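(* Let $n>1$, let $V_1,\dots,V_N$ be $N$ subspaces of $\mathbb R^n$, and let $1\le p_j\le\infty$ for $j=1,\dots,N$. Let $\mathfrak A=\mathfrak C(\mathbb R^n)$ be the Clifford algebra over $\mathbb R^n$ with its tracial state $\tau$. For each $j$ let $\mathfrak A_j=\mathfrak C(V_j)$ be the Clifford algebra over $V_j$ with the inner product $V_j$ inherits from $\mathbb R^n$, equipped with its tracial state $\tau_j$, and let $\phi_j:\mathfrak A_j\to\mathfrak A$ be the natural homomorphism induced by the natural embedding of $V_j$ into $\mathbb R^n$. Let $P_j$ be the orthogonal projection onto $V_j$ in $\mathbb R^n$. Then $$\tau\left(\exp\left[\sum_{j=1}^N\phi_j(H_j)\right]\right)\le\prod_{j=1}^N\left(\tau_j\left(e^{p_jH_j}\right)\right)^{1/p_j}$$ holds for all self-adjoint operators $H_j\in\mathfrak A_j$, $j=1,\dots,N$, if and only if $$\sum_{j=1}^N\frac1{p_j}P_j\le I_{\mathbb R^n}.$$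
   Context: The Clifford algebra $\mathfrak C=\mathfrak C(\mathbb R^n)$ is the complex operator algebra on $(\mathbb C^2)^{\otimes n}$ generated by $n$ self-adjoint operators $Q_1,\dots,Q_n$ satisfying $Q_iQ_j+Q_jQ_i=2\delta_{i,j}I$. For $\alpha\in\{0,1\}^n$ put $Q^\alpha=Q_1^{\alpha_1}\cdots Q_n^{\alpha_n}$; the $2^n$ operators $Q^\alpha$ form a basis of $\mathfrak C$. The tracial state is $\tau\left(\sum_\alpha x_\alpha Q^\alpha\right)=x_{(0,\dots,0)}$, which equals the normalized trace $2^{-n}\mathrm{Tr}$ on $(\mathbb C^2)^{\otimes n}$. With $\mathcal J(x)=\sum_{j=1}^n x_jQ_j$ for $x\in\mathbb R^n$, for a subspace $V\subset\mathbb R^n$ with orthonormal basis $\{u_1,\dots,u_m\}$, $\mathfrak C(V)$ is the subalgebra of $\mathfrak C$ generated by $I$ and $\mathcal J(u_1),\dots,\mathcal J(u_m)$ (it is isomorphic to $\mathfrak C(\mathbb R^m)$). The tracial state $\tau_j$ on $\mathfrak C(V_j)$ is the restriction of $\tau$, and $\phi_j$ is the inclusion. The inequality between matrices is in the sense of quadratic forms. If $p_j=\infty$, then $1/p_j=0$ and the factor $(\tau_j(e^{p_jH_j}))^{1/p_j}$ means the operator norm $\|e^{H_j}\|$. *)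

(* Defs.v *)
From HB Require Import structures.
From mathcomp Require Import all_boot all_order all_algebra.
From mathcomp Require Import complex.
From mathcomp Require Import all_classical all_reals all_analysis.

Set Implicit Arguments.
Unset Strict Implicit.
Unset Printing Implicit Defensive.

Import Order.TTheory GRing.Theory Num.Theory.
Import numFieldNormedType.Exports.
Local Open Scope classical_set_scope.
Local Open Scope complex_scope.
Local Open Scope ring_scope.

(* Subspaces of R^n are row spaces of matrices V : 'M[R]_n (mxalgebra), and
   vectors of R^n are row vectors; operators on (C^2)^{(x) n} are matrices of
   size 2 ^ n over C = R[i] acting on column vectors. *)

Section Euclidean.
Context {R : realType} {n : nat}.
Implicit Types V A B : 'M[R]_n.

(* kermx V^T is the row space of all u with u *m V^T = 0, that is, V^\perp. *)
Definition orthproj V : 'M[R]_n := proj_mx <<V>>%MS (kermx V^T).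

Definition qform_le A B : Prop :=
  forall x : 'rV[R]_n, (x *m A *m x^T) 0 0 <= (x *m B *m x^T) 0 0.

Definition orthonormal_basis m (u : 'M[R]_(m, n)) V : Prop :=
  u *m u^T = 1%:M /\ (u == V)%MS.

Lemma orthproj_sub V (x : 'rV[R]_n) : (x *m orthproj V <= V)%MS.
Proof. by apply: submx_trans (proj_mx_sub _ _ _) _; rewrite genmxE. Qed.

Lemma orthproj_perp V (x : 'rV[R]_n) : (x - x *m orthproj V) *m V^T = 0.
Proof.
apply/sub_kermxP; apply: proj_mx_compl_sub.
have cap0 : (<<V>> :&: kermx V^T = 0)%MS.
  apply/eqP/rowV0P => v; rewrite sub_capmx genmxE.
  case/andP=> /submxP[w vE] /sub_kermxP v0.
  have : v *m v^T = 0 by rewrite {2}vE trmx_mul mulmxA v0 mul0mx.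
  move/matrixP/(_ 0 0); rewrite !mxE => /eqP.
  rewrite psumr_eq0 => [/allP vv|i _]; last by rewrite mxE -expr2 sqr_ge0.
  apply/rowP=> i; rewrite mxE; have := vv i (mem_index_enum _).
  by rewrite /= mxE mulf_eq0 orbb => /eqP.
rewrite submx_full // /row_full eqn_leq rank_leq_col /=.
have := mxrank_sum_cap <<V>>%MS (kermx V^T).
rewrite cap0 mxrank0 addn0 => ->.
by rewrite mxrank_gen mxrank_ker mxrank_tr subnKC // rank_leq_row.
Qed.

End Euclidean.

Section Operators.
Context {R : realType} {d : nat}.
Implicit Types A : 'M[R[i]]_d.

(* Power series, summed entrywise in the real and imaginary parts. *)
Definition expmx A : 'M[R[i]]_d :=
  \matrix_(i, j)
    (limn (series (fun k => complex.Re ((k`!%:R^-1 *: A ^+ k) i j)))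
     +i* limn (series (fun k => complex.Im ((k`!%:R^-1 *: A ^+ k) i j)))).

Definition l2norm (v : 'cV[R[i]]_d) : R :=
  Num.sqrt (\sum_i Normc.normc (v i 0) ^+ 2).

Definition opnorm A : R :=
  sup [set l2norm (A *m v) | v in [set v | l2norm v <= 1]].

Definition subalgebra (S : set 'M[R[i]]_d) : Prop :=
  [/\ S 1%:M,
      forall (a : R[i]) A B, S A -> S B -> S (a *: A + B)
    & forall A B, S A -> S B -> S (A *m B)].

Definition gen_algebra (G : set 'M[R[i]]_d) : set 'M[R[i]]_d :=
  smallest subalgebra G.

End Operators.

Section Clifford.
Context {R : realType} {n : nat}.
Implicit Types (Q : 'I_n -> 'M[R[i]]_(2 ^ n)) (al : {ffun 'I_n -> bool}).

Definition Qpow Q al : 'M[R[i]]_(2 ^ n) := \prod_(i < n) Q i ^+ al i.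

Definition tau (x : 'M[R[i]]_(2 ^ n)) : R[i] := (2 ^ n)%:R^-1 * \tr x.

(* For odd n the anticommutation relations alone force neither the
   independence of the Q^alpha nor that the normalized trace reads off the
   coefficient of Q^0 (e.g. n = 1, Q_1 = I), whence the last two fields. *)
Record clifford_generators Q : Prop := CliffordGenerators {
  cliff_selfadj : forall i, Q i \is hermsymmx;
  cliff_anticomm : forall i j,
    Q i *m Q j + Q j *m Q i = (2 * (i == j)%:R)%:M;
  cliff_free : forall x : {ffun 'I_n -> bool} -> R[i],
    \sum_al x al *: Qpow Q al = 0 -> forall al, x al = 0;
  cliff_tau : forall x : {ffun 'I_n -> bool} -> R[i],
    tau (\sum_al x al *: Qpow Q al) = x [ffun=> false]
}.

Definition Jmap Q (x : 'rV[R]_n) : 'M[R[i]]_(2 ^ n) :=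
  \sum_j (x 0 j)%:C *: Q j.

(* The set does not depend on the orthonormal basis u; it is realized inside
   C(R^n), so that tau_j is the restriction of tau and phi_j the inclusion. *)
Definition cliff_sub Q (V : 'M[R]_n) : set 'M[R[i]]_(2 ^ n) :=
  [set x | exists m (u : 'M[R]_(m, n)), orthonormal_basis u V /\
     gen_algebra [set Jmap Q (row i u) | i in [set: 'I_m]] x].

(* (tau (e^{pH}))^{1/p}, and ||e^H|| for p = +oo; the value at -oo is
   irrelevant. *)
Definition exp_norm (p : \bar R) (H : 'M[R[i]]_(2 ^ n)) : R :=
  match p with
  | r%:E%E => complex.Re (tau (expmx (r%:C *: H))) `^ r^-1
  | _ => opnorm (expmx H)
  end.

End Clifford.

(* Jordan-Wigner: Q_j e_s = (-1)^{#{i < j | s_i = 1}} e_{s + delta_j} on the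
   basis (e_s) of (C^2)^{(x) n} indexed by s in {0,1}^n. *)
Section JordanWigner.
Context {R : realType} {n : nat}.
Local Notation bits := {ffun 'I_n -> bool}.
Implicit Types (a b s t : bits) (f g : bits -> bool).

Let bxor a b : bits := [ffun i => a i (+) b i].
Let bdelta (j : 'I_n) : bits := [ffun i => i == j].

Lemma card_bits : #|{: bits}| = (2 ^ n)%N.
Proof. by rewrite card_ffun card_bool card_ord. Qed.

Let bt (i : 'I_(2 ^ n)) : bits := enum_val (cast_ord (esym card_bits) i).
Let tb (s : bits) : 'I_(2 ^ n) := cast_ord card_bits (enum_rank s).

Let btK : cancel bt tb.
Proof. by move=> i; rewrite /bt /tb enum_valK cast_ordKV. Qed.
Let tbK : cancel tb bt.
Proof. by move=> i; rewrite /bt /tb cast_ordK enum_rankK. Qed.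

Let bxorC a b : bxor a b = bxor b a.
Proof. by apply/ffunP=> i; rewrite !ffunE addbC. Qed.
Let bxorA a b s : bxor a (bxor b s) = bxor (bxor a b) s.
Proof. by apply/ffunP=> i; rewrite !ffunE addbA. Qed.
Let bxorK a b : bxor (bxor a b) b = a.
Proof. by apply/ffunP=> i; rewrite !ffunE -addbA addbb addbF. Qed.
Let bxor0 a : bxor a [ffun=> false] = a.
Proof. by apply/ffunP=> i; rewrite !ffunE addbF. Qed.

Definition signed_shift a f : 'M[R[i]]_(2 ^ n) :=
  \matrix_(i, j) ((bt i == bxor (bt j) a)%:R * (-1) ^+ f (bt j)).

Lemma signed_shiftM a b f g :
  signed_shift a f *m signed_shift b g =
  signed_shift (bxor a b) (fun s => f (bxor s b) (+) g s).
Proof.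
apply/matrixP=> i j; rewrite !mxE (bigD1 (tb (bxor (bt j) b))) //= big1 => [|k nk].
  rewrite !mxE !tbK eqxx mul1r addr0 -bxorA [bxor b a]bxorC.
  by rewrite -mulrA signr_addb.
rewrite !mxE [bt k == _](introF eqP) ?mul0r ?mulr0 // => e.
by rewrite -e btK eqxx in nk.
Qed.

Definition jw_sign (j : 'I_n) s := \big[addb/false]_(k < n | (k < j)%N) s k.
Definition jordan_wigner j := signed_shift (bdelta j) (jw_sign j).

Let jw_sign_delta j k s :
  jw_sign j (bxor s (bdelta k)) = jw_sign j s (+) (k < j)%N.
Proof.
rewrite /jw_sign (eq_bigr (fun i => s i (+) (i == k))); last first.
  by move=> i _; rewrite !ffunE.
rewrite big_split /=; congr addb; case: (ltnP k j) => kj.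
  rewrite (bigD1 k) //= eqxx big1 // => i /andP[_ /negPf//].
by rewrite big1 // => i ij; apply/negP => /eqP ik; rewrite ik ltnNge kj in ij.
Qed.

Let signed_shift0 f : (forall s, f s = false) ->
  signed_shift [ffun=> false] f = 1%:M.
Proof.
move=> f0; apply/matrixP=> i j; rewrite !mxE f0 mulr1 bxor0.
by rewrite (can_eq btK).
Qed.

Let Qpow_jw (al : bits) : exists f, Qpow jordan_wigner al = signed_shift al f.
Proof.
have [f ->] : exists f, Qpow jordan_wigner al = signed_shift
    [ffun k => \big[addb/false]_(i < n) (al i && (k == i))] f.
  rewrite /Qpow; elim: (index_enum _) => [|i r [f IH]].
    exists (fun=> false); rewrite big_nil -[LHS](@signed_shift0 (fun=> false)) //.
    by congr signed_shift; apply/ffunP=> k; rewrite !ffunE big_nil.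
  rewrite big_cons {}IH; case ali: (al i).
    rewrite expr1 -[_ * _]/(_ *m _) signed_shiftM; eexists.
    by congr signed_shift; apply/ffunP=> k; rewrite !ffunE big_cons ali.
  exists f; rewrite expr0 mul1r; congr signed_shift; apply/ffunP=> k.
  by rewrite !ffunE big_cons ali.
exists f; congr signed_shift; apply/ffunP=> k; rewrite ffunE (bigD1 k) //= eqxx andbT.
by rewrite big1 ?addbF // => i /negPf ik; rewrite eq_sym ik andbF.
Qed.

Lemma jordan_wignerP : clifford_generators jordan_wigner.
Proof.
have z0 : [ffun=> false] = [ffun=> false] :> bits by [].
split.
- move=> j; apply/is_hermitianmxP; rewrite expr0 scale1r.
  apply/matrixP=> s t; rewrite !mxE rmorphM rmorph_nat rmorphXn rmorphN1.
  have -> : (bt t == bxor (bt s) (bdelta j)) = (bt s == bxor (bt t) (bdelta j)).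
    by apply/eqP/eqP => ->; rewrite bxorK.
  by case: eqP => [->|]; rewrite ?mul0r // jw_sign_delta ltnn addbF.
- move=> i j; rewrite !signed_shiftM; case: (eqVneq i j) => [<-|ij].
    have -> : bxor (bdelta i) (bdelta i) = [ffun=> false].
      by apply/ffunP=> k; rewrite !ffunE addbb.
    rewrite signed_shift0; last first.
      by move=> s; rewrite jw_sign_delta ltnn addbF addbb.
    by rewrite mulr1 -[in LHS]raddfD.
  rewrite mulr0 raddf0 [bxor (bdelta j) _]bxorC.
  apply/matrixP=> s t; rewrite !mxE -mulrDr !jw_sign_delta.
  have := ij; rewrite -val_eqE neq_ltn => /orP[] lt; rewrite lt ltnNge (ltnW lt) /=.
    by case: (jw_sign i _); case: (jw_sign j _);
      rewrite ?expr0 ?expr1 ?subrr ?addNr ?mulr0.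
  by case: (jw_sign i _); case: (jw_sign j _);
    rewrite ?expr0 ?expr1 ?subrr ?addNr ?mulr0.
- move=> x x0 al; move/matrixP: x0 => /(_ (tb al) (tb [ffun=> false])).
  rewrite summxE (bigD1 al) //= big1 => [|be neq].
    have [f ->] := Qpow_jw al; rewrite !mxE !tbK addr0 bxorC bxor0 eqxx mul1r.
    by move/eqP; rewrite mulf_eq0 signr_eq0 orbF => /eqP.
  have [f ->] := Qpow_jw be; rewrite !mxE !tbK bxorC bxor0 eq_sym (negPf neq).
  by rewrite mul0r mulr0.
- move=> x; rewrite /tau raddf_sum (bigD1 [ffun=> false]) //= big1 => [|al al0].
    rewrite addr0 linearZ /= /Qpow big1 => [|i _]; last by rewrite ffunE.
    rewrite mxtrace1 mulrCA mulVf ?mulr1 // pnatr_eq0 -lt0n expn_gt0 //.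
  rewrite linearZ /=; have [f ->] := Qpow_jw al.
  rewrite /mxtrace big1 ?mulr0 // => i _; rewrite mxE.
  case: eqP => [e|]; rewrite ?mul0r //; case/eqP: al0.
  apply/ffunP => k; move/ffunP: e => /(_ k); rewrite !ffunE.
  by case: (bt i k); case: (al k).
Qed.

End JordanWigner.

(* Main.v *)
(* Sufficiency.  By Gibbs' variational principle the inequality is dual to
   superadditivity of entropy: sum_j (1/p_j) Ent(E_j rho) <= Ent(rho) for every density
   rho, where E_j is the conditional expectation onto C(V_j).  Along the heat flow
   generated by the number operator both sides decrease to 0, and the derivative of
   Ent is (minus) the Fisher information (1/2) sum_k D(R_k rho || rho), where R_u is the
   automorphism reflecting u.  The relative entropy D(R_u rho || rho) decreases
   under E_j when u is in V_j, and u |-> D(R_u rho || rho) extends to a positive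
   quadratic form on R^n, so the inequality between Fisher informations follows from
   sum_j (1/p_j) P_j <= I.  The flow is discretized by Euler steps, so that no matrix
   function has to be differentiated.  The reflections R_u need the grading
   automorphism to be unitarily implemented, which is achieved by passing to
   A |-> diag(A, A') with A' the graded image of A.

   Necessity.  Take H_j = t (1/p_j) J(P_j x); as J(v)^2 = |v|^2, the second-order terms
   at t = 0 give |S x|^2 <= <x, S x> for S = sum_j (1/p_j) P_j, whence S <= I. *)
Require Import Defs.
From HB Require Import structures.
From mathcomp Require Import all_boot all_order all_algebra.
From mathcomp Require Import complex.
From mathcomp Require Import all_classical all_reals all_analysis.
From mathcomp Require Import ring lra.

Set Implicit Arguments.
Unset Strict Implicit.
Unset Printing Implicit Defensive.

Import Order.TTheory GRing.Theory Num.Theory.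
Import numFieldNormedType.Exports.
Local Open Scope classical_set_scope.
Local Open Scope complex_scope.
Local Open Scope ring_scope.

(** The trace [rtr] is not normalized, so a density is a positive matrix whose trace is the
    dimension [D]. Monotonicity of the Fisher information under E_j needs only midpoint convexity of
    A |-> D(X A X^* || A) for fixed X: E_j is an iterated average over single reflections R_w with w
    orthogonal to V_j, and each of them changes the matrix implementing R_u by a sign at most. The
    convexity comes from Riemann sums whose terms are suprema of functions affine in A. An Euler
    step of size e at time k costs an error of order e^2 (1 - e)^(2k); a geometric series sums these
    errors to O(e) uniformly in the number of steps, so e is fixed first and the number of steps
    afterwards. The grading automorphism is not inner for odd n; the doubling implements it in the
    same way for every n. For p_j = oo the entropy term has weight 0, and the variational principle
    for H_j is replaced by Tr(B H) <= Tr(B) max spec(H). *)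

Local Notation conjC := Num.Def.conjC.

(* Locked: unification otherwise unfolds adjoints when rewriting with mulmxA. *)
HB.lock Definition adj (R : realType) m n (A : 'M[R[i]]_(m, n)) : 'M[R[i]]_(n, m) :=
  map_mx conjC A^T.

HB.lock Definition dmx (R : realType) D (a : 'I_D -> R) : 'M[R[i]]_D :=
  diag_mx (\row_i (a i)%:C).

HB.lock Definition eigmx (R : realType) D (A : 'M[R[i]]_D) : 'M[R[i]]_D := spectralmx A.

HB.lock Definition eigs (R : realType) D (A : 'M[R[i]]_D) (i : 'I_D) : R :=
  complex.Re (spectral_diag A 0 i).

HB.lock Definition fmx (R : realType) D (f : R -> R) (A : 'M[R[i]]_D) : 'M[R[i]]_D :=
  adj (eigmx A) *m dmx (f \o eigs A) *m eigmx A.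

(** * Adjoints and the real part of the trace *)

Section Adjoint.
Context {R : realType}.
Local Notation C := R[i].

Definition rtr D (A : 'M[C]_D) : R := complex.Re (\tr A).

Definition nsq (z : C) : R := complex.Re z ^+ 2 + complex.Im z ^+ 2.

Lemma ReD (x y : C) : complex.Re (x + y) = complex.Re x + complex.Re y.
Proof. by case: x => ? ?; case: y. Qed.

Lemma ImD (x y : C) : complex.Im (x + y) = complex.Im x + complex.Im y.
Proof. by case: x => ? ?; case: y. Qed.

Lemma ReN (x : C) : complex.Re (- x) = - complex.Re x.
Proof. by case: x. Qed.

Lemma ReZ (a : R) (x : C) : complex.Re (a%:C * x) = a * complex.Re x.
Proof. by case: x => x1 x2 /=; rewrite mul0r subr0. Qed.

Lemma ImZ (a : R) (x : C) : complex.Im (a%:C * x) = a * complex.Im x.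
Proof. by case: x => x1 x2 /=; rewrite mul0r addr0. Qed.

Lemma Re_sum (I : Type) (r : seq I) (P : pred I) (F : I -> C) :
  complex.Re (\sum_(i <- r | P i) F i) = \sum_(i <- r | P i) complex.Re (F i).
Proof. by apply: (big_morph _ ReD). Qed.

Lemma Im_sum (I : Type) (r : seq I) (P : pred I) (F : I -> C) :
  complex.Im (\sum_(i <- r | P i) F i) = \sum_(i <- r | P i) complex.Im (F i).
Proof. by apply: (big_morph _ ImD). Qed.

Lemma conjC_real (a : R) : conjC (a%:C : C) = a%:C.
Proof. by apply: conj_Creal; rewrite complex_real. Qed.

Lemma nsqE (z : C) : z * conjC z = (nsq z)%:C.
Proof. by rewrite -normCK -add_Re2_Im2. Qed.

Lemma nsq_ge0 (z : C) : 0 <= nsq z.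
Proof. by rewrite addr_ge0 ?sqr_ge0. Qed.

Lemma nsqNJ (z : C) : nsq (- conjC z) = nsq z.
Proof. by case: z => a b; rewrite /nsq /=; ring. Qed.

Lemma adjE m n (A : 'M[C]_(m, n)) i j : adj A i j = conjC (A j i).
Proof. by rewrite adj.unlock !mxE. Qed.

Lemma adjK m n (A : 'M[C]_(m, n)) : adj (adj A) = A.
Proof. by apply/matrixP=> i j; rewrite !adjE conjCK. Qed.

Lemma adjD m n (A B : 'M[C]_(m, n)) : adj (A + B) = adj A + adj B.
Proof. by apply/matrixP=> i j; rewrite adjE !mxE !adjE rmorphD. Qed.

Lemma adjN m n (A : 'M[C]_(m, n)) : adj (- A) = - adj A.
Proof. by apply/matrixP=> i j; rewrite adjE !mxE !adjE rmorphN. Qed.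

Lemma adjB m n (A B : 'M[C]_(m, n)) : adj (A - B) = adj A - adj B.
Proof. by rewrite adjD adjN. Qed.

Lemma adj_scale m n (a : C) (A : 'M[C]_(m, n)) : adj (a *: A) = conjC a *: adj A.
Proof. by apply/matrixP=> i j; rewrite adjE !mxE !adjE rmorphM. Qed.

Lemma adj_scaler m n (a : R) (A : 'M[C]_(m, n)) : adj (a%:C *: A) = a%:C *: adj A.
Proof. by rewrite adj_scale conjC_real. Qed.

Lemma adj0 m n : adj (0 : 'M[C]_(m, n)) = 0.
Proof. by apply/matrixP=> i j; rewrite adjE !mxE rmorph0. Qed.

Lemma adj_sum m n (I : Type) (r : seq I) (P : pred I) (F : I -> 'M[C]_(m, n)) :
  adj (\sum_(i <- r | P i) F i) = \sum_(i <- r | P i) adj (F i).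
Proof. by apply: (big_morph (@adj R m n) (@adjD m n) (@adj0 m n)). Qed.

Lemma adjM m n p (A : 'M[C]_(m, n)) (B : 'M[C]_(n, p)) :
  adj (A *m B) = adj B *m adj A.
Proof. by rewrite adj.unlock trmx_mul map_mxM. Qed.

Lemma adj_1 D : adj (1%:M : 'M[C]_D) = 1%:M.
Proof. by rewrite adj.unlock trmx1 map_mx1. Qed.

Lemma hermP D (A : 'M[C]_D) : A \is hermsymmx <-> adj A = A.
Proof.
split; first by move/is_hermitianmxP; rewrite expr0 scale1r adj.unlock => <-.
by move=> h; apply/is_hermitianmxP; rewrite expr0 scale1r; move: h; rewrite adj.unlock => ->.
Qed.

Lemma rtrD D (A B : 'M[C]_D) : rtr (A + B) = rtr A + rtr B.
Proof. by rewrite /rtr mxtraceD ReD. Qed.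

Lemma rtrN D (A : 'M[C]_D) : rtr (- A) = - rtr A.
Proof. by rewrite /rtr raddfN ReN. Qed.

Lemma rtrB D (A B : 'M[C]_D) : rtr (A - B) = rtr A - rtr B.
Proof. by rewrite rtrD rtrN. Qed.

Lemma rtrZ D (a : R) (A : 'M[C]_D) : rtr (a%:C *: A) = a * rtr A.
Proof. by rewrite /rtr mxtraceZ ReZ. Qed.

Lemma rtr0 D : rtr (0 : 'M[C]_D) = 0.
Proof. by rewrite /rtr mxtrace0. Qed.

Lemma rtr1 D : rtr (1%:M : 'M[C]_D) = D%:R.
Proof. by rewrite /rtr mxtrace1 -(rmorph_nat (real_complex R)). Qed.

Lemma rtr_sum D (I : Type) (r : seq I) (P : pred I) (F : I -> 'M[C]_D) :
  rtr (\sum_(i <- r | P i) F i) = \sum_(i <- r | P i) rtr (F i).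
Proof. by apply: (big_morph (@rtr D) (@rtrD D) (@rtr0 D)). Qed.

Lemma rtrC m n (A : 'M[C]_(m, n)) (B : 'M[C]_(n, m)) : rtr (A *m B) = rtr (B *m A).
Proof. by rewrite /rtr mxtrace_mulC. Qed.

End Adjoint.

(** * Functional calculus of Hermitian matrices *)

Section FunctionalCalculus.
Context {R : realType} {D : nat}.
Local Notation C := R[i].
Implicit Types (A B X Y P W : 'M[C]_D) (f g : R -> R) (a b : 'I_D -> R).

Lemma dmxE a i j : dmx a i j = (a i)%:C *+ (i == j).
Proof. by rewrite dmx.unlock !mxE. Qed.

Lemma mul_dmx a m (X : 'M[C]_(D, m)) i j : (dmx a *m X) i j = (a i)%:C * X i j.
Proof. by rewrite dmx.unlock mul_diag_mx !mxE. Qed.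

Lemma mul_mx_dmx m (X : 'M[C]_(m, D)) a i j : (X *m dmx a) i j = X i j * (a j)%:C.
Proof. by rewrite dmx.unlock mul_mx_diag !mxE. Qed.

Lemma adj_dmx a : adj (dmx a) = dmx a.
Proof.
apply/matrixP=> i j; rewrite adjE !dmxE eq_sym.
by case: eqP => [->|_]; rewrite ?mulr1n ?mulr0n ?conjC_real ?rmorph0.
Qed.

Lemma dmxM a b : dmx a *m dmx b = dmx (fun i => a i * b i).
Proof. by apply/matrixP=> i j; rewrite mul_dmx !dmxE rmorphM mulrnAr. Qed.

Lemma unitaryLR P : P *m adj P = 1%:M -> adj P *m P = 1%:M.
Proof. exact: mulmx1C. Qed.

Lemma spectral_adjr A : eigmx A *m adj (eigmx A) = 1%:M.
Proof. by rewrite adj.unlock eigmx.unlock; apply/unitarymxP/spectral_unitarymx. Qed.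

Lemma spectral_adjl A : adj (eigmx A) *m eigmx A = 1%:M.
Proof. exact/unitaryLR/spectral_adjr. Qed.

Lemma spectral_dec A : adj A = A -> A = adj (eigmx A) *m dmx (eigs A) *m eigmx A.
Proof.
move/hermP => hA; have /hermitian_normalmx /orthomx_spectralP AE := hA.
rewrite {1}AE invmx_unitary ?spectral_unitarymx // adj.unlock eigmx.unlock.
congr (_ *m _ *m _); rewrite dmx.unlock; congr diag_mx; apply/rowP => i.
by rewrite mxE eigs.unlock RRe_real //; have /mxOverP -> := hermitian_spectral_diag_real hA.
Qed.

(** The change of basis M = P U^* intertwines the two diagonal matrices, so M i j vanishes unless
    [a i = b j]. Hence it also intertwines their images under an arbitrary f, and the functional
    calculus does not depend on the diagonalization. *)
Lemma fmx_unique P a A f : P *m adj P = 1%:M -> A = adj P *m dmx a *m P ->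
  fmx f A = adj P *m dmx (f \o a) *m P.
Proof.
move=> uP AE; have hA : adj A = A by rewrite AE !adjM adjK adj_dmx mulmxA.
have := spectral_dec hA; rewrite {1}AE fmx.unlock.
set U := eigmx A; set b := eigs A => E.
have uU : U *m adj U = 1%:M := spectral_adjr A.
pose M := P *m adj U.
have ME : dmx a *m M = M *m dmx b.
  have := congr1 (fun X => P *m X *m adj U) E.
  by rewrite /M !mulmxA uP mul1mx -!mulmxA uU mulmx1 !mulmxA.
have : dmx (f \o a) *m M = M *m dmx (f \o b).
  apply/matrixP => i j; move/matrixP/(_ i j): ME.
  rewrite !mul_dmx !mul_mx_dmx mulrC /=; have [->|nz] := eqVneq (M i j) 0.
    by rewrite !mul0r mulr0.
  by move/(mulfI nz) => /complexI ->; rewrite mulrC.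
move/(congr1 (fun X => adj P *m X *m U)).
rewrite /M !mulmxA (unitaryLR uP) mul1mx -!mulmxA (unitaryLR uU) mulmx1 => ->.
by rewrite !mulmxA.
Qed.

Lemma fmx_id A : adj A = A -> fmx id A = A.
Proof. by move=> hA; rewrite [RHS](spectral_dec hA) fmx.unlock. Qed.

Lemma adj_fmx f A : adj (fmx f A) = fmx f A.
Proof. by rewrite fmx.unlock !adjM adjK adj_dmx mulmxA. Qed.

Lemma fmx_comp f g A : fmx f (fmx g A) = fmx (f \o g) A.
Proof. by rewrite (fmx_unique _ (spectral_adjr A) (a := g \o eigs A)) fmx.unlock. Qed.

Lemma fmxM f g A : fmx f A *m fmx g A = fmx (fun x => f x * g x) A.
Proof.
rewrite fmx.unlock !mulmxA -(mulmxA _ (eigmx A)) spectral_adjr mulmx1.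
by rewrite -(mulmxA _ (dmx _) (dmx _)) dmxM.
Qed.

Lemma eq_fmx_eigs f g A : (forall i, f (eigs A i) = g (eigs A i)) -> fmx f A = fmx g A.
Proof.
move=> fg; rewrite fmx.unlock; congr (_ *m _ *m _).
by apply/matrixP => i j; rewrite !dmxE /= fg.
Qed.

Lemma fmxD f g A : fmx (fun x => f x + g x) A = fmx f A + fmx g A.
Proof.
rewrite fmx.unlock -mulmxDl -mulmxDr; congr (_ *m _ *m _).
by apply/matrixP=> i j; rewrite dmxE !mxE !dmxE /= rmorphD mulrnDl.
Qed.

Lemma fmxZ (a : R) f A : fmx (fun x => a * f x) A = a%:C *: fmx f A.
Proof.
rewrite fmx.unlock scalemxAl scalemxAr; congr (_ *m _ *m _).
by apply/matrixP=> i j; rewrite dmxE !mxE !dmxE /= rmorphM mulrnAr.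
Qed.

Lemma dmx_cst (a : R) : dmx (fun=> a) = a%:C%:M :> 'M[C]_D.
Proof. by apply/matrixP=> i j; rewrite dmxE mxE. Qed.

Lemma fmx_cst (a : R) A : fmx (fun=> a) A = a%:C%:M.
Proof.
rewrite fmx.unlock [dmx _]dmx_cst -mulmxA mul_scalar_mx -scalemxAr spectral_adjl.
by rewrite scalemx1.
Qed.

Lemma fmx_conj f A W : adj A = A -> W *m adj W = 1%:M ->
  fmx f (W *m A *m adj W) = W *m fmx f A *m adj W.
Proof.
move=> hA uW; rewrite (@fmx_unique (eigmx A *m adj W) (eigs A)).
- by rewrite !adjM adjK fmx.unlock !mulmxA.
- by rewrite adjM adjK mulmxA -(mulmxA _ (adj W)) (unitaryLR uW) mulmx1 spectral_adjr.
- by rewrite {1}(spectral_dec hA) !adjM adjK !mulmxA.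
Qed.

Lemma rtr_fmx_mul2 f A X g B Y :
  rtr (fmx f A *m X *m fmx g B *m adj Y) =
  \sum_i \sum_j f (eigs A i) * g (eigs B j) *
    complex.Re ((eigmx A *m X *m adj (eigmx B)) i j *
      conjC ((eigmx A *m Y *m adj (eigmx B)) i j)).
Proof.
rewrite fmx.unlock; set U := eigmx A; set V := eigmx B.
pose Z := U *m X *m adj V; pose T := U *m Y *m adj V.
have -> : rtr (adj U *m dmx (f \o eigs A) *m U *m X *m
    (adj V *m dmx (g \o eigs B) *m V) *m adj Y) =
  rtr (dmx (f \o eigs A) *m Z *m dmx (g \o eigs B) *m adj T).
  by rewrite [adj T]adjM [adj (U *m Y)]adjM adjK /Z -!mulmxA [LHS]rtrC -!mulmxA.
rewrite /rtr /mxtrace Re_sum; apply: eq_bigr => i _.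
rewrite mxE Re_sum; apply: eq_bigr => j _.
rewrite mul_mx_dmx mul_dmx adjE -/Z -/T -ReZ; congr complex.Re.
rewrite rmorphM /=; ring.
Qed.

(** Turns trace inequalities into scalar inequalities between pairs of eigenvalues, tested against
    nonnegative weights. *)
Lemma rtr_fmx_mul f A X g B :
  rtr (fmx f A *m X *m fmx g B *m adj X) =
  \sum_i \sum_j f (eigs A i) * g (eigs B j) *
    nsq ((eigmx A *m X *m adj (eigmx B)) i j).
Proof.
rewrite rtr_fmx_mul2; apply: eq_bigr => i _; apply: eq_bigr => j _.
by rewrite nsqE.
Qed.

Lemma rtr_fmx f A : rtr (fmx f A) = \sum_i f (eigs A i).
Proof.
rewrite fmx.unlock rtrC mulmxA spectral_adjr mul1mx /rtr /mxtrace Re_sum.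
by apply: eq_bigr => i _; rewrite dmxE eqxx.
Qed.

End FunctionalCalculus.

(** * Hermitian forms and lower bounds on spectra *)

Section QuadraticForms.
Context {R : realType} {D : nat}.
Local Notation C := R[i].
Implicit Types (A B X Y W : 'M[C]_D) (f g : R -> R) (v : 'rV[C]_D) (dl : R).

Definition qf A v : R := rtr (v *m A *m adj v).

(** An explicit bound instead of mere positivity: it survives unitary conjugation, averaging and
    Euler steps, and its inverse is the constant in the error term of [klein_reverse]. *)
Definition hlb dl A : Prop :=
  adj A = A /\ forall v, dl * qf 1%:M v <= qf A v.

Lemma qfD A B v : qf (A + B) v = qf A v + qf B v.
Proof. by rewrite /qf mulmxDr mulmxDl rtrD. Qed.

Lemma qfZ (a : R) A v : qf (a%:C *: A) v = a * qf A v.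
Proof. by rewrite /qf -scalemxAr -scalemxAl rtrZ. Qed.

Lemma qf1E v : qf 1%:M v = \sum_i nsq (v 0 i).
Proof.
rewrite /qf mulmx1 /rtr /mxtrace big_ord_recl big_ord0 addr0 mxE Re_sum.
by apply: eq_bigr => i _; rewrite adjE nsqE.
Qed.

Lemma qf1_ge0 v : 0 <= qf 1%:M v.
Proof. by rewrite qf1E sumr_ge0 // => i _; apply: nsq_ge0. Qed.

Lemma qf_conj W A v : qf (W *m A *m adj W) v = qf A (v *m W).
Proof. by rewrite /qf adjM !mulmxA. Qed.

Lemma qf_dmx (a : 'I_D -> R) v : qf (dmx a) v = \sum_i a i * nsq (v 0 i).
Proof.
rewrite /qf /rtr /mxtrace big_ord_recl big_ord0 addr0 mxE Re_sum.
by apply: eq_bigr => i _; rewrite mul_mx_dmx adjE mulrAC nsqE mulrC ReZ.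
Qed.

Lemma qf_fmx f A v :
  qf (fmx f A) v = \sum_i f (eigs A i) * nsq ((v *m adj (eigmx A)) 0 i).
Proof. by rewrite fmx.unlock -{2}(adjK (eigmx A)) qf_conj qf_dmx. Qed.

Lemma qf1_unitary W v : W *m adj W = 1%:M -> qf 1%:M (v *m W) = qf 1%:M v.
Proof. by move=> uW; rewrite /qf !mulmx1 adjM mulmxA -(mulmxA v) uW mulmx1. Qed.

Lemma adj_rowE m p (P : 'M[C]_(m, p)) i : adj (row i P) = adj P *m delta_mx i 0.
Proof.
rewrite rowE adjM; congr (_ *m _); apply/matrixP=> a b.
by rewrite adjE !mxE rmorph_nat andbC.
Qed.

Lemma qf_row A W i : qf A (row i W) = complex.Re ((W *m A *m adj W) i i).
Proof.
rewrite /qf adj_rowE rowE -!mulmxA -rowE !mulmxA -colE /rtr /mxtrace.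
by rewrite big_ord_recl big_ord0 addr0 !mxE.
Qed.

Lemma hlb_eigs dl A i : hlb dl A -> dl <= eigs A i.
Proof.
move=> [hA /(_ (row i (eigmx A)))]; rewrite !qf_row mulmx1 spectral_adjr.
rewrite {2}(spectral_dec hA) !mulmxA spectral_adjr mul1mx -mulmxA spectral_adjr.
by rewrite mulmx1 dmxE mxE eqxx mulr1.
Qed.

Lemma hlb_fmx dl f A : (forall i, dl <= f (eigs A i)) -> hlb dl (fmx f A).
Proof.
move=> h; split; first exact: adj_fmx.
move=> v; rewrite qf_fmx -(@qf1_unitary (adj (eigmx A))) ?adjK ?spectral_adjl //.
rewrite qf1E mulr_sumr; apply: ler_sum => i _.
by rewrite ler_wpM2r ?nsq_ge0.
Qed.

Lemma hlb_conj dl A W : W *m adj W = 1%:M -> hlb dl A -> hlb dl (W *m A *m adj W).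
Proof.
move=> uW [hA lA]; split; first by rewrite !adjM adjK hA mulmxA.
by move=> v; rewrite qf_conj -(qf1_unitary v uW).
Qed.

Lemma hlbD dl dl' A B : hlb dl A -> hlb dl' B -> hlb (dl + dl') (A + B).
Proof.
move=> [hA lA] [hB lB]; split; first by rewrite adjD hA hB.
by move=> v; rewrite qfD mulrDl lerD.
Qed.

Lemma hlbZ dl (a : R) A : 0 <= a -> hlb dl A -> hlb (a * dl) (a%:C *: A).
Proof.
move=> a0 [hA lA]; split; first by rewrite adj_scaler hA.
by move=> v; rewrite qfZ -mulrA ler_wpM2l.
Qed.

Lemma hlb_mid dl A B : hlb dl A -> hlb dl B -> hlb dl (2^-1%:C *: (A + B)).
Proof.
move=> lA lB; have -> : dl = 2^-1 * (dl + dl) by field.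
by apply: hlbZ (hlbD lA lB); rewrite invr_ge0.
Qed.

End QuadraticForms.

(** * Entropy and Klein's inequality in both directions *)

Section Entropy.
Context {R : realType} {D : nat}.
Local Notation C := R[i].
Implicit Types (A B X Y W : 'M[C]_D) (f g : R -> R) (dl : R).

Lemma ln_le_subr1 (x : R) : 0 < x -> ln x <= x - 1.
Proof. by move=> x0; have := @le_ln1Dx R (x - 1); rewrite subrKC; apply; lra. Qed.

Definition xlnx (x : R) : R := x * ln x.

(** The sign is opposite to that of the von Neumann entropy; for positive definite matrices of trace
    [D] the value is nonnegative and vanishes at the identity. *)
Definition entropy A : R := rtr (fmx xlnx A).

Definition ovl A B i j : R := nsq ((eigmx A *m adj (eigmx B)) i j).

Lemma rtr_fmx2 f A g B :
  rtr (fmx f A *m fmx g B) = \sum_i \sum_j f (eigs A i) * g (eigs B j) * ovl A B i j.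
Proof. by have := rtr_fmx_mul f A 1%:M g B; rewrite adj_1 !mulmx1. Qed.

Lemma rtr_fmx2l f A B :
  rtr (fmx f A) = \sum_i \sum_j f (eigs A i) * ovl A B i j.
Proof.
rewrite -[fmx f A]mulmx1 -[1%:M](@fmx_cst R D 1 B) rtr_fmx2.
by under eq_bigr do under eq_bigr do rewrite mulr1.
Qed.

Lemma rtr_fmx2r A g B :
  rtr (fmx g B) = \sum_i \sum_j g (eigs B j) * ovl A B i j.
Proof.
rewrite -[fmx g B]mul1mx -[1%:M](@fmx_cst R D 1 A) rtr_fmx2.
by under eq_bigr do under eq_bigr do rewrite mul1r.
Qed.

Lemma mul_lnE A : adj A = A -> A *m fmx (@ln R) A = fmx xlnx A.
Proof. by move=> hA; rewrite -{1}(fmx_id hA) fmxM. Qed.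

Lemma entropyE A : adj A = A -> entropy A = rtr (A *m fmx (@ln R) A).
Proof. by move=> hA; rewrite mul_lnE. Qed.

(** In eigenbases of A and B this is a ln(b/a) <= b - a for each pair of eigenvalues. *)
Lemma klein dl A B : 0 < dl -> hlb dl A -> hlb dl B ->
  rtr A - rtr B <= entropy A - rtr (A *m fmx (@ln R) B).
Proof.
move=> d0 lA lB; have [hA _] := lA; have [hB _] := lB.
have -> : rtr A = \sum_i \sum_j eigs A i * ovl A B i j.
  by rewrite -{1}(fmx_id hA) (rtr_fmx2l _ _ B).
have -> : rtr B = \sum_i \sum_j eigs B j * ovl A B i j.
  by rewrite -{1}(fmx_id hB) (rtr_fmx2r A).
have -> : rtr (A *m fmx (@ln R) B) = \sum_i \sum_j eigs A i * ln (eigs B j) * ovl A B i j.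
  by rewrite -{1}(fmx_id hA) rtr_fmx2.
rewrite /entropy (rtr_fmx2l _ _ B).
rewrite -!sumrB; apply: ler_sum => i _; rewrite -!sumrB; apply: ler_sum => j _ /=.
rewrite -!mulrBl; apply: ler_wpM2r; first exact: nsq_ge0.
have a0 := lt_le_trans d0 (hlb_eigs i lA); have b0 := lt_le_trans d0 (hlb_eigs j lB).
set a := eigs A i in a0 *; set b := eigs B j in b0 *.
have := @ln_le_subr1 (b / a) (divr_gt0 b0 a0); rewrite ln_div ?posrE // /xlnx => h.
have := ler_wpM2l (ltW a0) h; have -> : a * (b / a - 1) = b - a by field; rewrite gt_eqF.
lra.
Qed.

(** The same logarithmic bound, multiplied by b instead of a, gives b ln(b/a) <= b - a + (b - a)^2 /
    a, and a >= dl. The remainder is quadratic in B - A, which makes the errors of the Euler steps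
    summable. *)
Lemma klein_reverse dl A B : 0 < dl -> hlb dl A -> hlb dl B ->
  entropy B - rtr (B *m fmx (@ln R) A) <= rtr B - rtr A + dl^-1 * rtr ((B - A) *m (B - A)).
Proof.
move=> d0 lA lB; have [hA _] := lA; have [hB _] := lB.
have -> : rtr ((B - A) *m (B - A)) = rtr (B *m B) - 2 * rtr (A *m B) + rtr (A *m A).
  by rewrite mulmxBl !mulmxBr !rtrB [rtr (B *m A)]rtrC; ring.
have -> : rtr A = \sum_i \sum_j eigs A i * ovl A B i j.
  by rewrite -{1}(fmx_id hA) (rtr_fmx2l _ _ B).
have -> : rtr B = \sum_i \sum_j eigs B j * ovl A B i j.
  by rewrite -{1}(fmx_id hB) (rtr_fmx2r A).
have -> : rtr (B *m fmx (@ln R) A) = \sum_i \sum_j ln (eigs A i) * eigs B j * ovl A B i j.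
  by rewrite rtrC -{1}(fmx_id hB) rtr_fmx2.
have -> : rtr (A *m B) = \sum_i \sum_j eigs A i * eigs B j * ovl A B i j.
  by rewrite -{1}(fmx_id hA) -{1}(fmx_id hB) rtr_fmx2.
have -> : rtr (A *m A) = \sum_i \sum_j eigs A i * eigs A i * ovl A B i j.
  by rewrite -[in LHS](fmx_id hA) fmxM (rtr_fmx2l _ _ B).
have -> : rtr (B *m B) = \sum_i \sum_j eigs B j * eigs B j * ovl A B i j.
  by rewrite -[in LHS](fmx_id hB) fmxM (rtr_fmx2r A).
rewrite /entropy (rtr_fmx2r A).
rewrite mulr_sumr -!sumrB -!big_split /= mulr_sumr -big_split /=; apply: ler_sum => i _.
rewrite mulr_sumr -!sumrB -!big_split /= mulr_sumr -big_split /=; apply: ler_sum => j _ /=.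
have la := hlb_eigs i lA; have a0 := lt_le_trans d0 la.
have b0 := lt_le_trans d0 (hlb_eigs j lB).
set a := eigs A i in la a0 *; set b := eigs B j in b0 *.
set w := ovl _ _ _ _; have w0 : 0 <= w by exact: nsq_ge0.
have h := @ln_le_subr1 (b / a) (divr_gt0 b0 a0); rewrite ln_div ?posrE // in h.
have {}h : b * (ln b - ln a) <= b * (b / a - 1) by rewrite ler_wpM2l // ltW.
have e : b * (b / a - 1) = b - a + a^-1 * (b - a) ^+ 2 by field; rewrite gt_eqF.
have h2 : a^-1 * (b - a) ^+ 2 <= dl^-1 * (b - a) ^+ 2.
  by rewrite ler_wpM2r ?sqr_ge0 // lef_pV2 ?posrE.
have h3 : xlnx b - ln a * b <= b - a + dl^-1 * (b - a) ^+ 2.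
  by rewrite /xlnx; lra.
have := ler_wpM2r w0 h3; lra.
Qed.

End Entropy.

(** * Convexity of the relative entropy between a matrix and its conjugate *)

Section FisherInformation.
Context {R : realType}.
Implicit Types (r s u : R).

(* A Riemann sum of r (r - s) / ((1 - u) r + u s) over 0 <= u <= 1, whose
   integral is r ln (r / s). *)
Definition riemann_ln (m : nat) r s : R :=
  \sum_(k < m) m%:R^-1 * (r * (r - s) / ((1 - k.+1%:R / m%:R) * r + k.+1%:R / m%:R * s)).

Lemma convex_comb_gt0 r s u : 0 < r -> 0 < s -> 0 <= u <= 1 -> 0 < (1 - u) * r + u * s.
Proof.
move=> r0 s0 /andP[u0 u1]; have [->|un] := eqVneq u 0; first by rewrite subr0 mul1r mul0r addr0.
have u' : 0 < u by rewrite lt_neqAle eq_sym un.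
by rewrite ltr_wpDl ?mulr_gt0 // mulr_ge0 ?subr_ge0 // ltW.
Qed.

(** Along the equidistant points a_k from r to s, ln r - ln s telescopes, and ln x <= x - 1 at a_k /
    a_(k+1) and at its inverse bounds each increment from both sides. The two bounds differ by (r -
    s)/m times 1/a_(k+1) - 1/a_k, which telescopes to the stated error. *)
Lemma riemann_lnP (m : nat) r s : 0 < r -> 0 < s -> (0 < m)%N ->
  r * (ln r - ln s) <= riemann_ln m r s
    <= r * (ln r - ln s) + (r - s) ^+ 2 / (m%:R * s).
Proof.
move=> r0 s0 m0; have M0 : 0 < m%:R :> R by rewrite ltr0n.
pose a (k : nat) : R := (1 - k%:R / m%:R) * r + k%:R / m%:R * s.
have a0 k : (k <= m)%N -> 0 < a k.
  move=> km; apply: convex_comb_gt0 => //; rewrite divr_ge0 ?ler0n //=.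
  by rewrite ler_pdivrMr // mul1r ler_nat.
have aS k : a k - a k.+1 = (r - s) / m%:R.
  by rewrite /a -[k.+1]addn1 natrD; field; rewrite gt_eqF.
have am : a m = s by rewrite /a divff ?gt_eqF // subrr mul0r add0r mul1r.
have a00 : a 0 = r by rewrite /a mul0r subr0 mul1r mul0r addr0.
have tel (f : nat -> R) : \sum_(k < m) (f k - f k.+1) = f 0%N - f m.
  rewrite -(big_mkord xpredT (fun k => f k - f k.+1)) -opprB -telescope_sumr //.
  by rewrite -sumrN; apply: eq_bigr => k _; rewrite opprB.
have -> : ln r - ln s = \sum_(k < m) (ln (a k) - ln (a k.+1)).
  by rewrite (tel (fun k => ln (a k))) a00 am.
have -> : (r - s) ^+ 2 / (m%:R * s) =
    \sum_(k < m) r * ((r - s) / m%:R * ((a k.+1)^-1 - (a k)^-1)).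
  rewrite -!mulr_sumr; under eq_bigr do rewrite -opprB.
  rewrite sumrN (tel (fun k => (a k)^-1)) a00 am.
  by field; rewrite !gt_eqF.
rewrite mulr_sumr -big_split /riemann_ln /=; apply/andP; split; apply: ler_sum => k _.
  rewrite [leRHS](_ : _ = r * ((r - s) / m%:R / a k.+1)); last first.
    rewrite -/(a k.+1); have := a0 _ (ltn_ord k); move: (a k.+1) => t t0.
    by field; rewrite !gt_eqF.
  apply: ler_wpM2l; first exact: ltW.
  have p1 := a0 _ (ltnW (ltn_ord k)); have p2 := a0 _ (ltn_ord k).
  have := ln_le_subr1 (divr_gt0 p1 p2); rewrite ln_div ?posrE //.
  by rewrite -(aS k) mulrBl divff ?gt_eqF.
rewrite [leLHS](_ : _ = r * ((r - s) / m%:R / a k.+1)); last first.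
  rewrite -/(a k.+1); have := a0 _ (ltn_ord k); move: (a k.+1) => t t0.
  by field; rewrite !gt_eqF.
rewrite -mulrDr; apply: ler_wpM2l; first exact: ltW.
have p1 := a0 _ (ltnW (ltn_ord k)); have p2 := a0 _ (ltn_ord k).
have := ln_le_subr1 (divr_gt0 p2 p1); rewrite ln_div ?posrE //.
rewrite -(aS k); move: (a k) (a k.+1) p1 p2 => x y x0 y0.
have -> : (x - y) * (y^-1 - x^-1) = (x - y) / y - 1 + y / x by field; rewrite !gt_eqF.
lra.
Qed.

Context {D : nat}.
Local Notation C := R[i].
Implicit Types (A B X Y W : 'M[C]_D) (dl : R).

(* For unitary X this is the relative entropy D(X A X^* || A). *)
Definition fisher A X : R :=
  rtr (fmx xlnx A *m X *m adj X) - rtr (fmx (@ln R) A *m X *m A *m adj X).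

Definition eigw A X i j : R := nsq ((eigmx A *m X *m adj (eigmx A)) i j).

Lemma eigw_sym A X i j : adj X = - X -> eigw A X i j = eigw A X j i.
Proof.
move=> aX; rewrite /eigw; set Z := eigmx A *m X *m _.
have aZ : adj Z = - Z by rewrite /Z !adjM adjK aX mulNmx mulmxN mulmxA.
have -> : Z j i = - conjC (Z i j).
  by rewrite -adjE aZ; move: (Z) => T; rewrite mxE opprK.
by rewrite nsqNJ.
Qed.

Lemma fisher_eigw A X : adj A = A -> adj X = - X ->
  fisher A X = \sum_i \sum_j eigs A i * (ln (eigs A i) - ln (eigs A j)) * eigw A X i j.
Proof.
move=> hA aX; rewrite /fisher.
have -> : rtr (fmx xlnx A *m X *m adj X) = \sum_i \sum_j xlnx (eigs A i) * eigw A X i j.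
  rewrite -[fmx xlnx A *m X]mulmx1 -[1%:M](@fmx_cst R D 1 A) rtr_fmx_mul.
  by under eq_bigr do under eq_bigr do rewrite mulr1.
have -> : rtr (fmx (@ln R) A *m X *m A *m adj X) =
    \sum_i \sum_j ln (eigs A i) * eigs A j * eigw A X i j.
  by rewrite -{2}(fmx_id hA) rtr_fmx_mul.
rewrite [X in _ - X]exchange_big /= -sumrB; apply: eq_bigr => i _.
rewrite -sumrB; apply: eq_bigr => j _.
by rewrite [eigw A X j i]eigw_sym // /xlnx; ring.
Qed.

(** The weights [eigw] are symmetric for skew-adjoint X, so the sum may be symmetrized in i and j.
    The coefficients become nonnegative for positive A, since ln is increasing; this exhibits a
    positive quadratic form in X. *)
Lemma fisher_theta A X : adj A = A -> adj X = - X ->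
  fisher A X = \sum_i \sum_j
    2^-1 * ((ln (eigs A i) - ln (eigs A j)) * (eigs A i - eigs A j)) * eigw A X i j.
Proof.
move=> hA aX; rewrite fisher_eigw //.
have e : \sum_i \sum_j eigs A i * (ln (eigs A i) - ln (eigs A j)) * eigw A X i j =
  \sum_i \sum_j eigs A j * (ln (eigs A j) - ln (eigs A i)) * eigw A X i j.
  rewrite exchange_big; apply: eq_bigr => i _; apply: eq_bigr => j _.
  by rewrite [eigw A X j i]eigw_sym.
have half (x : R) : x = 2^-1 * (x + x) by field.
rewrite [LHS]half {2}e -big_split mulr_sumr; apply: eq_bigr => i _.
rewrite -big_split mulr_sumr; apply: eq_bigr => j _ /=; ring.
Qed.

(* perspective is the supremum over Y of dual_form, which is affine in A; hence its
   convexity. *)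
Definition perspective u A X : R :=
  \sum_i \sum_j eigs A i ^+ 2 / ((1 - u) * eigs A i + u * eigs A j) * eigw A X i j.

Definition dual_form u A X Y : R :=
  2 * rtr (A *m X *m adj Y) - (1 - u) * rtr (A *m Y *m adj Y) - u * rtr (Y *m A *m adj Y).

Lemma dual_formE u A X Y : adj A = A ->
  dual_form u A X Y = \sum_i \sum_j
    (2 * eigs A i * complex.Re ((eigmx A *m X *m adj (eigmx A)) i j *
       conjC ((eigmx A *m Y *m adj (eigmx A)) i j)) -
    ((1 - u) * eigs A i + u * eigs A j) * eigw A Y i j).
Proof.
move=> hA; rewrite /dual_form.
have e Z : rtr (A *m Z *m adj Y) = \sum_i \sum_j eigs A i *
    complex.Re ((eigmx A *m Z *m adj (eigmx A)) i j * conjC ((eigmx A *m Y *m adj (eigmx A)) i j)).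
  rewrite -{1}(fmx_id hA) -[fmx id A *m Z]mulmx1 -[1%:M](@fmx_cst R D 1 A) rtr_fmx_mul2.
  by under eq_bigr do under eq_bigr do rewrite mulr1.
rewrite !e; have -> : rtr (Y *m A *m adj Y) = \sum_i \sum_j eigs A j * eigw A Y i j.
  rewrite -{1}(fmx_id hA) -[Y in LHS]mul1mx -[1%:M](@fmx_cst R D 1 A).
  have -> : adj (fmx (fun=> 1) A *m Y) = adj Y by rewrite fmx_cst mul1mx.
  by rewrite rtr_fmx_mul; under eq_bigr do under eq_bigr do rewrite mul1r.
rewrite !mulr_sumr -!sumrB; apply: eq_bigr => i _.
rewrite !mulr_sumr -!sumrB; apply: eq_bigr => j _.
by rewrite nsqE /= -/(eigw A Y i j); ring.
Qed.

(** Expand |r x - t y|^2 >= 0 and divide by t; equality holds at y = (r / t) x. *)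
Lemma Re_mulJ_le (t r : R) (x y : C) : 0 < t ->
  2 * r * complex.Re (x * conjC y) - t * nsq y <= r ^+ 2 / t * nsq x.
Proof.
move=> t0; have := nsq_ge0 (r%:C * x - t%:C * y).
have -> : nsq (r%:C * x - t%:C * y) =
    r ^+ 2 * nsq x - 2 * r * t * complex.Re (x * conjC y) + t ^+ 2 * nsq y.
  by case: x => x1 x2; case: y => y1 y2; rewrite /nsq /=; ring.
move=> h; have := mulr_ge0 (ltW (_ : 0 < t^-1)) h; rewrite invr_gt0 => /(_ t0).
have -> : t^-1 * (r ^+ 2 * nsq x - 2 * r * t * complex.Re (x * conjC y) + t ^+ 2 * nsq y)
  = r ^+ 2 / t * nsq x - 2 * r * complex.Re (x * conjC y) + t * nsq y.
  by field; rewrite gt_eqF.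
lra.
Qed.

Lemma dual_form_le dl u A X Y : 0 < dl -> hlb dl A -> 0 <= u <= 1 ->
  dual_form u A X Y <= perspective u A X.
Proof.
move=> d0 lA u01; rewrite dual_formE; last by case: lA.
apply: ler_sum => i _; apply: ler_sum => j _; apply: Re_mulJ_le.
by apply: convex_comb_gt0 => //; apply: lt_le_trans d0 (hlb_eigs _ lA).
Qed.

Lemma dual_form_attained dl u A X : 0 < dl -> hlb dl A -> 0 <= u <= 1 ->
  exists Y, dual_form u A X Y = perspective u A X.
Proof.
move=> d0 lA u01; pose t i j := (1 - u) * eigs A i + u * eigs A j.
(* The equality case of [Re_mulJ_le] in each entry, written in the eigenbasis of A. *)
pose Z : 'M[C]_D := \matrix_(i, j)
  ((eigs A i / t i j)%:C * (eigmx A *m X *m adj (eigmx A)) i j).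
exists (adj (eigmx A) *m Z *m eigmx A); rewrite dual_formE; last by case: lA.
have UE : eigmx A *m (adj (eigmx A) *m Z *m eigmx A) *m adj (eigmx A) = Z.
  by rewrite !mulmxA spectral_adjr mul1mx -mulmxA spectral_adjr mulmx1.
have ZE i j : Z i j = (eigs A i / t i j)%:C * (eigmx A *m X *m adj (eigmx A)) i j.
  by rewrite mxE.
apply: eq_bigr => i _; apply: eq_bigr => j _; rewrite /eigw UE ZE -/(t i j).
have t0 : 0 < t i j.
  by apply: convex_comb_gt0 => //; apply: lt_le_trans d0 (hlb_eigs _ lA).
move: (t i j) ((eigmx A *m X *m adj (eigmx A)) i j) t0 => T [x1 x2] t0; rewrite /nsq /=.
by field; rewrite gt_eqF.
Qed.

Lemma rtr_midM A B X Y :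
  rtr (2^-1%:C *: (A + B) *m X *m Y) = 2^-1 * (rtr (A *m X *m Y) + rtr (B *m X *m Y)).
Proof. by rewrite -scalemxAl -scalemxAl rtrZ mulmxDl mulmxDl rtrD. Qed.

Lemma dual_form_mid u A B X Y :
  dual_form u (2^-1%:C *: (A + B)) X Y = 2^-1 * (dual_form u A X Y + dual_form u B X Y).
Proof.
have alg (a b c d a' b' : R) :
  2 * (2^-1 * (a + b)) - (1 - u) * (2^-1 * (c + d)) - u * (2^-1 * (a' + b')) =
  2^-1 * (2 * a - (1 - u) * c - u * a' + (2 * b - (1 - u) * d - u * b')) by ring.
have e Z : rtr (Y *m Z *m adj Y) = rtr (Z *m adj Y *m Y) by rewrite -mulmxA [LHS]rtrC.
rewrite /dual_form (e A) (e B) (e (_ *: _)).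
rewrite (rtr_midM A B X) (rtr_midM A B Y) (rtr_midM A B (adj Y)).
exact: alg.
Qed.

(** The optimal Y for the midpoint is a competitor for both A and B, and [dual_form] is affine. *)
Lemma perspective_mid dl u A B X : 0 < dl -> hlb dl A -> hlb dl B -> 0 <= u <= 1 ->
  perspective u (2^-1%:C *: (A + B)) X <= 2^-1 * (perspective u A X + perspective u B X).
Proof.
move=> d0 lA lB u01; have [Y <-] := dual_form_attained X d0 (hlb_mid lA lB) u01.
rewrite dual_form_mid ler_wpM2l ?invr_ge0 // lerD //.
  exact: (dual_form_le _ _ d0 lA).
exact: (dual_form_le _ _ d0 lB).
Qed.

Definition riemann_fisher m A X : R :=
  \sum_i \sum_j riemann_ln m (eigs A i) (eigs A j) * eigw A X i j.

(** With u = K/m and T = (1 - u) r + u s one has r - s = (r - T) m / K, so the summand r (r - s) /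
    (m T) equals (r^2 / T - r) / K. The Riemann sum is thus a positive combination of convex terms
    minus linear ones. *)
Lemma riemann_fisherE dl m A X : 0 < dl -> hlb dl A -> (0 < m)%N ->
  riemann_fisher m A X =
  \sum_(k < m) k.+1%:R^-1 * (perspective (k.+1%:R / m%:R) A X - rtr (A *m X *m adj X)).
Proof.
move=> d0 lA m0; have [hA _] := lA.
have -> : rtr (A *m X *m adj X) = \sum_i \sum_j eigs A i * eigw A X i j.
  rewrite -{1}(fmx_id hA) -[fmx id A *m X]mulmx1 -[1%:M](@fmx_cst R D 1 A) rtr_fmx_mul.
  by under eq_bigr do under eq_bigr do rewrite mulr1.
have M0 : 0 < m%:R :> R by rewrite ltr0n.
under [RHS]eq_bigr do rewrite -sumrB mulr_sumr.
rewrite exchange_big; apply: eq_bigr => i _.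
under [RHS]eq_bigr do rewrite -sumrB mulr_sumr.
rewrite exchange_big; apply: eq_bigr => j _.
rewrite /riemann_ln mulr_suml; apply: eq_bigr => k _.
have t0 : 0 < (1 - k.+1%:R / m%:R) * eigs A i + k.+1%:R / m%:R * eigs A j.
  apply: convex_comb_gt0; try exact: lt_le_trans d0 (hlb_eigs _ lA).
  by rewrite divr_ge0 ?ler0n //= ler_pdivrMr // mul1r ler_nat.
have k0 : k.+1%:R != 0 :> R by rewrite pnatr_eq0.
move: (k.+1%:R : R) k0 t0 => K k0 t0.
set T := _ + _ in t0 *; move: (eigw A X i j) => w.
have e : eigs A i - eigs A j = (eigs A i - T) * m%:R / K.
  by rewrite /T; field; rewrite k0 gt_eqF.
rewrite e; move: (eigs A i) T t0 {e} => r T t0.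
by field; rewrite k0 !gt_eqF.
Qed.

(** The Riemann sums are midpoint convex in A and exceed [fisher] by at most a constant over m; let
    m grow. *)
Lemma fisher_mid dl A B X : 0 < dl -> hlb dl A -> hlb dl B -> adj X = - X ->
  fisher (2^-1%:C *: (A + B)) X <= 2^-1 * (fisher A X + fisher B X).
Proof.
move=> d0 lA lB aX; have lM := hlb_mid lA lB; set M := _ *: _ in lM *.
have [hA _] := lA; have [hB _] := lB; have [hM _] := lM.
pose err A := \sum_i \sum_j (eigs A i - eigs A j) ^+ 2 / eigs A j * eigw A X i j.
have up A' m : hlb dl A' -> (0 < m)%N ->
    fisher A' X <= riemann_fisher m A' X <= fisher A' X + m%:R^-1 * err A'.
  move=> lA' m0; rewrite fisher_eigw; [|by case: lA'|by []].
  have p i : 0 < eigs A' i by apply: lt_le_trans d0 (hlb_eigs i lA').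
  have M0 : 0 < m%:R :> R by rewrite ltr0n.
  apply/andP; split.
    apply: ler_sum => i _; apply: ler_sum => j _; apply: ler_wpM2r; first exact: nsq_ge0.
    by have /andP[] := riemann_lnP (p i) (p j) m0.
  rewrite /err mulr_sumr -big_split; apply: ler_sum => i _.
  rewrite mulr_sumr -big_split; apply: ler_sum => j _ /=.
  rewrite mulrA -mulrDl; apply: ler_wpM2r; first exact: nsq_ge0.
  have /andP[_ h] := riemann_lnP (p i) (p j) m0; apply: le_trans h _.
  by rewrite lerD2l invfM mulrCA.
have conv m : (0 < m)%N ->
    riemann_fisher m M X <= 2^-1 * (riemann_fisher m A X + riemann_fisher m B X).
  move=> m0; rewrite !(@riemann_fisherE dl) // -big_split mulr_sumr.
  apply: ler_sum => k _ /=.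
  have M0 : 0 < m%:R :> R by rewrite ltr0n.
  have u01 : 0 <= (k.+1%:R / m%:R : R) <= 1.
    by rewrite divr_ge0 ?ler0n //= ler_pdivrMr // mul1r ler_nat.
  have h := perspective_mid X d0 lA lB u01; rewrite -/M in h.
  have -> : rtr (M *m X *m adj X) = 2^-1 * (rtr (A *m X *m adj X) + rtr (B *m X *m adj X)).
    exact: rtr_midM.
  rewrite -mulrDr mulrCA ler_wpM2l ?invr_ge0 ?ler0n //; lra.
apply/ler_addgt0Pl => e e0.
pose E := 2^-1 * (err A + err B).
have err0 A' : hlb dl A' -> 0 <= err A'.
  move=> lA'; apply: sumr_ge0 => i _; apply: sumr_ge0 => j _.
  by rewrite mulr_ge0 ?nsq_ge0 // divr_ge0 ?sqr_ge0 // ltW // (lt_le_trans d0) // hlb_eigs.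
have E0 : 0 <= E by rewrite mulr_ge0 ?invr_ge0 // addr_ge0 ?err0.
pose m := (Num.truncn (E / e)).+1.
have m0 : (0 < m)%N by [].
have mE : m%:R^-1 * E <= e.
  have M0 : 0 < m%:R :> R by rewrite ltr0n.
  rewrite mulrC ler_pdivrMr // mulrC -ler_pdivrMr //.
  by apply/ltW/truncnS_gt.
have alg (a b c a' b' c' x y z w : R) : a <= a' -> b' <= b + w * y -> c' <= c + w * z ->
    a' <= 2^-1 * (b' + c') -> w * (2^-1 * (y + z)) <= x -> a <= x + 2^-1 * (b + c).
  by rewrite mulrCA mulrDr; lra.
have /andP[h1 _] := up M m lM m0; have /andP[_ h2] := up A m lA m0.
have /andP[_ h3] := up B m lB m0.
exact: alg h1 h2 h3 (conv m m0) mE.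
Qed.

Lemma fisherN A X : fisher A (- X) = fisher A X.
Proof.
rewrite /fisher adjN; move: (fmx xlnx A) (fmx (@ln R) A) (adj X) => F G Y.
have -> : F *m - X *m - Y = F *m X *m Y by rewrite mulmxN mulmxN mulNmx opprK.
have -> // : G *m - X *m A *m - Y = G *m X *m A *m Y.
by rewrite mulmxN mulmxN mulNmx mulNmx opprK.
Qed.

Lemma fisher_conj A X W : adj A = A -> W *m adj W = 1%:M ->
  fisher (W *m A *m adj W) X = fisher A (adj W *m X *m W).
Proof.
move=> hA uW; rewrite /fisher !fmx_conj // !adjM adjK.
move: (fmx xlnx A) (fmx (@ln R) A) => F G.
have -> : rtr (W *m F *m adj W *m X *m adj X) =
    rtr (F *m (adj W *m X *m W) *m (adj W *m (adj X *m W))).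
  rewrite -!mulmxA [LHS]rtrC -!mulmxA.
  by rewrite [in RHS](mulmxA W (adj W)) uW mul1mx.
have -> // : rtr (W *m G *m adj W *m X *m (W *m A *m adj W) *m adj X) =
    rtr (G *m (adj W *m X *m W) *m A *m (adj W *m (adj X *m W))).
by rewrite -!mulmxA [LHS]rtrC -!mulmxA.
Qed.

(** Conjugating A by W amounts to conjugating X by W^*, which changes X by a sign at most and leaves
    [fisher] unchanged; convexity does the rest. *)
Lemma fisher_avg dl A X W : 0 < dl -> hlb dl A -> adj X = - X -> W *m adj W = 1%:M ->
  adj W *m X *m W = X \/ adj W *m X *m W = - X ->
  fisher (2^-1%:C *: (A + W *m A *m adj W)) X <= fisher A X.
Proof.
move=> d0 lA aX uW hX; apply: le_trans (fisher_mid d0 lA (hlb_conj uW lA) aX) _.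
rewrite fisher_conj //; last by case: lA.
by case: hX => ->; rewrite ?fisherN; lra.
Qed.

End FisherInformation.

(** * Elementary bounds on geometric decay *)

Section GeometricDecay.
Context {R : realType}.

(** Bounds the accumulated error of the Euler steps independently of their number K. *)
Lemma geometric_sum_le (e : R) K : 0 <= e <= 1 ->
  e * \sum_(k < K) ((1 - e) ^+ k) ^+ 2 <= 1.
Proof.
move=> /andP[e0 e1]; suff h : e * \sum_(k < K) ((1 - e) ^+ k) ^+ 2 <= 1 - (1 - e) ^+ K.
  by apply: le_trans h _; rewrite gerBl exprn_ge0 // subr_ge0.
elim: K => [|K IH]; first by rewrite big_ord0 mulr0 expr0 subrr.
rewrite big_ord_recr mulrDr /=; apply: le_trans (lerD IH (lexx _)) _.
have p0 : 0 <= (1 - e) ^+ K by rewrite exprn_ge0 // subr_ge0.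
have p1 : (1 - e) ^+ K <= 1 by rewrite exprn_ile1 ?subr_ge0 // gerBl.
rewrite [_ ^+ K.+1]exprS; move: ((1 - e) ^+ K) p0 p1 => p p0 p1.
have := mulr_ge0 e0 (mulr_ge0 p0 (_ : 0 <= 1 - p)); rewrite subr_ge0 => /(_ p1).
rewrite expr2; lra.
Qed.

(** A Bernoulli-type bound: for fixed e > 0 it makes (1 - e)^(2K) explicitly small as K grows. *)
Lemma geometric_le (e : R) K : 0 <= e <= 1 -> ((1 - e) ^+ K) ^+ 2 * (1 + K%:R * e) <= 1.
Proof.
move=> /andP[e0 e1].
have p0 : 0 <= (1 - e) ^+ K by rewrite exprn_ge0 // subr_ge0.
have p1 : (1 - e) ^+ K <= 1 by rewrite exprn_ile1 ?subr_ge0 // gerBl.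
apply: le_trans (_ : (1 - e) ^+ K * (1 + K%:R * e) <= _).
  apply: ler_wpM2r; first by rewrite addr_ge0 // mulr_ge0.
  by rewrite expr2 -[leRHS]mulr1 ler_wpM2l.
elim: K {p0 p1} => [|K IH]; first by rewrite expr0 mul0r addr0 mulr1.
have p0 : 0 <= (1 - e) ^+ K by rewrite exprn_ge0 // subr_ge0.
apply: le_trans IH; rewrite exprSr -mulrA; apply: ler_wpM2l => //.
have -> : K.+1%:R = 1 + K%:R :> R by rewrite -natr1 addrC.
have := mulr_ge0 (mulr_ge0 e0 e0) (_ : 0 <= 1 + K%:R); rewrite addr_ge0 // => /(_ isT).
lra.
Qed.

End GeometricDecay.

(** * Clifford reflections and conditional expectations *)

Section CliffordFlow.
Context {R : realType} {n D : nat}.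
Local Notation C := R[i].
Implicit Types (u v w : 'rV[R]_n) (s : seq 'rV[R]_n).

Definition dotv u v : R := \sum_k u 0 k * v 0 k.

Lemma dotvC u v : dotv u v = dotv v u.
Proof. by apply: eq_bigr => k _; rewrite mulrC. Qed.

(** The skew-adjoint convention, with squares -1, fits the doubled generators [dblW] and also i Q_k;
    skew-adjointness is what the Fisher information lemmas ask of X. *)
Definition anticliff (W : 'I_n -> 'M[C]_D) : Prop :=
  (forall i, adj (W i) = - W i) /\
  forall i j, W i *m W j + W j *m W i = (- 2 * (i == j)%:R : R)%:C%:M.

Context (W : 'I_n -> 'M[C]_D) (hW : anticliff W).
Implicit Types (A B X Y H : 'M[C]_D) (dl : R).

Definition Wv u : 'M[C]_D := \sum_k (u 0 k)%:C *: W k.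

Lemma adj_Wv u : adj (Wv u) = - Wv u.
Proof.
rewrite /Wv adj_sum -sumrN; apply: eq_bigr => k _.
by rewrite adj_scaler (proj1 hW) scalerN.
Qed.

Lemma Wv_delta k : Wv (delta_mx 0 k) = W k.
Proof.
rewrite /Wv (bigD1 k) //= big1 => [|j jk]; rewrite mxE ?eqxx /=.
  by rewrite addr0 rmorph1 scale1r.
by rewrite (negPf jk) rmorph0 scale0r.
Qed.

Lemma Wv_anticomm u v : Wv u *m Wv v + Wv v *m Wv u = (- 2 * dotv u v)%:C%:M.
Proof.
have e x y : Wv x *m Wv y = \sum_i \sum_j (x 0 i * y 0 j)%:C *: (W i *m W j).
  rewrite /Wv mulmx_suml; apply: eq_bigr => i _; rewrite mulmx_sumr.
  by apply: eq_bigr => j _; rewrite -scalemxAl -scalemxAr scalerA rmorphM.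
rewrite !e [X in _ + X]exchange_big -big_split /=.
rewrite /dotv mulr_sumr rmorph_sum raddf_sum /=; apply: eq_bigr => i _.
rewrite -big_split /= (bigD1 i) //= big1 => [|j ji].
  rewrite addr0 [v 0 i * _]mulrC -scalerDr (proj2 hW) eqxx mulr1.
  by rewrite scale_scalar_mx -rmorphM; congr (_%:C%:M); ring.
rewrite [v 0 j * _]mulrC -scalerDr (proj2 hW) eq_sym (negPf ji) mulr0.
by rewrite !rmorph0 scaler0.
Qed.

Lemma half_add X : 2^-1%:C *: (X + X) = X.
Proof.
rewrite scalerDr -scalerDl -rmorphD (_ : 2^-1 + 2^-1 = 1 :> R); last by field.
by rewrite rmorph1 scale1r.
Qed.

Lemma Wv_sq u : dotv u u = 1 -> Wv u *m Wv u = - 1%:M.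
Proof.
move=> u1; have := Wv_anticomm u u; rewrite u1 mulr1 => h.
rewrite -[LHS]half_add h scale_scalar_mx -rmorphM mulrN mulVf ?pnatr_eq0 //.
by rewrite rmorphN1 raddfN.
Qed.

Lemma Wv_unitary u : dotv u u = 1 -> Wv u *m adj (Wv u) = 1%:M.
Proof. by move=> u1; rewrite adj_Wv mulmxN Wv_sq // opprK. Qed.

Lemma Wv_orth u v : dotv u v = 0 -> Wv u *m Wv v = - (Wv v *m Wv u).
Proof.
by move=> uv; apply/eqP; rewrite -addr_eq0 Wv_anticomm uv mulr0 !rmorph0.
Qed.

Lemma Wv_conj_orth u v : dotv u u = 1 -> dotv u v = 0 ->
  adj (Wv u) *m Wv v *m Wv u = - Wv v.
Proof.
move=> u1 uv; rewrite -mulmxA -[Wv v *m Wv u]opprK -Wv_orth // mulmxN mulmxA.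
by rewrite (unitaryLR (Wv_unitary u1)) mul1mx.
Qed.

Definition cjW u X : 'M[C]_D := Wv u *m X *m adj (Wv u).

Lemma cjWD u X Y : cjW u (X + Y) = cjW u X + cjW u Y.
Proof. by rewrite /cjW mulmxDr mulmxDl. Qed.

Lemma cjWZ u (a : C) X : cjW u (a *: X) = a *: cjW u X.
Proof. by rewrite /cjW -scalemxAr -scalemxAl. Qed.

Lemma cjWK u X : dotv u u = 1 -> cjW u (cjW u X) = X.
Proof.
move=> u1; have -> : cjW u (cjW u X) = Wv u *m Wv u *m X *m adj (Wv u *m Wv u).
  by rewrite /cjW adjM !mulmxA.
by rewrite Wv_sq // adjN adj_1 mulNmx mul1mx mulmxN mulmx1 opprK.
Qed.

Lemma cjW_avg u X : dotv u u = 1 ->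
  cjW u (2^-1%:C *: (X + cjW u X)) = 2^-1%:C *: (X + cjW u X).
Proof. by move=> u1; rewrite cjWZ cjWD cjWK // [cjW u X + X]addrC. Qed.

Lemma cjWC u v X : dotv u v = 0 -> cjW u (cjW v X) = cjW v (cjW u X).
Proof.
move=> uv; have e x y Z : cjW x (cjW y Z) = Wv x *m Wv y *m Z *m adj (Wv x *m Wv y).
  by rewrite /cjW adjM !mulmxA.
by rewrite !e [Wv u *m Wv v]Wv_orth // adjN mulNmx mulNmx mulmxN opprK.
Qed.

Definition nabla X : 'M[C]_D := \sum_k W k *m X *m adj (W k).

Lemma nablaD X Y : nabla (X + Y) = nabla X + nabla Y.
Proof. by rewrite /nabla -big_split; apply: eq_bigr => k _; rewrite mulmxDr mulmxDl. Qed.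

Lemma nablaZ (a : C) X : nabla (a *: X) = a *: nabla X.
Proof. by rewrite /nabla scaler_sumr; apply: eq_bigr => k _; rewrite -scalemxAr -scalemxAl. Qed.

Lemma mulmx_expand4 (P Q X : 'M[C]_D) (a : C) :
  (- P - a%:M) *m X *m (- Q - a%:M) =
  P *m X *m Q + a *: (P *m X) + a *: (X *m Q) + (a * a) *: X.
Proof.
rewrite -!opprD mulNmx mulNmx mulmxN opprK mulmxDl mul_scalar_mx mulmxDr mulmxDl.
by rewrite mul_mx_scalar -scalemxAl scalerDr scalerA addrA [X in X + _]addrAC.
Qed.

(** Moving [Wv u] past [W k] leaves a scalar 2 u_k. Summed over k, these corrections rebuild [Wv u],
    whose square is -1: the two cross terms give -2X each and cancel the quadratic term 4X. *)
Lemma cjW_nabla u X : dotv u u = 1 -> cjW u (nabla X) = nabla (cjW u X).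
Proof.
move=> u1; have c k : Wv u *m W k = - (W k *m Wv u) - (2 * u 0 k)%:C%:M.
  apply/eqP; rewrite -(Wv_delta k) addrC -subr_eq opprK Wv_anticomm.
  rewrite /dotv (bigD1 k) //= big1 => [|j jk].
    by rewrite mxE !eqxx mulr1 addr0 mulNr rmorphN raddfN.
  by rewrite mxE (negPf jk) andbF mulr0.
pose S := \sum_k (2 * u 0 k)%:C *: (W k *m Wv u *m X).
pose T := \sum_k (2 * u 0 k)%:C *: (X *m adj (Wv u) *m adj (W k)).
have e : cjW u (nabla X) = nabla (cjW u X) + S + T + 4%:C *: X.
  have -> : 4%:C *: X = \sum_k (4 * (u 0 k * u 0 k))%:C *: X.
    by rewrite -scaler_suml -rmorph_sum -mulr_sumr -/(dotv u u) u1 mulr1.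
  rewrite /cjW /nabla mulmx_sumr mulmx_suml -!big_split; apply: eq_bigr => k _ /=.
  have -> : Wv u *m (W k *m X *m adj (W k)) *m adj (Wv u) =
      (Wv u *m W k) *m X *m adj (Wv u *m W k) by rewrite adjM !mulmxA.
  rewrite c adjB adjN adjM; set a := (2 * u 0 k)%:C.
  have -> : adj (a%:M : 'M[C]_D) = a%:M.
    by rewrite -scalemx1 adj_scale adj_1 conjC_real.
  rewrite mulmx_expand4 -!mulmxA; congr (_ + _ + _ + _ *: _).
  by rewrite -rmorphM; congr (_%:C); ring.
have sT Z : \sum_k (2 * u 0 k)%:C *: (Z *m adj (W k)) = 2%:C *: (Z *m adj (Wv u)).
  rewrite /Wv adj_sum mulmx_sumr scaler_sumr; apply: eq_bigr => k _.
  by rewrite adj_scaler -scalemxAr scalerA -rmorphM.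
have sS Z : \sum_k (2 * u 0 k)%:C *: (W k *m Z) = 2%:C *: (Wv u *m Z).
  rewrite /Wv mulmx_suml scaler_sumr; apply: eq_bigr => k _.
  by rewrite -scalemxAl scalerA -rmorphM.
have S2 : S = - (2%:C *: X).
  rewrite /S; under eq_bigr do rewrite -mulmxA.
  by rewrite sS mulmxA Wv_sq // mulNmx mul1mx scalerN.
have T2 : T = - (2%:C *: X).
  by rewrite /T sT adj_Wv mulmxN mulmxN mulNmx opprK -mulmxA Wv_sq // mulmxN mulmx1 scalerN.
have f4 : 4%:C = 2%:C + 2%:C :> C by rewrite -rmorphD; congr (_%:C); ring.
by rewrite e S2 T2 f4 scalerDl addrA subrK subrK.
Qed.

Fixpoint onseq s : Prop :=
  if s is w :: s' then
    [/\ dotv w w = 1, forall v, v \in s' -> dotv w v = 0 & onseq s']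
  else True.

(* Averaging over the reflections in the vectors of s: the conditional expectation
   onto the algebra of the orthogonal complement of s. *)
Fixpoint EV s X : 'M[C]_D :=
  if s is w :: s' then 2^-1%:C *: (EV s' X + cjW w (EV s' X)) else X.

Lemma EVD s X Y : EV s (X + Y) = EV s X + EV s Y.
Proof.
elim: s => //= w s ->; rewrite cjWD -scalerDr; congr (_ *: _).
by rewrite addrACA.
Qed.

Lemma EVZ s (a : C) X : EV s (a *: X) = a *: EV s X.
Proof.
by elim: s => //= w s ->; rewrite cjWZ -scalerDr !scalerA mulrC.
Qed.

(** Conjugations by orthogonal directions commute, because the anticommutation sign appears
    twice. *)
Lemma EV_fix s w X : onseq s -> w \in s -> cjW w (EV s X) = EV s X.
Proof.
elim: s => //= v s IH [v1 vs os]; rewrite in_cons => /predU1P[->|ws].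
  exact: cjW_avg.
have wv : dotv w v = 0 by rewrite dotvC vs.
by rewrite cjWZ cjWD (cjWC _ wv) (IH os ws).
Qed.

Lemma EV_nabla s X : onseq s -> EV s (nabla X) = nabla (EV s X).
Proof.
by elim: s => //= v s IH [v1 vs os]; rewrite IH // nablaZ nablaD cjW_nabla.
Qed.

Lemma cjW_hlb dl u A : dotv u u = 1 -> hlb dl A -> hlb dl (cjW u A).
Proof. by move=> u1; apply: hlb_conj; exact: Wv_unitary. Qed.

Lemma EV_hlb dl s A : onseq s -> hlb dl A -> hlb dl (EV s A).
Proof.
elim: s => //= v s IH [v1 vs os] lA; have lE := IH os lA.
exact: hlb_mid lE (cjW_hlb v1 lE).
Qed.

Lemma rtr_cjW u X : dotv u u = 1 -> rtr (cjW u X) = rtr X.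
Proof.
by move=> u1; rewrite /cjW rtrC mulmxA (unitaryLR (Wv_unitary u1)) mul1mx.
Qed.

Lemma rtr_EV s X : onseq s -> rtr (EV s X) = rtr X.
Proof.
elim: s => //= v s IH [v1 vs os]; rewrite rtrZ rtrD rtr_cjW // IH //.
by field.
Qed.

(** The conditional expectation is symmetric for the trace form, and it fixes H. *)
Lemma rtr_EV_mul s X H : onseq s -> (forall w, w \in s -> cjW w H = H) ->
  rtr (EV s X *m H) = rtr (X *m H).
Proof.
elim: s => //= v s IH [v1 vs os] h.
have hv := h v (mem_head _ _).
have -> : rtr (2^-1%:C *: (EV s X + cjW v (EV s X)) *m H) =
    2^-1 * (rtr (EV s X *m H) + rtr (cjW v (EV s X) *m H)).
  by rewrite -scalemxAl rtrZ mulmxDl rtrD.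
have -> : rtr (cjW v (EV s X) *m H) = rtr (EV s X *m H).
  rewrite -{1}hv /cjW; have := unitaryLR (Wv_unitary v1).
  move: (EV s X) (Wv v) => Y V uV.
  rewrite -!mulmxA [LHS]rtrC -!mulmxA uV mulmx1.
  by rewrite [adj V *m (V *m _)]mulmxA uV mul1mx.
rewrite IH; [by field | by [] |].
by move=> w ws; apply: h; rewrite in_cons ws orbT.
Qed.

(** Each vector v of s is orthogonal to u, so conjugation by [Wv v] sends [Wv u] to its negative,
    and [fisher_avg] applies at every averaging step. *)
Lemma fisher_EV dl s A u : 0 < dl -> onseq s -> hlb dl A -> dotv u u = 1 ->
  (forall w, w \in s -> dotv w u = 0) -> fisher (EV s A) (Wv u) <= fisher A (Wv u).
Proof.
move=> d0; elim: s => //= v s IH [v1 vs os] lA u1 h.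
apply: le_trans (IH os lA u1 _); last by move=> w ws; apply: h; rewrite in_cons ws orbT.
apply: (fisher_avg d0 (EV_hlb os lA) (adj_Wv u) (Wv_unitary v1)).
by right; apply: Wv_conj_orth => //; apply: h; rewrite mem_head.
Qed.

Lemma fisher_unitE A u : adj A = A -> dotv u u = 1 ->
  fisher A (Wv u) = entropy A - rtr (fmx (@ln R) A *m cjW u A).
Proof.
move=> hA u1; rewrite /fisher /entropy /cjW -mulmxA Wv_unitary // mulmx1.
by rewrite !mulmxA.
Qed.

Lemma fisher_fixed A u : adj A = A -> dotv u u = 1 -> cjW u A = A -> fisher A (Wv u) = 0.
Proof. by move=> hA u1 fA; rewrite fisher_unitE // fA rtrC -entropyE // subrr. Qed.

(** * The Laplacian and the dissipation of entropy *)

Definition lap X : 'M[C]_D := n%:R%:C *: X - nabla X.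

Lemma dotv_delta u k : dotv u (delta_mx 0 k) = u 0 k.
Proof.
rewrite /dotv (bigD1 k) //= big1 => [|j jk]; rewrite mxE ?eqxx ?mulr1 ?addr0 //.
by rewrite (negPf jk) andbF mulr0.
Qed.

Lemma dotv_delta1 k : dotv (delta_mx 0 k) (delta_mx 0 k) = 1.
Proof. by rewrite dotv_delta mxE !eqxx. Qed.

(** The substitute for differentiating the entropy: e/2 times this quantity is the first-order
    decrease under [euler e], since [nabla] sums the conjugations in the coordinate directions. *)
Lemma rtr_ln_lap A : adj A = A ->
  rtr (fmx (@ln R) A *m lap A) = \sum_k fisher A (Wv (delta_mx 0 k)).
Proof.
move=> hA; rewrite /lap mulmxBr -scalemxAr rtrB rtrZ rtrC -entropyE //.
under eq_bigr do rewrite fisher_unitE ?dotv_delta1 //.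
rewrite sumrB sumr_const card_ord mulr_natl /nabla mulmx_sumr rtr_sum.
by congr (_ - _); apply: eq_bigr => k _; rewrite /cjW Wv_delta.
Qed.

(* The Fisher information is a nonnegative combination of squares of linear
   forms in u, so weighted Parseval-type inequalities transfer to it. *)
Lemma fisher_Wv_le dl A (a b : seq (R * 'rV[R]_n)) : 0 < dl -> hlb dl A ->
  (forall x, \sum_(q <- a) q.1 * dotv q.2 x ^+ 2 <= \sum_(q <- b) q.1 * dotv q.2 x ^+ 2) ->
  \sum_(q <- a) q.1 * fisher A (Wv q.2) <= \sum_(q <- b) q.1 * fisher A (Wv q.2).
Proof.
move=> d0 lA h; have [hA _] := lA.
pose th i j := 2^-1 * ((ln (eigs A i) - ln (eigs A j)) * (eigs A i - eigs A j)).
(* The generators in an eigenbasis of A: the real and imaginary parts of these entries, as k varies,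
   are the coefficients of the linear forms in u. *)
pose z i j k := (eigmx A *m W k *m adj (eigmx A)) i j.
pose x1 i j : 'rV[R]_n := \row_k complex.Re (z i j k).
pose x2 i j : 'rV[R]_n := \row_k complex.Im (z i j k).
have th0 i j : 0 <= th i j.
  have p k : 0 < eigs A k := lt_le_trans d0 (hlb_eigs k lA).
  rewrite mulr_ge0 ?invr_ge0 //; have [le|/ltW le] := leP (eigs A i) (eigs A j).
    by rewrite mulr_le0 // subr_le0 // ler_ln ?posrE.
  by rewrite mulr_ge0 // subr_ge0 // ler_ln ?posrE.
have e u : fisher A (Wv u) =
    \sum_i \sum_j th i j * (dotv u (x1 i j) ^+ 2 + dotv u (x2 i j) ^+ 2).
  rewrite (fisher_theta hA (adj_Wv u)); apply: eq_bigr => i _; apply: eq_bigr => j _.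
  congr (_ * _); rewrite /eigw.
  have -> : (eigmx A *m Wv u *m adj (eigmx A)) i j = \sum_k (u 0 k)%:C * z i j k.
    rewrite /Wv mulmx_sumr mulmx_suml summxE; apply: eq_bigr => k _.
    by rewrite -scalemxAr -scalemxAl mxE.
  rewrite /nsq Re_sum Im_sum /dotv.
  by congr (_ ^+ 2 + _ ^+ 2); apply: eq_bigr => k _; rewrite ?ReZ ?ImZ mxE.
have E (c : seq (R * 'rV[R]_n)) : \sum_(q <- c) q.1 * fisher A (Wv q.2) =
    \sum_i \sum_j th i j * (\sum_(q <- c) q.1 * dotv q.2 (x1 i j) ^+ 2 +
      \sum_(q <- c) q.1 * dotv q.2 (x2 i j) ^+ 2).
  under eq_bigr do rewrite e mulr_sumr.
  rewrite exchange_big; apply: eq_bigr => i _ /=.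
  under eq_bigr do rewrite mulr_sumr.
  rewrite exchange_big; apply: eq_bigr => j _ /=.
  by rewrite -big_split mulr_sumr; apply: eq_bigr => q _ /=; ring.
rewrite !E; apply: ler_sum => i _; apply: ler_sum => j _.
by rewrite ler_wpM2l // lerD.
Qed.

(* One Euler step of the heat flow whose generator is the number operator lap / 2. *)
Definition euler (e : R) X : 'M[C]_D := X - (e / 2)%:C *: lap X.

Lemma lapD X Y : lap (X + Y) = lap X + lap Y.
Proof. by rewrite /lap nablaD scalerDr opprD addrACA. Qed.

Lemma lapZ (a : C) X : lap (a *: X) = a *: lap X.
Proof. by rewrite /lap nablaZ scalerBr !scalerA mulrC. Qed.

Lemma eulerD e X Y : euler e (X + Y) = euler e X + euler e Y.
Proof. by rewrite /euler lapD scalerDr opprD addrACA. Qed.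

Lemma eulerZ e (a : C) X : euler e (a *: X) = a *: euler e X.
Proof.
by rewrite /euler lapZ [RHS]scalerBr !scalerA [a * _]mulrC.
Qed.

Lemma EVB s X Y : EV s (X - Y) = EV s X - EV s Y.
Proof. by rewrite EVD -[- Y]scaleN1r EVZ scaleN1r. Qed.

Lemma EV_lap s X : onseq s -> EV s (lap X) = lap (EV s X).
Proof. by move=> os; rewrite /lap EVB EVZ (EV_nabla X os). Qed.

Lemma EV_euler s e X : onseq s -> EV s (euler e X) = euler e (EV s X).
Proof. by move=> os; rewrite /euler EVB EVZ (EV_lap X os). Qed.

Lemma rtr_nabla X : rtr (nabla X) = n%:R * rtr X.
Proof.
rewrite /nabla rtr_sum (eq_bigr (fun=> rtr X)) ?sumr_const ?card_ord ?mulr_natl // => k _.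
by rewrite -(Wv_delta k) -/(cjW _ X) rtr_cjW // dotv_delta1.
Qed.

Lemma rtr_euler e X : rtr (euler e X) = rtr X.
Proof. by rewrite /euler rtrB rtrZ /lap rtrB rtrZ rtr_nabla subrr mulr0 subr0. Qed.

(** For e n <= 1 a step is (1 - e n / 2) A + (e / 2) [nabla] A with nonnegative coefficients, and
    [nabla] is a sum of n unitary conjugations. *)
Lemma euler_hlb dl e A : 0 <= e -> e * n%:R <= 1 -> hlb dl A -> hlb dl (euler e A).
Proof.
move=> e0 en lA; have eE : euler e A = (1 - e / 2 * n%:R)%:C *: A + (e / 2)%:C *: nabla A.
  rewrite /euler /lap scalerBr opprB addrA addrAC rmorphB rmorph1 scalerBl scale1r.
  by rewrite scalerA -rmorphM addrAC.
have lN : hlb (n%:R * dl) (nabla A).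
  have -> : n%:R * dl = \sum_(k < n) dl by rewrite sumr_const card_ord mulr_natl.
  rewrite /nabla; elim/big_ind2: _.
  - split; first by rewrite adj0.
    by move=> v; rewrite mul0r /qf mulmx0 mul0mx rtr0.
  - by move=> a X b Y; apply: hlbD.
  - by move=> k _; rewrite -(Wv_delta k); apply: cjW_hlb lA; apply: dotv_delta1.
have -> : dl = (1 - e / 2 * n%:R) * dl + e / 2 * (n%:R * dl) by ring.
rewrite eE; have p1 : 0 <= 1 - e / 2 * n%:R by lra.
have p2 : 0 <= e / 2 by lra.
exact: hlbD (hlbZ p1 lA) (hlbZ p2 lN).
Qed.

(* A weight c_j, an orthonormal family u_j and an orthonormal completion s_j of it;
   the conditional expectation onto the algebra of span u_j is EV s_j. *)
Record brascamp_datum N (c : 'I_N -> R) (u s : 'I_N -> seq 'rV[R]_n) : Prop :=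
  BrascampDatum {
  bd_ge0 : forall j, 0 <= c j;
  bd_unit : forall j v, v \in u j -> dotv v v = 1;
  bd_orth : forall j v w, v \in u j -> w \in s j -> dotv w v = 0;
  bd_on : forall j, onseq (s j);
  bd_parseval : forall j x,
    \sum_(v <- u j) dotv v x ^+ 2 + \sum_(v <- s j) dotv v x ^+ 2 = dotv x x;
  bd_le : forall x, \sum_j c j * \sum_(v <- u j) dotv v x ^+ 2 <= dotv x x }.

Lemma onseq_unit s w : onseq s -> w \in s -> dotv w w = 1.
Proof.
elim: s => //= v s IH [v1 _ os]; rewrite in_cons => /predU1P[-> //|ws].
exact: IH.
Qed.

Lemma dotv_sqr_delta x : dotv x x = \sum_k dotv (delta_mx 0 k) x ^+ 2.
Proof. by apply: eq_bigr => k _; rewrite dotvC dotv_delta expr2. Qed.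

Context (N : nat) (c : 'I_N -> R) (us ss : 'I_N -> seq 'rV[R]_n).
Context (bd : brascamp_datum c us ss).

(** [bd_le] bounds the weighted information of A in the directions of all [us j] by its full
    information. In each direction of [us j] passing to [EV (ss j) A] decreases the information.
    Finally [EV (ss j) A] is invariant under the reflections in [ss j], so by [bd_parseval] its
    information in the directions of [us j] is already all of it. *)
Lemma fisher_lap_le dl A : 0 < dl -> hlb dl A ->
  \sum_j c j * rtr (fmx (@ln R) (EV (ss j) A) *m lap (EV (ss j) A)) <=
  rtr (fmx (@ln R) A *m lap A).
Proof.
move=> d0 lA; have [hA _] := lA.
have lE j : hlb dl (EV (ss j) A) by apply: EV_hlb => //; apply: bd_on bd j.
have hE j : adj (EV (ss j) A) = EV (ss j) A by case: (lE j).
pose q1 : seq (R * 'rV[R]_n) := flatten [seq [seq (c j, v) | v <- us j] | j <- enum 'I_N].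
pose q2 : seq (R * 'rV[R]_n) := [seq (1, delta_mx 0 k) | k <- enum 'I_n].
have sq1 (f : 'rV[R]_n -> R) : \sum_(q <- q1) q.1 * f q.2 = \sum_j c j * \sum_(v <- us j) f v.
  rewrite big_flatten big_map big_enum /=; apply: eq_bigr => j _.
  by rewrite big_map mulr_sumr.
have sq2 (f : 'rV[R]_n -> R) : \sum_(q <- q2) q.1 * f q.2 = \sum_k f (delta_mx 0 k).
  by rewrite big_map big_enum; apply: eq_bigr => k _; rewrite mul1r.
rewrite (rtr_ln_lap hA) -(sq2 (fun v => fisher A (Wv v))).
apply: le_trans (_ : \sum_(q <- q1) q.1 * fisher A (Wv q.2) <= _); last first.
  apply: (fisher_Wv_le d0 lA) => x; rewrite (sq1 (fun v => dotv v x ^+ 2)).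
  by rewrite (sq2 (fun v => dotv v x ^+ 2)) -dotv_sqr_delta; apply: bd_le bd x.
rewrite (sq1 (fun v => fisher A (Wv v))); apply: ler_sum => j _.
apply: ler_wpM2l; first exact: bd_ge0 bd j.
rewrite (rtr_ln_lap (hE j)).
pose q3 : seq (R * 'rV[R]_n) := [seq (1, v) | v <- us j ++ ss j].
have sq3 (f : 'rV[R]_n -> R) : \sum_(q <- q3) q.1 * f q.2 =
    \sum_(v <- us j) f v + \sum_(v <- ss j) f v.
  by rewrite big_map -big_cat; apply: eq_bigr => k _; rewrite mul1r.
rewrite -(sq2 (fun v => fisher (EV (ss j) A) (Wv v))).
apply: le_trans (_ : \sum_(q <- q3) q.1 * fisher (EV (ss j) A) (Wv q.2) <= _).
  apply: (fisher_Wv_le d0 (lE j)) => x; rewrite (sq2 (fun v => dotv v x ^+ 2)).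
  by rewrite (sq3 (fun v => dotv v x ^+ 2)) -dotv_sqr_delta (bd_parseval bd).
rewrite (sq3 (fun v => fisher (EV (ss j) A) (Wv v))).
rewrite [X in _ + X]big1_seq ?addr0 => [|v /= vs]; last first.
  apply: fisher_fixed => //; first exact: onseq_unit (bd_on bd j) vs.
  by apply: EV_fix => //; apply: bd_on bd j.
rewrite big_seq [leRHS]big_seq; apply: ler_sum => v vu.
apply: (fisher_EV d0 (bd_on bd j) lA); first exact: (bd_unit bd vu).
by move=> w ws; exact: (bd_orth bd vu ws).
Qed.

Definition entropy_gap A : R := entropy A - \sum_j c j * entropy (EV (ss j) A).

Lemma subr_euler e X : euler e X - X = - ((e / 2)%:C *: lap X).
Proof. by rewrite /euler addrAC subrr add0r. Qed.

(** The upper half of a first-order expansion, from [klein_reverse]; the trace terms cancel because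
    a step preserves the trace. *)
Lemma entropy_euler_le dl e A : 0 < dl -> hlb dl A -> hlb dl (euler e A) ->
  entropy (euler e A) - dl^-1 * rtr ((euler e A - A) *m (euler e A - A)) <=
  entropy A - e / 2 * rtr (fmx (@ln R) A *m lap A).
Proof.
move=> d0 lA lB; have [hA _] := lA; have := klein_reverse d0 lA lB.
have -> : rtr (euler e A *m fmx (@ln R) A) = entropy A - e / 2 * rtr (fmx (@ln R) A *m lap A).
  rewrite -[euler e A](subrK A) subr_euler mulmxDl rtrD mulNmx rtrN -scalemxAl rtrZ.
  by rewrite -(entropyE hA) addrC [rtr (lap A *m _)]rtrC.
have alg (a b x : R) : a - b <= 0 + x -> a - x <= b by lra.
by rewrite rtr_euler subrr; apply: alg.
Qed.

(** A convex function lies above its tangent: Klein's inequality gives the lower half with no error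
    term. *)
Lemma entropy_euler_ge dl e A : 0 < dl -> hlb dl A -> hlb dl (euler e A) ->
  entropy A - e / 2 * rtr (fmx (@ln R) A *m lap A) <= entropy (euler e A).
Proof.
move=> d0 lA lB; have [hA _] := lA; have := klein d0 lB lA.
have -> : rtr (euler e A *m fmx (@ln R) A) = entropy A - e / 2 * rtr (fmx (@ln R) A *m lap A).
  rewrite -[euler e A](subrK A) subr_euler mulmxDl rtrD mulNmx rtrN -scalemxAl rtrZ.
  by rewrite -(entropyE hA) addrC [rtr (lap A *m _)]rtrC.
by rewrite rtr_euler subrr subr_ge0.
Qed.

(** The entropies of the [EV (ss j) A] enter with a minus sign and use the error-free bound, so the
    only error is the squared displacement of A itself. The first-order terms compare by
    [fisher_lap_le]. *)
Lemma entropy_gap_euler dl e A : 0 < dl -> hlb dl A -> 0 <= e -> e * n%:R <= 1 ->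
  entropy_gap (euler e A) - dl^-1 * rtr ((euler e A - A) *m (euler e A - A)) <= entropy_gap A.
Proof.
move=> d0 lA e0 en; have lB := euler_hlb e0 en lA.
have h1 := entropy_euler_le d0 lA lB.
have h4 : \sum_j c j * entropy (EV (ss j) A) - e / 2 * (\sum_j c j *
    rtr (fmx (@ln R) (EV (ss j) A) *m lap (EV (ss j) A))) <=
    \sum_j c j * entropy (EV (ss j) (euler e A)).
  rewrite mulr_sumr -sumrB; apply: ler_sum => j _; have oj := bd_on bd j.
  rewrite mulrCA -mulrBr; apply: ler_wpM2l; first exact: bd_ge0 bd j.
  rewrite EV_euler //; apply: (entropy_euler_ge d0 (EV_hlb oj lA)).
  by rewrite -EV_euler //; apply: EV_hlb.
have e2 : 0 <= e / 2 by rewrite divr_ge0.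
have h5 := ler_wpM2l e2 (fisher_lap_le d0 lA).
have alg (a b x y z w p : R) : b - x <= a - y -> z - w <= p -> w <= y -> b - p - x <= a - z.
  by lra.
exact: alg h1 h4 h5.
Qed.

(** * Decay of the graded components along the discrete flow *)

Local Notation multi_index := {ffun 'I_n -> bool}.
Implicit Types (al be : multi_index).

Definition weight al : R := \sum_i (al i)%:R.

(** Each [F al] stands for a monomial together with its coefficient, so the initial density is the
    plain sum of the [F al]; the component of weight 0 is the stationary state 1. *)
Definition graded (F : multi_index -> 'M[C]_D) : Prop :=
  (forall i al, W i *m F al *m adj (W i) = ((-1) ^+ al i)%:C *: F al) /\
  F [ffun=> false] = 1%:M.

Lemma weight_ge0 al : 0 <= weight al.
Proof. by apply: sumr_ge0. Qed.

Lemma weight_le al : weight al <= n%:R.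
Proof.
have -> : n%:R = \sum_(i < n) 1 :> R by rewrite sumr_const card_ord.
by apply: ler_sum => i _; case: (al i); rewrite ?ler01.
Qed.

Lemma weight_ge1 al : al != [ffun=> false] -> 1 <= weight al.
Proof.
move=> al0; have [i ali] : exists i, al i.
  apply/existsP; apply: contraR al0; rewrite negb_exists => /forallP h.
  by apply/eqP/ffunP => i; rewrite ffunE; apply/negbTE.
by rewrite /weight (bigD1 i) //= ali lerDl sumr_ge0.
Qed.

Lemma weight0 : weight [ffun=> false] = 0.
Proof. by rewrite /weight big1 // => i _; rewrite ffunE. Qed.

Context (F : multi_index -> 'M[C]_D) (gF : graded F).

Lemma lap_graded al : lap (F al) = (2 * weight al)%:C *: F al.
Proof.
have -> : 2 * weight al = n%:R - \sum_i (-1) ^+ al i.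
  have -> : n%:R = \sum_(i < n) 1 :> R by rewrite sumr_const card_ord.
  rewrite -sumrB mulr_sumr.
  by apply: eq_bigr => i _; case: (al i); rewrite /= ?expr1 ?expr0; ring.
rewrite /lap /nabla rmorphB scalerBl; congr (_ - _).
by rewrite rmorph_sum scaler_suml; apply: eq_bigr => i _; rewrite (proj1 gF).
Qed.

Lemma euler_graded e al : euler e (F al) = (1 - e * weight al)%:C *: F al.
Proof.
rewrite /euler lap_graded scalerA -rmorphM rmorphB rmorph1 scalerBl scale1r.
by congr (_ - _%:C *: _); field.
Qed.

Lemma euler_sum e (I : finType) (G : I -> 'M[C]_D) :
  euler e (\sum_i G i) = \sum_i euler e (G i).
Proof.
apply: (big_morph (euler e) (eulerD e)).
by rewrite /euler /lap /nabla big1 ?scaler0 ?subr0 ?scaler0 ?subr0 // => k _; rewrite mulmx0 mul0mx.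
Qed.

Lemma EV_sum s (I : finType) (G : I -> 'M[C]_D) : EV s (\sum_i G i) = \sum_i EV s (G i).
Proof.
apply: (big_morph (EV s) (EVD s)); elim: s => //= v s ->.
by rewrite /cjW mulmx0 mul0mx addr0 scaler0.
Qed.

Lemma EV1 s : onseq s -> EV s 1%:M = 1%:M.
Proof.
elim: s => //= v s IH [v1 _ os].
by rewrite (IH os) /cjW mulmx1 Wv_unitary // half_add.
Qed.

Definition flow e k : 'M[C]_D := iter k (euler e) (\sum_al F al).

Lemma flowE e k : flow e k = \sum_al ((1 - e * weight al) ^+ k)%:C *: F al.
Proof.
elim: k => [|k IH]; first by apply: eq_bigr => al _; rewrite expr0 rmorph1 scale1r.
rewrite /flow iterS -/(flow e k) IH euler_sum; apply: eq_bigr => al _.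
by rewrite eulerZ euler_graded scalerA -rmorphM exprSr.
Qed.

(** The double sum depends on G only, which makes the constant uniform in the step size and the
    time. *)
Lemma rtr_sum_sqr (a : multi_index -> R) (G : multi_index -> 'M[C]_D) (b : R) :
  (forall al, 0 <= a al <= b) ->
  rtr ((\sum_al (a al)%:C *: G al) *m (\sum_al (a al)%:C *: G al)) <=
  b ^+ 2 * \sum_al \sum_be `|rtr (G al *m G be)|.
Proof.
move=> hab; rewrite mulmx_suml rtr_sum mulr_sumr; apply: ler_sum => al _.
rewrite mulmx_sumr rtr_sum mulr_sumr; apply: ler_sum => be _.
rewrite -scalemxAl -scalemxAr scalerA -rmorphM rtrZ.
have /andP[a0 ab] := hab al; have /andP[a0' ab'] := hab be.
apply: le_trans (_ : a al * a be * `|rtr (G al *m G be)| <= _).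
  by apply: ler_wpM2l; [exact: mulr_ge0 | exact: ler_norm].
by apply: ler_wpM2r => //; rewrite expr2; apply: ler_pM.
Qed.

Lemma flow_hlb dl e k : 0 <= e -> e * n%:R <= 1 -> hlb dl (\sum_al F al) -> hlb dl (flow e k).
Proof.
by move=> e0 en lA; elim: k => [|k IH]; [exact: lA | exact: euler_hlb e0 en IH].
Qed.

Lemma flow_rate e k al : 0 <= e -> e * n%:R <= 1 -> al != [ffun=> false] ->
  0 <= (1 - e * weight al) ^+ k <= (1 - e) ^+ k.
Proof.
move=> e0 en al0.
have h0 : 0 <= 1 - e * weight al.
  rewrite subr_ge0; apply: le_trans en; apply: ler_wpM2l => //; exact: weight_le.
rewrite exprn_ge0 //=; apply: lerXn2r; rewrite ?nnegrE //.
  apply: le_trans h0 _; rewrite lerD2l lerN2 -[leLHS]mulr1.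
  by apply: ler_wpM2l => //; apply: weight_ge1.
by rewrite lerD2l lerN2 -[leLHS]mulr1; apply: ler_wpM2l => //; apply: weight_ge1.
Qed.

(** The component [al] moves by e |al| (1 - e |al|)^k, which is 0 for weight 0 and at most e n (1 -
    e)^k for weights between 1 and n. *)
Lemma flow_step_sqr e k : 0 <= e <= 1 -> e * n%:R <= 1 ->
  rtr ((flow e k.+1 - flow e k) *m (flow e k.+1 - flow e k)) <=
  (e * n%:R * (1 - e) ^+ k) ^+ 2 * \sum_al \sum_be `|rtr (F al *m F be)|.
Proof.
move=> /andP[e0 e1] en; pose a al := e * weight al * (1 - e * weight al) ^+ k.
have -> : flow e k.+1 - flow e k = - \sum_al (a al)%:C *: F al.
  rewrite !flowE -sumrB -sumrN; apply: eq_bigr => al _.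
  have -> : - ((a al)%:C *: F al) = (- a al)%:C *: F al by rewrite rmorphN scaleNr.
  by rewrite -scalerBl -rmorphB; congr (_%:C *: _); rewrite exprS /a; ring.
rewrite mulmxN mulNmx opprK; apply: rtr_sum_sqr => al.
have [->|al0] := eqVneq al [ffun=> false].
  by rewrite /a weight0 mulr0 mul0r lexx !mulr_ge0 ?exprn_ge0 ?subr_ge0.
have /andP[h0 h1] := flow_rate k e0 en al0.
rewrite /a mulr_ge0 ?mulr_ge0 ?weight_ge0 //=.
apply: ler_pM => //; first by rewrite mulr_ge0 ?weight_ge0.
by apply: ler_wpM2l => //; apply: weight_le.
Qed.

Lemma fmx_ln1 : fmx (@ln R) (1%:M : 'M[C]_D) = 0.
Proof.
have -> : (1%:M : 'M[C]_D) = fmx (fun=> 1) 1%:M by rewrite fmx_cst.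
rewrite fmx_comp (_ : _ \o _ = fun=> 0); first by rewrite fmx_cst raddf0.
by apply/funext => x /=; rewrite ln1.
Qed.

Lemma hlb1 : hlb 1 (1%:M : 'M[C]_D).
Proof. by split; [exact: adj_1 | move=> v; rewrite mul1r]. Qed.

Lemma hlbW dl dl' A : dl' <= dl -> hlb dl A -> hlb dl' A.
Proof.
move=> le [hA lA]; split=> // v; apply: le_trans (lA v).
by rewrite ler_wpM2r ?qf1_ge0.
Qed.

Lemma entropy_ge0 dl A : 0 < dl -> dl <= 1 -> hlb dl A -> rtr A = D%:R -> 0 <= entropy A.
Proof.
move=> d0 d1 lA tA; have := klein d0 lA (hlbW d1 hlb1).
by rewrite fmx_ln1 mulmx0 rtr0 rtr1 tA subrr subr0.
Qed.

Lemma entropy_le_sqr dl A : 0 < dl -> dl <= 1 -> hlb dl A -> rtr A = D%:R ->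
  entropy A <= dl^-1 * rtr ((A - 1%:M) *m (A - 1%:M)).
Proof.
move=> d0 d1 lA tA; have := klein_reverse d0 (hlbW d1 hlb1) lA.
by rewrite fmx_ln1 mulmx0 rtr0 rtr1 tA subrr subr0 add0r.
Qed.

Lemma EV_flow_sqr s e k : onseq s -> 0 <= e <= 1 -> e * n%:R <= 1 ->
  rtr ((EV s (flow e k) - 1%:M) *m (EV s (flow e k) - 1%:M)) <=
  ((1 - e) ^+ k) ^+ 2 * \sum_al \sum_be `|rtr (EV s (F al) *m EV s (F be))|.
Proof.
move=> os /andP[e0 e1] en.
pose a al := if al == [ffun=> false] then 0 else (1 - e * weight al) ^+ k.
have -> : EV s (flow e k) - 1%:M = \sum_al (a al)%:C *: EV s (F al).
  rewrite flowE EV_sum (bigD1 [ffun=> false]) //= [RHS](bigD1 [ffun=> false]) //=.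
  have -> : a [ffun=> false] = 0 by rewrite /a eqxx.
  rewrite rmorph0 scale0r add0r weight0 mulr0 subr0 expr1n rmorph1 scale1r.
  rewrite (proj2 gF) (EV1 os) [LHS]addrAC subrr add0r.
  by apply: eq_bigr => al /negPf al0; rewrite EVZ /a al0.
apply: rtr_sum_sqr => al; rewrite /a; case: eqVneq => [_|al0].
  by rewrite lexx exprn_ge0 ?subr_ge0.
exact: flow_rate.
Qed.

Lemma rtr_flow e k : rtr (flow e k) = rtr (\sum_al F al).
Proof. by elim: k => // k IH; rewrite /flow iterS rtr_euler. Qed.

(** K Euler steps lower the initial gap bound by at most C1 e in total, and the gap at the end is at
    least -C2 (1 - e)^(2K), because every [EV (ss j) (flow e K)] is by then close to 1. *)
Lemma entropy_gap_ge0 dl : 0 < dl -> hlb dl (\sum_al F al) ->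
  rtr (\sum_al F al) = D%:R -> 0 <= entropy_gap (\sum_al F al).
Proof.
(* Capped at 1 so that the identity, the limit of the flow, satisfies the same lower bound. *)
move=> d0' lA' tA; pose d := Num.min dl 1.
have d0 : 0 < d by rewrite lt_min d0' ltr01.
have d1 : d <= 1 by rewrite ge_min lexx orbT.
have lA : hlb d (\sum_al F al) by apply: hlbW lA'; rewrite ge_min lexx.
pose C1 := d^-1 * (n%:R ^+ 2 * \sum_al \sum_be `|rtr (F al *m F be)|).
pose C2 := \sum_j c j * (d^-1 *
  \sum_al \sum_be `|rtr (EV (ss j) (F al) *m EV (ss j) (F be))|).
have C10 : 0 <= C1.
  rewrite mulr_ge0 ?invr_ge0 ?(ltW d0) // mulr_ge0 ?sqr_ge0 //.
  by apply: sumr_ge0 => al _; apply: sumr_ge0.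
have C20 : 0 <= C2.
  apply: sumr_ge0 => j _; rewrite mulr_ge0 ?(bd_ge0 bd) // mulr_ge0 ?invr_ge0 ?(ltW d0) //.
  by apply: sumr_ge0 => al _; apply: sumr_ge0.
have main e K : 0 <= e <= 1 -> e * n%:R <= 1 ->
    - (C1 * e) - C2 * ((1 - e) ^+ K) ^+ 2 <= entropy_gap (\sum_al F al).
  move=> e01 en; have /andP[e0 e1] := e01.
  have step : entropy_gap (flow e K) - C1 * e ^+ 2 * \sum_(k < K) ((1 - e) ^+ k) ^+ 2 <=
      entropy_gap (\sum_al F al).
    elim: K => [|K IH]; first by rewrite big_ord0 mulr0 subr0.
    apply: le_trans IH; have h1 := entropy_gap_euler d0 (flow_hlb K e0 en lA) e0 en.
    have h2 := flow_step_sqr K e01 en.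
    rewrite -/(flow e K.+1) in h1; rewrite -[euler e (flow e K)]/(flow e K.+1) in h1.
    have dV : 0 <= d^-1 by rewrite invr_ge0 ltW.
    have h3 := ler_wpM2l dV h2.
    rewrite big_ord_recr mulrDr /=.
    have h4 : C1 * e ^+ 2 * ((1 - e) ^+ K) ^+ 2 = d^-1 *
        ((e * n%:R * (1 - e) ^+ K) ^+ 2 * \sum_al \sum_be `|rtr (F al *m F be)|).
      by rewrite /C1 !exprMn; move: (\sum_al _) => S; ring.
    have alg (a b x y z w : R) : a - x <= b -> x <= y -> y = w -> a - (z + w) <= b - z by lra.
    exact: alg h1 h3 (esym h4).
  apply: le_trans step.
  have g1 : C1 * e ^+ 2 * \sum_(k < K) ((1 - e) ^+ k) ^+ 2 <= C1 * e.
    have -> : C1 * e ^+ 2 * \sum_(k < K) ((1 - e) ^+ k) ^+ 2 =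
        C1 * e * (e * \sum_(k < K) ((1 - e) ^+ k) ^+ 2).
      by move: (\sum_(k < K) _) => S; ring.
    by rewrite -[leRHS]mulr1; apply: ler_wpM2l; [exact: mulr_ge0 | exact: geometric_sum_le].
  have lB := flow_hlb K e0 en lA; have tB : rtr (flow e K) = D%:R by rewrite rtr_flow.
  have g2 := entropy_ge0 d0 d1 lB tB.
  have g3 : \sum_j c j * entropy (EV (ss j) (flow e K)) <= C2 * ((1 - e) ^+ K) ^+ 2.
    rewrite /C2 mulr_suml; apply: ler_sum => j _; rewrite -mulrA.
    apply: ler_wpM2l; first exact: bd_ge0 bd j.
    have oj := bd_on bd j; have tE : rtr (EV (ss j) (flow e K)) = D%:R by rewrite rtr_EV.
    apply: le_trans (entropy_le_sqr d0 d1 (EV_hlb oj lB) tE) _.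
    rewrite -mulrA; apply: ler_wpM2l; first by rewrite invr_ge0 ltW.
    by rewrite mulrC; apply: EV_flow_sqr.
  have alg (a b x y z : R) : x <= y -> 0 <= a -> b <= z -> - y - z <= a - b - x by lra.
  exact: alg g1 g2 g3.
apply/ler_addgt0Pl => r r0; rewrite addrC.
(* The first entry gives both e <= 1 and e n <= 1, the second C1 e <= r / 2; adding 1 keeps the
   denominators positive. *)
pose e := Num.min (n.+1%:R^-1) (r / 2 / (C1 + 1)).
have e0 : 0 < e by rewrite lt_min invr_gt0 ltr0n /= !divr_gt0 // ltr_wpDl.
have en' : e * n.+1%:R <= 1.
  by rewrite -ler_pdivlMr ?ltr0n // mul1r ge_min lexx.
have en : e * n%:R <= 1.
  by apply: le_trans en'; rewrite ler_wpM2l ?(ltW e0) // ler_nat.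
have e1 : e <= 1.
  by apply: le_trans en'; rewrite -[leLHS]mulr1 ler_wpM2l ?(ltW e0) // ler1n.
have e01 : 0 <= e <= 1 by rewrite ltW.
have eC : C1 * e <= r / 2.
  apply: le_trans (_ : (C1 + 1) * e <= _); first by rewrite ler_wpM2r ?(ltW e0) // lerDl.
  by rewrite mulrC -ler_pdivlMr ?ltr_wpDl // ge_min lexx orbT.
(* Chosen so that C2 <= (r / 2) K e; as x K e <= 1 by [geometric_le], the terminal error C2 x is at
   most r / 2. *)
pose K := (Num.truncn (C2 * 2 / r / e)).+1.
have KC : C2 <= r / 2 * (K%:R * e).
  have h : C2 * 2 / r / e <= K%:R by apply/ltW/truncnS_gt.
  rewrite ler_pdivrMr // ler_pdivrMr // in h; lra.
have q := geometric_le K e01; set x := ((1 - e) ^+ K) ^+ 2 in q *.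
have x0 : 0 <= x by exact: sqr_ge0.
have m := main e K e01 en; rewrite -/x in m.
have C2x : C2 * x <= r / 2.
  apply: le_trans (_ : r / 2 * (K%:R * e) * x <= _); first by rewrite ler_wpM2r.
  rewrite -[leRHS]mulr1 -mulrA ler_wpM2l ?divr_ge0 ?(ltW r0) //.
  by apply: le_trans q; rewrite mulrC mulrDr mulr1 lerDr.
have alg (a b g r' : R) : - a - b <= g -> a <= r' / 2 -> b <= r' / 2 -> 0 <= r' + g by lra.
by rewrite addrC; exact: alg m eC C2x.
Qed.

End CliffordFlow.

(** * Gibbs states and duality between entropy and exponentials *)

Section Gibbs.
Context {R : realType} {D : nat}.
Local Notation C := R[i].
Implicit Types (A B H : 'M[C]_D) (f : R -> R) (dl : R).

Lemma exists_hlb_fmx f A : (forall i, 0 < f (eigs A i)) -> exists2 dl, 0 < dl & hlb dl (fmx f A).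
Proof.
move=> f0; pose s := 1 + \sum_i (f (eigs A i))^-1.
(* The inverse of s lies below every f-value, without taking a minimum; the summand 1 covers
   [D = 0]. *)
have s0 : 0 < s by rewrite ltr_pwDl // sumr_ge0 // => i _; rewrite invr_ge0 ltW.
exists s^-1; first by rewrite invr_gt0.
apply: hlb_fmx => i; rewrite -[leRHS]invrK lef_pV2 ?posrE ?invr_gt0 //.
rewrite /s (bigD1 i) //= addrCA lerDl addr_ge0 // sumr_ge0 // => j _.
by rewrite invr_ge0 ltW.
Qed.

Definition partition_fun H : R := rtr (fmx expR H) / D%:R.

Lemma partition_fun_gt0 H : (0 < D)%N -> 0 < partition_fun H.
Proof.
move=> D0; rewrite divr_gt0 ?ltr0n // rtr_fmx (bigD1 (Ordinal D0)) //=.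
by rewrite ltr_wpDr ?expR_gt0 // sumr_ge0 // => i _; rewrite expR_ge0.
Qed.

(** As [partition_fun] is the normalized trace of e^H, this has trace [D] rather than 1, in
    agreement with a weight-0 component equal to the identity. *)
Definition gibbs_state H : 'M[C]_D := fmx (fun x => expR x / partition_fun H) H.

Lemma rtr_gibbs H : (0 < D)%N -> rtr (gibbs_state H) = D%:R.
Proof.
move=> D0; rewrite /gibbs_state; under eq_fun do rewrite mulrC.
have Z0 := partition_fun_gt0 H D0; have D0' : 0 < D%:R :> R by rewrite ltr0n.
rewrite fmxZ rtrZ.
have -> : rtr (fmx expR H) = partition_fun H * D%:R.
  by rewrite /partition_fun divfK // gt_eqF.
by rewrite mulKf // gt_eqF.
Qed.

Lemma hlb_gibbs H : (0 < D)%N -> exists2 dl, 0 < dl & hlb dl (gibbs_state H).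
Proof.
move=> D0; apply: exists_hlb_fmx => i.
by rewrite divr_gt0 ?expR_gt0 ?partition_fun_gt0.
Qed.

Lemma ln_gibbs H : adj H = H -> (0 < D)%N ->
  fmx (@ln R) (gibbs_state H) = H - (ln (partition_fun H))%:C%:M.
Proof.
move=> hH D0; rewrite fmx_comp.
have -> : @ln R \o (fun x => expR x / partition_fun H) =
    (fun x => x + - ln (partition_fun H)).
  by apply/funext => x /=; rewrite ln_div ?posrE ?expR_gt0 ?partition_fun_gt0 // expRK.
by rewrite (fmxD id) fmx_id // fmx_cst rmorphN raddfN.
Qed.

(** Klein's inequality against the Gibbs state, whose logarithm is H minus a scalar. *)
Lemma gibbs_variational dl B H : (0 < D)%N -> 0 < dl -> hlb dl B -> adj H = H ->
  rtr B = D%:R -> rtr (B *m H) <= entropy B + D%:R * ln (partition_fun H).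
Proof.
move=> D0 d0 lB hH tB; have [d1 d10 lG] := hlb_gibbs H D0.
pose d := Num.min dl d1; have d00 : 0 < d by rewrite lt_min d0.
have lB' : hlb d B by apply: hlbW lB; rewrite ge_min lexx.
have lG' : hlb d (gibbs_state H) by apply: hlbW lG; rewrite ge_min lexx orbT.
have := klein d00 lB' lG'; rewrite rtr_gibbs // tB subrr ln_gibbs // mulmxBr rtrB.
have -> : rtr (B *m (ln (partition_fun H))%:C%:M) = D%:R * ln (partition_fun H).
  by rewrite mul_mx_scalar rtrZ tB mulrC.
have alg (a b x : R) : 0 <= a - (b - x) -> b <= a + x by lra.
exact: alg.
Qed.

Lemma entropy_gibbs H : adj H = H -> (0 < D)%N ->
  entropy (gibbs_state H) = rtr (gibbs_state H *m H) - D%:R * ln (partition_fun H).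
Proof.
move=> hH D0; rewrite entropyE; last exact: adj_fmx.
by rewrite ln_gibbs // mulmxBr rtrB mul_mx_scalar rtrZ rtr_gibbs // [_ * D%:R]mulrC.
Qed.

(** The counterpart of [gibbs_variational] for an infinite exponent: no entropy term, and the top of
    the spectrum in place of a free energy. *)
Lemma rtr_mul_le dl B H (l : R) : 0 < dl -> hlb dl B -> adj H = H ->
  (forall i, eigs H i <= l) -> rtr (B *m H) <= rtr B * l.
Proof.
move=> d0 lB hH hl; have [hB _] := lB.
have -> : rtr (B *m H) = \sum_i \sum_j eigs B i * eigs H j * ovl B H i j.
  by rewrite -{1}(fmx_id hB) -{1}(fmx_id hH) rtr_fmx2.
have -> : rtr B = \sum_i \sum_j eigs B i * ovl B H i j.
  by rewrite -{1}(fmx_id hB) (rtr_fmx2l _ _ H).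
rewrite mulr_suml; apply: ler_sum => i _; rewrite mulr_suml; apply: ler_sum => j _.
rewrite mulrAC; apply: ler_wpM2l (hl j); rewrite mulr_ge0 ?nsq_ge0 // ltW //.
exact: lt_le_trans d0 (hlb_eigs i lB).
Qed.

Context {n N : nat} (W : 'I_n -> 'M[C]_D) (hW : anticliff W).
Context (c : 'I_N -> R) (us ss : 'I_N -> seq 'rV[R]_n) (bd : brascamp_datum c us ss).

(* Gibbs' variational principle turns superadditivity of entropy into the
   inequality for exponentials; L j plays the role of ln ||e^{H_j}||_{p_j}. *)
Lemma ln_partition_le (H : 'I_N -> 'M[C]_D) (L : 'I_N -> R)
    (F : {ffun 'I_n -> bool} -> 'M[C]_D) :
  (0 < D)%N -> (forall j, adj (H j) = H j) ->
  (forall j w, w \in ss j -> cjW W w (H j) = H j) ->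
  graded W F -> \sum_al F al = gibbs_state (\sum_j H j) ->
  (forall j dl B, 0 < dl -> hlb dl B -> rtr B = D%:R ->
     rtr (B *m H j) <= c j * entropy B + D%:R * L j) ->
  ln (partition_fun (\sum_j H j)) <= \sum_j L j.
Proof.
move=> D0 hH fH gF FE hL; set K := \sum_j H j in FE *.
have hK : adj K = K by rewrite /K adj_sum; apply: eq_bigr => j _.
have [dl d0 lA] := hlb_gibbs K D0; have tA := rtr_gibbs K D0.
have := entropy_gap_ge0 hW bd gF d0; rewrite FE => /(_ lA tA).
rewrite /entropy_gap entropy_gibbs //; set A := gibbs_state K in lA tA *.
(* [H j] is fixed by the reflections in [ss j], so it pairs with A only through the conditional
   expectation. *)
have -> : rtr (A *m K) = \sum_j rtr (EV W (ss j) A *m H j).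
  rewrite /K mulmx_sumr rtr_sum; apply: eq_bigr => j _.
  by rewrite (rtr_EV_mul hW A (bd_on bd j) (fH j)).
have h : \sum_j rtr (EV W (ss j) A *m H j) <=
    \sum_j (c j * entropy (EV W (ss j) A)) + D%:R * \sum_j L j.
  rewrite mulr_sumr -big_split; apply: ler_sum => j _ /=.
  apply: (hL j dl) => //; first exact: (EV_hlb hW (bd_on bd j) lA).
  by rewrite (rtr_EV hW A (bd_on bd j)).
have alg (a b x y : R) : a <= b + y -> 0 <= a - x - b -> x <= y by lra.
move=> h'; have := alg _ _ _ _ h h'.
by rewrite ler_pM2l ?ltr0n.
Qed.

End Gibbs.

(** * Monomials in Clifford generators *)

Section CliffordSpan.
Context {R : realType} {n d : nat}.
Local Notation C := R[i].
Local Notation multi_index := {ffun 'I_n -> bool}.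
Implicit Types (q : 'I_n -> 'M[C]_d) (al : multi_index) (r : seq 'I_n).

Definition cliff_rel q : Prop :=
  forall i j, q i *m q j + q j *m q i = (2 * (i == j)%:R)%:M.

(** [Qpow] over an arbitrary list of indices, to allow induction on the list. *)
Definition monomial q r al : 'M[C]_d := \prod_(k <- r) q k ^+ al k.

Lemma cliff_rel_sq q i : cliff_rel q -> q i *m q i = 1%:M.
Proof.
move=> cq; have := cq i i; rewrite eqxx mulr1 => h.
rewrite -[LHS](half_add (q i *m q i)) h scale_scalar_mx.
have -> : 2 = (2%:C : C) by rewrite (rmorph_nat (real_complex R)).
by rewrite -rmorphM mulVf ?pnatr_eq0 // rmorph1.
Qed.

Lemma cliff_rel_anti q i j : cliff_rel q -> i != j -> q i *m q j = - (q j *m q i).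
Proof.
move=> cq ij; apply/eqP; rewrite -addr_eq0 cq (negPf ij) mulr0.
by rewrite raddf0.
Qed.

Lemma cliff_relN q : cliff_rel q -> cliff_rel (fun i => - q i).
Proof. by move=> cq i j; rewrite !mulmxN !mulNmx !opprK. Qed.

Lemma monomial_nil q al : monomial q [::] al = 1%:M.
Proof. by rewrite /monomial big_nil. Qed.

Lemma monomial_cons q k r al : monomial q (k :: r) al = q k ^+ al k *m monomial q r al.
Proof. by rewrite /monomial big_cons. Qed.

Lemma exprb (x : 'M[C]_d) (b : bool) : x ^+ b = if b then x else 1%:M.
Proof. by case: b; rewrite ?expr1 ?expr0. Qed.

Lemma monomialN q r al :
  monomial (fun i => - q i) r al = (-1) ^+ (\sum_(k <- r) al k)%N *: monomial q r al.
Proof.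
elim: r => [|k r IH]; first by rewrite !monomial_nil big_nil expr0 scale1r.
rewrite !monomial_cons big_cons IH -scalemxAr exprD [in RHS]mulrC -scalerA.
rewrite [in RHS]scalemxAl; congr (_ *: (_ *m _)); rewrite !exprb.
by case: (al k); rewrite ?expr1 ?expr0 ?scale1r ?scaleN1r.
Qed.

Lemma conj_sqM (q x y : 'M[C]_d) : q *m q = 1%:M ->
  q *m (x *m y) *m q = (q *m x *m q) *m (q *m y *m q).
Proof. by move=> qq; rewrite !mulmxA -(mulmxA _ q q) qq mulmx1. Qed.

(* Conjugation by q_i after the grading automorphism q |-> - q reflects the i-th
   coordinate. *)
Lemma monomial_reflect q i r al : cliff_rel q ->
  q i *m monomial (fun k => - q k) r al *m q i =
  (-1) ^+ (\sum_(k <- r) ((k == i) && al k))%N *: monomial q r al.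
Proof.
move=> cq; have qq := cliff_rel_sq i cq; elim: r => [|k r IH].
  by rewrite !monomial_nil big_nil expr0 scale1r mulmx1.
rewrite !monomial_cons big_cons (conj_sqM _ _ qq) IH -scalemxAr exprD.
rewrite [in RHS]mulrC -scalerA [in RHS]scalemxAl; congr (_ *: (_ *m _)).
rewrite !exprb; case: (al k); last by rewrite andbF expr0 scale1r mulmx1.
rewrite andbT; case: eqVneq => [->|ki].
  by rewrite mulmxN mulNmx qq mul1mx scaleN1r.
by rewrite expr0 scale1r mulmxN -(cliff_rel_anti cq ki) -mulmxA qq mulmx1.
Qed.

Definition flip i al : multi_index := [ffun k => (k == i) (+) al k].

(** The number of factors that q_i has to anticommute past before it reaches its own position in
    r. *)
Fixpoint flip_sign i r al : nat :=
  if r is k :: r' then (if k == i then 0 else al k + flip_sign i r' al)%N else 0%N.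

Lemma monomial_mul q i r al : cliff_rel q -> uniq r -> i \in r ->
  q i *m monomial q r al = (-1) ^+ flip_sign i r al *: monomial q r (flip i al).
Proof.
move=> cq; have qq := cliff_rel_sq i cq; elim: r => //= k r IH /andP[kr ur].
rewrite in_cons !monomial_cons mulmxA => /orP[/eqP ik|ir].
  subst k; rewrite eqxx expr0 scale1r ffunE eqxx; congr (_ *m _).
    by rewrite !exprb; case: (al i); rewrite ?mulmx1.
  rewrite /monomial big_seq [RHS]big_seq; apply: eq_bigr => l lr; rewrite ffunE.
  by case: eqVneq lr kr => [-> ->|].
have ki : k != i by apply: contraNneq kr => ->.
rewrite (negPf ki) ffunE (negPf ki) /= exprD -scalerA.
have -> : q i *m q k ^+ al k = (-1) ^+ al k *: (q k ^+ al k *m q i).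
  rewrite exprb; case: (al k); last by rewrite expr0 scale1r mulmx1 mul1mx.
  by rewrite expr1 scaleN1r; apply: cliff_rel_anti; rewrite // eq_sym.
by rewrite -scalemxAl -mulmxA IH // -scalemxAr.
Qed.

End CliffordSpan.

(** * The grading automorphism and the doubled representation *)

Section Doubling.
Context {R : realType} {n : nat}.
Local Notation C := R[i].
Local Notation d := (2 ^ n)%N.
Local Notation multi_index := {ffun 'I_n -> bool}.
Context (Q : 'I_n -> 'M[C]_(2 ^ n)) (cQ : clifford_generators Q).
Implicit Types (A B X Y H : 'M[C]_(2 ^ n)) (al : multi_index) (w : 'rV[R]_n).

Local Notation Q' := (fun i => - Q i).

Lemma cliff_relQ : cliff_rel Q.
Proof. exact: cliff_anticomm cQ. Qed.

Lemma adj_Q i : adj (Q i) = Q i.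
Proof. exact/hermP/(cliff_selfadj cQ). Qed.

Lemma QpowE (q : 'I_n -> 'M[C]_(2 ^ n)) al : Qpow q al = monomial q (index_enum 'I_n) al.
Proof. by []. Qed.

(* B is the image of A under the grading automorphism. *)
Definition graded_pair A B : Prop :=
  exists x : multi_index -> C,
    A = \sum_al x al *: Qpow Q al /\ B = \sum_al x al *: Qpow Q' al.

Lemma gp_lin (a : C) A B X Y : graded_pair A B -> graded_pair X Y ->
  graded_pair (a *: A + X) (a *: B + Y).
Proof.
move=> [x [-> ->]] [y [-> ->]]; exists (fun al => a * x al + y al); split;
  rewrite scaler_sumr -big_split; apply: eq_bigr => al _;
  by rewrite scalerDl scalerA.
Qed.

Lemma gp0 : graded_pair 0 0.
Proof. by exists (fun=> 0); split; rewrite big1 // => al _; rewrite scale0r. Qed.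

Lemma gpZ (a : C) A B : graded_pair A B -> graded_pair (a *: A) (a *: B).
Proof. by move=> h; have := gp_lin a h gp0; rewrite !addr0. Qed.

Lemma gpD A B X Y : graded_pair A B -> graded_pair X Y -> graded_pair (A + X) (B + Y).
Proof. by move=> h k; have := gp_lin 1 h k; rewrite !scale1r. Qed.

Lemma gp_sum (I : finType) (F G : I -> 'M[C]_(2 ^ n)) :
  (forall i, graded_pair (F i) (G i)) -> graded_pair (\sum_i F i) (\sum_i G i).
Proof.
move=> h; elim/big_ind2: _ => //; first exact: gp0.
by move=> *; apply: gpD.
Qed.

Lemma Qpow0 (q : 'I_n -> 'M[C]_(2 ^ n)) : Qpow q [ffun=> false] = 1%:M :> 'M[C]_(2 ^ n).
Proof. by rewrite /Qpow big1 // => i _; rewrite ffunE expr0. Qed.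

Lemma gp1 : graded_pair 1%:M 1%:M.
Proof.
exists (fun al => (al == [ffun=> false])%:R); split;
  rewrite (bigD1 [ffun=> false]) //= big1 ?addr0 ?eqxx ?scale1r ?Qpow0 // => al /negPf->;
  by rewrite scale0r.
Qed.

(** [monomial_mul] depends only on the anticommutation relations, which the -Q_k satisfy as well;
    both sides therefore acquire the same sign and the same flipped index. *)
Lemma gp_mulQ i A B : graded_pair A B -> graded_pair (Q i *m A) (- Q i *m B).
Proof.
move=> [x [-> ->]]; rewrite !mulmx_sumr; apply: gp_sum => al.
rewrite -!scalemxAr; apply: gpZ.
rewrite !QpowE (monomial_mul al cliff_relQ (index_enum_uniq _) (mem_index_enum i)).
rewrite (monomial_mul al (cliff_relN cliff_relQ) (index_enum_uniq _) (mem_index_enum i)).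
apply: gpZ; exists (fun be => (be == flip i al)%:R); split;
  rewrite (bigD1 (flip i al)) //= big1 ?addr0 ?eqxx ?scale1r // => be /negPf->;
  by rewrite scale0r.
Qed.

Lemma gp_mul_monomial r al A B : graded_pair A B ->
  graded_pair (monomial Q r al *m A) (monomial Q' r al *m B).
Proof.
move=> h; elim: r => [|k r IH]; first by rewrite !monomial_nil !mul1mx.
rewrite !monomial_cons -!mulmxA !exprb; case: (al k); last by rewrite !mul1mx.
exact: gp_mulQ.
Qed.

Lemma gpM A B X Y : graded_pair A B -> graded_pair X Y -> graded_pair (A *m X) (B *m Y).
Proof.
move=> [x [-> ->]] h; rewrite !mulmx_suml; apply: gp_sum => al.
by rewrite -!scalemxAl; apply: gpZ; rewrite !QpowE; apply: gp_mul_monomial.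
Qed.

Lemma gpQ i : graded_pair (Q i) (- Q i).
Proof. by have := gp_mulQ i gp1; rewrite !mulmx1. Qed.

Lemma gp_adj A B : graded_pair A B -> graded_pair (adj A) (adj B).
Proof.
move=> [x [-> ->]]; rewrite !adj_sum; apply: gp_sum => al; rewrite !adj_scale.
apply: gpZ; rewrite !QpowE; elim: (index_enum _) => [|k r IH].
  by rewrite !monomial_nil !adj_1; apply: gp1.
rewrite !monomial_cons !adjM; apply: (gpM IH).
rewrite !exprb; case: (al k); last by rewrite !adj_1; apply: gp1.
by rewrite adjN adj_Q; apply: gpQ.
Qed.

(** Linear independence of the Q^alpha; with linearity of the relation it makes the graded partner
    unique. *)
Lemma gp_inj B : graded_pair 0 B -> B = 0.
Proof.
move=> [x [/esym/(cliff_free cQ) x0 ->]].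
by rewrite big1 // => al _; rewrite x0 scale0r.
Qed.

Lemma gp_tau (x : multi_index -> C) : tau (\sum_al x al *: Qpow Q' al) = x [ffun=> false].
Proof.
have -> : \sum_al x al *: Qpow Q' al =
    \sum_al (x al * (-1) ^+ (\sum_(k <- index_enum 'I_n) al k)%N) *: Qpow Q al.
  by apply: eq_bigr => al _; rewrite !QpowE monomialN scalerA.
rewrite (cliff_tau cQ) big1 ?expr0 ?mulr1 // => k _.
by rewrite ffunE.
Qed.

Lemma gp_trace A B : graded_pair A B -> \tr A = \tr B.
Proof.
move=> [x [AE BE]]; have : tau A = tau B by rewrite AE BE gp_tau (cliff_tau cQ).
by rewrite /tau => /mulfI; apply; rewrite invr_eq0 pnatr_eq0 -lt0n expn_gt0.
Qed.

(** The relation is preserved by polynomials, and f may be replaced by a polynomial that agrees with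
    it on the finitely many eigenvalues. *)
Lemma gp_fmx f A B : adj A = A -> adj B = B -> graded_pair A B ->
  graded_pair (fmx f A) (fmx f B).
Proof.
move=> hA hB hAB.
pose G (g : R -> R) := graded_pair (fmx g A) (fmx g B).
have GD g h : G g -> G h -> G (fun x => g x + h x) by rewrite /G !fmxD; apply: gpD.
have GZ a g : G g -> G (fun x => a * g x) by rewrite /G !fmxZ; apply: gpZ.
have GM g h : G g -> G h -> G (fun x => g x * h x) by rewrite /G -!fmxM; apply: gpM.
have Gc a : G (fun=> a) by rewrite /G !fmx_cst -!(scalemx1 _ a%:C); apply: gpZ gp1.
have Gid : G id by rewrite /G !fmx_id.
(* A product of linear factors, whose zeros are exactly the points of s. *)
have Gnull (s : seq R) : exists g, [/\ G g, forall x, x \in s -> g x = 0 &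
    forall x, x \notin s -> g x != 0].
  elim: s => [|y s [g [Gg gs gn]]].
    by exists (fun=> 1); split=> // x _; rewrite oner_eq0.
  exists (fun x => (x + - y) * g x); split.
  - by apply: (GM (fun x => x + - y) g) => //; apply: (GD id).
  - by move=> x; rewrite in_cons => /predU1P[->|/gs ->]; rewrite ?subrr ?mul0r ?mulr0.
  - move=> x; rewrite in_cons negb_or => /andP[xy xs].
    by rewrite mulf_neq0 ?gn // subr_eq0.
(* Newton interpolation: each new node is corrected by a multiple of the polynomial that vanishes at
   the old ones. *)
have Gint (s : seq R) : exists2 g, G g & forall x, x \in s -> g x = f x.
  elim: s => [|y s [g Gg gs]]; first by exists (fun=> 0).
  have [ys|ys] := boolP (y \in s).
    by exists g => // x; rewrite in_cons => /predU1P[->|]; apply: gs.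
  have [h [Gh hs hn]] := Gnull s.
  exists (fun x => g x + (f y - g y) / h y * h x); first by apply: GD => //; apply: GZ.
  move=> x; rewrite in_cons => /predU1P[->|xs].
    by rewrite divfK ?hn // addrC subrK.
  by rewrite (hs x xs) mulr0 addr0 gs.
(* A single interpolant has to serve both matrices, hence the union of the two spectra. *)
have [g Gg gf] := Gint (codom (eigs A) ++ codom (eigs B)).
have -> : fmx f A = fmx g A.
  by apply: eq_fmx_eigs => i; rewrite gf // mem_cat codom_f.
have -> // : fmx f B = fmx g B.
by apply: eq_fmx_eigs => i; rewrite gf // mem_cat codom_f orbT.
Qed.

(* In the doubled representation A |-> dg A A' the swap S of the two copies implements
   the grading automorphism, and dblW i is diag(Q_i, -Q_i) * S. *)
Definition dg A B : 'M[C]_(d + d) := block_mx A 0 0 B.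

Definition dblW i : 'M[C]_(d + d) := block_mx 0 (Q i) (- Q i) 0.

Lemma adj_block (A B X Y : 'M[C]_d) :
  adj (block_mx A B X Y) = block_mx (adj A) (adj X) (adj B) (adj Y).
Proof. by rewrite adj.unlock tr_block_mx map_block_mx. Qed.

Lemma anticliff_dblW : anticliff dblW.
Proof.
split=> [i|i j]; rewrite /dblW.
  by rewrite adj_block !adj0 adjN adj_Q opp_block_mx !oppr0 opprK.
rewrite !mulmx_block !mul0mx !mulmx0 !add0r !addr0 !mulmxN !mulNmx add_block_mx addr0.
rewrite -opprD cliff_relQ scalar_mx_block.
have -> : (- 2 * (i == j)%:R : R)%:C%:M = - (2 * (i == j)%:R)%:M :> 'M[C]_d.
  by rewrite -raddfN /= mulNr rmorphN rmorphM !rmorph_nat.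
by congr block_mx; congr (- _); rewrite addrC cliff_relQ eq_sym.
Qed.

Lemma adj_dg A B : adj (dg A B) = dg (adj A) (adj B).
Proof. by rewrite /dg adj_block !adj0. Qed.

Lemma dgM A B X Y : dg A B *m dg X Y = dg (A *m X) (B *m Y).
Proof. by rewrite /dg mulmx_block !mul0mx !mulmx0 !addr0 !add0r. Qed.

Lemma dgD A B X Y : dg A B + dg X Y = dg (A + X) (B + Y).
Proof. by rewrite /dg add_block_mx !addr0. Qed.

Lemma dgZ (a : C) A B : a *: dg A B = dg (a *: A) (a *: B).
Proof. by rewrite /dg scale_block_mx !scaler0. Qed.

Lemma dg1 : dg 1%:M 1%:M = 1%:M.
Proof. by rewrite /dg -scalar_mx_block. Qed.

Lemma dg_sum (I : finType) (F G : I -> 'M[C]_d) :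
  \sum_i dg (F i) (G i) = dg (\sum_i F i) (\sum_i G i).
Proof.
elim/big_rec3: _ => [|i A X B _ ->]; last by rewrite dgD.
by rewrite /dg block_mx0.
Qed.

Lemma rtr_dg A B : rtr (dg A B) = rtr A + rtr B.
Proof. by rewrite /rtr /dg mxtrace_block ReD. Qed.

Lemma fmx_dg f A B : adj A = A -> adj B = B -> fmx f (dg A B) = dg (fmx f A) (fmx f B).
Proof.
move=> hA hB.
pose a (i : 'I_(d + d)) : R := match fintype.split i with inl j => eigs A j | inr j => eigs B j end.
have dE g : dmx (g \o a) = dg (dmx (g \o eigs A)) (dmx (g \o eigs B)).
  apply/matrixP => i j; rewrite dmxE /= /a.
  rewrite -(fintype.splitK i) -(fintype.splitK j) !unsplitK (can_eq (@unsplitK d d)).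
  case: (fintype.split i) => i'; case: (fintype.split j) => j' /=.
  - by rewrite block_mxEul dmxE (inj_eq (@inl_inj _ _)).
  - by rewrite block_mxEur mxE.
  - by rewrite block_mxEdl mxE.
  - by rewrite block_mxEdr dmxE (inj_eq (@inr_inj _ _)).
rewrite (@fmx_unique _ _ (dg (eigmx A) (eigmx B)) a).
- by rewrite dE adj_dg !dgM fmx.unlock.
- by rewrite adj_dg dgM !spectral_adjr dg1.
- rewrite -[dmx a]/(dmx (id \o a)) dE adj_dg !dgM.
  by rewrite -[dmx (id \o _)]/(dmx (eigs A)) -[dmx (id \o eigs B)]/(dmx (eigs B)) -!spectral_dec.
Qed.

Lemma Wv_dblW w : Wv dblW w = block_mx 0 (Jmap Q w) (- Jmap Q w) 0.
Proof.
rewrite /Wv /Jmap -sumrN; elim/big_rec3: _ => [|i A X B _ ->].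
  by rewrite -[LHS](@block_mx0 C d d d d).
by rewrite /dblW scale_block_mx add_block_mx !scaler0 !addr0 scalerN.
Qed.

Lemma adj_Jmap w : adj (Jmap Q w) = Jmap Q w.
Proof. by rewrite /Jmap adj_sum; apply: eq_bigr => k _; rewrite adj_scaler adj_Q. Qed.

(** If B is the graded image A' and |w| = 1, the upper block J(w) A' J(w) is the reflection
    automorphism: it sends J(w) to -J(w) and fixes J(v) for v orthogonal to w. *)
Lemma cjW_dg w A B : cjW dblW w (dg A B) =
  dg (Jmap Q w *m B *m Jmap Q w) (Jmap Q w *m A *m Jmap Q w).
Proof.
rewrite /cjW Wv_dblW adj_block !adj0 adjN adj_Jmap /dg !mulmx_block.
by rewrite !(mul0mx, mulmx0, addr0, add0r, mulmxN, mulNmx, opprK, oppr0).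
Qed.

Definition dblF (x : multi_index -> C) al : 'M[C]_(d + d) :=
  x al *: dg (Qpow Q al) (Qpow Q' al).

Lemma graded_dblF x : x [ffun=> false] = 1 -> graded dblW (dblF x).
Proof.
move=> x0; split=> [i al|]; last by rewrite /dblF x0 scale1r !Qpow0 dg1.
rewrite /dblF -scalemxAr -scalemxAl scalerA mulrC -scalerA; congr (_ *: _).
have e : Jmap Q (delta_mx 0 i) = Q i.
  rewrite /Jmap (bigD1 i) //= big1 => [|j ji]; rewrite mxE ?eqxx /=.
    by rewrite addr0 rmorph1 scale1r.
  by rewrite (negPf ji) rmorph0 scale0r.
rewrite -(Wv_delta dblW i) -/(cjW _ _ _) cjW_dg e.
have s : (\sum_(k <- index_enum 'I_n) ((k == i) && al k))%N = al i :> nat.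
  by rewrite (bigD1 i) //= eqxx big1 ?addn0 // => k /negPf ->.
rewrite dgZ !QpowE (monomial_reflect i _ al cliff_relQ) s rmorphXn rmorphN1.
congr dg; have := monomial_reflect i (index_enum 'I_n) al (cliff_relN cliff_relQ).
rewrite s mulmxN mulNmx mulNmx opprK => <-.
by under [in RHS]eq_fun do rewrite opprK.
Qed.

End Doubling.

(** * The matrix exponential and the operator norm *)

Section Exponential.
Context {R : realType} {d : nat}.
Local Notation C := R[i].
Implicit Types (A H : 'M[C]_d) (f : R -> R) (v : 'cV[C]_d).

Lemma fmxX A k : adj A = A -> A ^+ k = fmx (fun x => x ^+ k) A.
Proof.
move=> hA; elim: k => [|k IH]; first by rewrite expr0 (_ : (fun=> _) = fun=> 1) ?fmx_cst.
rewrite exprS IH -{1}(fmx_id hA) -[_ * _]/(_ *m _) fmxM.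
by apply: eq_fmx_eigs => i; rewrite exprS.
Qed.

Definition eig_coef A (i j l : 'I_d) : C := conjC (eigmx A l i) * eigmx A l j.

Lemma fmxE f A i j : fmx f A i j = \sum_l (f (eigs A l))%:C * eig_coef A i j l.
Proof.
rewrite fmx.unlock mxE; apply: eq_bigr => l _.
by rewrite mul_mx_dmx adjE mulrAC mulrC /eig_coef.
Qed.

Lemma trace_fmx f A : \tr (fmx f A) = (\sum_i f (eigs A i))%:C.
Proof.
rewrite fmx.unlock mxtrace_mulC mulmxA spectral_adjr mul1mx rmorph_sum.
by apply: eq_bigr => i _; rewrite dmxE eqxx.
Qed.

Lemma expmxE A : adj A = A -> expmx A = fmx expR A.
Proof.
(* Each real or imaginary part of an entry is a finite real combination of scalar exponential series
   at the eigenvalues. *)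
move=> hA; have key (z : 'I_d -> R) :
    limn (series (fun k => \sum_l k`!%:R^-1 * eigs A l ^+ k * z l)) =
    \sum_l expR (eigs A l) * z l.
  apply/cvg_lim => //.
  have -> : series (fun k => \sum_l k`!%:R^-1 * eigs A l ^+ k * z l) =
      (fun m => \sum_l series (exp_coeff (eigs A l)) m * z l).
    apply/funext => m; rewrite /series /= exchange_big /=; apply: eq_bigr => l _.
    by rewrite mulr_suml; apply: eq_bigr => k _; rewrite /exp_coeff /= [_^-1 * _]mulrC.
  apply: cvg_big => [|l _]; first exact: add_continuous.
  apply: cvgMl; exact: is_cvg_series_exp_coeff.
apply/matrixP => i j; rewrite mxE.
have e k : (k`!%:R^-1 *: A ^+ k) i j =
    \sum_l (k`!%:R^-1 * eigs A l ^+ k)%:C * eig_coef A i j l.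
  rewrite fmxX // mxE fmxE mulr_sumr; apply: eq_bigr => l _.
  by rewrite mulrA rmorphM fmorphV rmorph_nat.
have eta (z : C) : complex.Re z +i* complex.Im z = z by case: z.
rewrite -[RHS]eta fmxE Re_sum Im_sum; congr Complex.
  rewrite -[RHS](eq_bigr _ (fun l _ => esym (ReZ _ _))) -key.
  congr (limn (series _)); apply/funext => k; rewrite e Re_sum.
  by apply: eq_bigr => l _; rewrite ReZ.
rewrite -[RHS](eq_bigr _ (fun l _ => esym (ImZ _ _))) -key.
congr (limn (series _)); apply/funext => k; rewrite e Im_sum.
by apply: eq_bigr => l _; rewrite ImZ.
Qed.

Lemma l2normE v : l2norm v = Num.sqrt (qf 1%:M (adj v)).
Proof.
rewrite /l2norm qf1E; congr Num.sqrt; apply: eq_bigr => i _.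
rewrite adjE /nsq; case: (v i 0) => a b /=.
by rewrite sqr_sqrtr ?addr_ge0 ?sqr_ge0 // sqrrN.
Qed.

(** A Frobenius-type bound; it shows that the set whose supremum is [opnorm] is bounded above. *)
Lemma l2norm_fmx_le f A v :
  l2norm (fmx f A *m v) <= Num.sqrt (\sum_i f (eigs A i) ^+ 2) * l2norm v.
Proof.
rewrite !l2normE -sqrtrM; last by apply: sumr_ge0 => i _; apply: sqr_ge0.
apply: ler_wsqrtr.
have -> : qf 1%:M (adj (fmx f A *m v)) = qf (fmx (fun x => f x ^+ 2) A) (adj v).
  rewrite /qf !adjK mulmx1 adjM adj_fmx mulmxA -(mulmxA (adj v)) fmxM.
  by congr rtr; congr (_ *m _ *m _); apply: eq_fmx_eigs => i; rewrite expr2.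
rewrite qf_fmx -(@qf1_unitary _ _ (adj (eigmx A))) ?adjK ?spectral_adjl //.
rewrite qf1E mulr_sumr; apply: ler_sum => i _; apply: ler_wpM2r; first exact: nsq_ge0.
by rewrite (bigD1 i) //= lerDl sumr_ge0 // => j _; apply: sqr_ge0.
Qed.

Lemma opnorm_set_nonempty A : [set l2norm (A *m v) | v in [set v | l2norm v <= 1]] !=set0.
Proof.
exists (l2norm (A *m 0)); exists 0 => //=; rewrite l2normE qf1E big1 ?sqrtr0 // => i _.
by rewrite adjE mxE rmorph0 /nsq /= expr0n addr0.
Qed.

(** Test the supremum on the unit eigenvector given by the adjoint of the i-th row of [eigmx A]. *)
Lemma opnorm_fmx_ge f A i : 0 <= f (eigs A i) -> f (eigs A i) <= opnorm (fmx f A).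
Proof.
move=> f0; pose v : 'cV[C]_d := adj (row i (eigmx A)).
have v1 : qf 1%:M (adj v) = 1.
  by rewrite adjK qf_row mulmx1 spectral_adjr mxE eqxx.
have vE : fmx f A *m v = (f (eigs A i))%:C *: v.
  rewrite -[LHS]adjK adjM adj_fmx adjK -[RHS]adjK adj_scaler adjK; congr adj.
  rewrite fmx.unlock !mulmxA -row_mul spectral_adjr row1.
  apply/rowP => j; rewrite -mulmxA -rowE mxE mul_dmx.
  by rewrite !mxE.
apply: ub_le_sup; last first.
  exists v => /=; first by rewrite l2normE v1 sqrtr1.
  rewrite vE l2normE adj_scaler.
  have -> : qf 1%:M ((f (eigs A i))%:C *: adj v) = f (eigs A i) ^+ 2.
    by rewrite /qf adj_scaler -!scalemxAl -scalemxAr !rtrZ -/(qf _ _) v1 mulr1 expr2.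
  by rewrite sqrtr_sqr ger0_norm.
exists (Num.sqrt (\sum_i f (eigs A i) ^+ 2)) => _ [w /= w1 <-].
apply: le_trans (l2norm_fmx_le f A w) _.
by rewrite -[leRHS]mulr1; apply: ler_wpM2l => //; apply: sqrtr_ge0.
Qed.

Lemma opnorm1_le : opnorm (1%:M : 'M[C]_d) <= 1.
Proof.
apply: ge_sup; first exact: opnorm_set_nonempty.
by move=> _ [w /= w1 <-]; rewrite mul1mx.
Qed.

Lemma fmx0_eigs f A : fmx f A = 0 -> forall i, f (eigs A i) = 0.
Proof.
move=> f0 i; have : qf (fmx f A) (row i (eigmx A)) = 0.
  by rewrite f0 /qf mulmx0 mul0mx rtr0.
rewrite qf_row fmx.unlock !mulmxA spectral_adjr mul1mx -mulmxA spectral_adjr mulmx1.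
by rewrite dmxE eqxx.
Qed.

End Exponential.

(** * Orthonormal bases and projections in real Euclidean space *)

Section RealOrthonormal.
Context {R : realType} {n : nat}.
Implicit Types (x y v w : 'rV[R]_n).

Lemma dotvE x y : dotv x y = (x *m y^T) 0 0.
Proof. by rewrite mxE; apply: eq_bigr => k _; rewrite mxE. Qed.

Lemma dotv_ge0 x : 0 <= dotv x x.
Proof. by apply: sumr_ge0 => k _; rewrite -expr2 sqr_ge0. Qed.

Lemma dotv_eq0 x : dotv x x = 0 -> x = 0.
Proof.
move=> /eqP; rewrite psumr_eq0 => [/allP h|k _]; last by rewrite -expr2 sqr_ge0.
apply/rowP => k; rewrite mxE; have := h k (mem_index_enum k).
by rewrite mulf_eq0 orbb => /eqP.
Qed.

Lemma dotv_rows m k (u : 'M[R]_(m, n)) (w : 'M[R]_(k, n)) i j :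
  dotv (row i w) (row j u) = (w *m u^T) i j.
Proof. by rewrite mxE; apply: eq_bigr => l _; rewrite !mxE. Qed.

Lemma mulmx_tr_eq0 m (A : 'M[R]_(m, n)) : A *m A^T = 0 -> A = 0.
Proof.
move=> h; apply/row_matrixP => i; rewrite row0; apply: dotv_eq0.
by rewrite dotv_rows h mxE.
Qed.

(** Gram-Schmidt by induction on the rank: normalize a nonzero row to e and continue in the part of
    V orthogonal to e. *)
Lemma exists_orthonormal m (V : 'M[R]_(m, n)) :
  exists k (u : 'M[R]_(k, n)), u *m u^T = 1%:M /\ (u == V)%MS.
Proof.
have [r] := ubnP (\rank V); elim: r m V => // r IH m V; rewrite ltnS => rV.
have [->|V0] := eqVneq V 0.
  exists 0%N, 0; split; first by apply/matrixP => -[].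
  by rewrite /eqmx !sub0mx.
pose v := nz_row V; have v0 : v != 0 by rewrite nz_row_eq0.
have vv : 0 < dotv v v.
  by rewrite lt_neqAle dotv_ge0 andbT eq_sym; apply: contraNneq v0 => /dotv_eq0 ->.
pose e := (Num.sqrt (dotv v v))^-1 *: v.
have eV : (e <= V)%MS by rewrite scalemx_sub // nz_row_sub.
have ee : e *m e^T = 1%:M.
  apply/matrixP => i j; rewrite !ord1 -dotvE mxE eqxx.
  rewrite /dotv; under eq_bigr do rewrite !mxE mulrACA.
  rewrite -mulr_sumr -/(dotv v v) -expr2 exprVn sqr_sqrtr ?dotv_ge0 // mulVf // gt_eqF //.
pose V' := (V :&: kermx e^T)%MS.
have rV' : (\rank V' < r)%N.
  apply: leq_trans rV; apply: rank_ltmx; rewrite ltmxE capmxSl /=.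
  apply/negP => /(submx_trans eV); rewrite sub_capmx => /andP[_ /sub_kermxP].
  by rewrite ee => /matrixP/(_ 0 0); rewrite !mxE eqxx => /eqP; rewrite oner_eq0.
have [k [u [uu uV']]] := IH _ V' rV'; have /andP[uV1 uV2] := uV'.
have [uV ue] : (u <= V)%MS /\ u *m e^T = 0.
  by move: uV1; rewrite sub_capmx => /andP[-> /sub_kermxP].
exists (1 + k)%N, (col_mx e u); split.
  rewrite tr_col_mx mul_col_row ee uu ue.
  have -> : e *m u^T = 0 by rewrite -[LHS]trmxK trmx_mul trmxK ue trmx0.
  by rewrite -scalar_mx_block.
apply/andP; split; first by rewrite col_mx_sub eV uV.
have -> : V = (V *m e^T) *m e + (V - (V *m e^T) *m e) by rewrite addrC subrK.
have ecu : (e <= col_mx e u)%MS.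
  by apply/submxP; exists (row_mx 1%:M 0); rewrite mul_row_col mul1mx mul0mx addr0.
have ucu : (u <= col_mx e u)%MS.
  by apply/submxP; exists (row_mx 0 1%:M); rewrite mul_row_col mul1mx mul0mx add0r.
apply: addmx_sub; first exact: submx_trans (submxMl _ _) ecu.
apply: submx_trans ucu; apply: submx_trans uV2; rewrite sub_capmx; apply/andP; split.
  rewrite addmx_sub // -mulNmx; exact: submx_trans (submxMl _ _) eV.
by apply/sub_kermxP; rewrite mulmxBl -!mulmxA ee mulmx1 subrr.
Qed.

(** The rows of 1 - u^T u - w^T w are orthogonal to u, hence in the span of w; being orthogonal to w
    too, they vanish. *)
Lemma orthonormal_complement m (u : 'M[R]_(m, n)) : u *m u^T = 1%:M ->
  exists k (w : 'M[R]_(k, n)), [/\ w *m w^T = 1%:M, w *m u^T = 0 &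
    u^T *m u + w^T *m w = 1%:M].
Proof.
move=> uu; have [k [w [ww /andP[wk kw]]]] := exists_orthonormal (kermx u^T).
have wu : w *m u^T = 0 by apply/sub_kermxP.
have uw : u *m w^T = 0 by rewrite -[LHS]trmxK trmx_mul trmxK wu trmx0.
exists k, w; split=> //; apply/eqP; rewrite eq_sym -subr_eq0; apply/eqP.
set Y := 1%:M - _.
have Yu : Y *m u^T = 0.
  by rewrite /Y mulmxBl mul1mx mulmxDl -!mulmxA uu wu mulmx1 mulmx0 addr0 subrr.
have Yw : Y *m w^T = 0.
  by rewrite /Y mulmxBl mul1mx mulmxDl -!mulmxA ww uw mulmx1 mulmx0 add0r subrr.
have /submxP[Z YE] : (Y <= w)%MS by apply: submx_trans kw; apply/sub_kermxP.
by rewrite YE; move: Yw; rewrite YE -mulmxA ww mulmx1 => ->; rewrite mul0mx.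
Qed.

(** The two projections of a vector both lie in V and leave residuals orthogonal to V, so their
    difference is orthogonal to itself. *)
Lemma orthproj_onb m (u : 'M[R]_(m, n)) (V : 'M[R]_n) :
  orthonormal_basis u V -> orthproj V = u^T *m u.
Proof.
move=> [uu /andP[uV Vu]]; apply/row_matrixP => i; rewrite !rowE.
set x := delta_mx 0 i; apply/eqP; rewrite -subr_eq0; apply/eqP; set z := _ - _.
have zV : (z <= V)%MS.
  rewrite addmx_sub ?orthproj_sub // eqmx_opp mulmxA.
  exact: submx_trans (submxMl _ _) uV.
have /submxP[Z VE] := Vu.
have h2 : (x - x *m (u^T *m u)) *m V^T = 0.
  have h3 : (x - x *m (u^T *m u)) *m u^T = 0 by rewrite mulmxBl -!mulmxA uu mulmx1 subrr.
  by rewrite VE trmx_mul [LHS]mulmxA h3 mul0mx.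
have zVt : z *m V^T = 0.
  have -> : z = (x - x *m (u^T *m u)) - (x - x *m orthproj V).
    by rewrite /z opprB [RHS]addrC addrA subrK.
  by rewrite mulmxBl h2 orthproj_perp subrr.
apply: mulmx_tr_eq0; have /submxP[c zE] := zV.
by rewrite {2}zE trmx_mul mulmxA zVt mul0mx.
Qed.

Lemma sum_dotv_rows m (u : 'M[R]_(m, n)) x :
  \sum_(v <- [seq row k u | k <- enum 'I_m]) dotv v x ^+ 2 = (x *m (u^T *m u) *m x^T) 0 0.
Proof.
rewrite big_map big_enum /=.
have -> : x *m (u^T *m u) *m x^T = (x *m u^T) *m (x *m u^T)^T.
  by rewrite trmx_mul trmxK !mulmxA.
rewrite mxE; apply: eq_bigr => k _; rewrite expr2.
have e : dotv (row k u) x = (x *m u^T) 0 k.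
  by rewrite dotvC dotvE !mxE; apply: eq_bigr => l _; rewrite !mxE.
by rewrite e [_^T k _]mxE.
Qed.

Lemma onseq_rows m (w : 'M[R]_(m, n)) (r : seq 'I_m) : w *m w^T = 1%:M -> uniq r ->
  onseq [seq row k w | k <- r].
Proof.
move=> ww; elim: r => //= k r IH /andP[kr ur]; split; last exact: IH.
  by rewrite dotv_rows ww mxE eqxx.
move=> v /mapP[l lr ->]; rewrite dotv_rows ww mxE.
by case: eqVneq kr lr => [-> /negPf->|].
Qed.

End RealOrthonormal.

(** * Invariance of a Clifford subalgebra under orthogonal reflections *)

Section GeneratedAlgebra.
Context {R : realType} {n : nat}.
Local Notation C := R[i].
Local Notation d := (2 ^ n)%N.
Context (Q : 'I_n -> 'M[C]_(2 ^ n)) (cQ : clifford_generators Q).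
Implicit Types (A B H : 'M[C]_(2 ^ n)) (u v w : 'rV[R]_n).

(** Makes the identities for [Wv] available for [Jmap]. *)
Lemma anticliff_iQ : anticliff (fun k => 'i%C *: Q k).
Proof.
split=> [k|k l].
  rewrite adj_scale (adj_Q cQ) -scaleNr; congr (_ *: _).
  by apply/eqP; rewrite eq_complex /= oppr0 !eqxx.
rewrite -!scalemxAl -!scalemxAr !scalerA -scalerDr (cliff_anticomm cQ).
rewrite -expr2 sqr_i scaleN1r; apply/esym.
by rewrite -raddfN /= mulNr rmorphN rmorphM !rmorph_nat.
Qed.

Lemma Wv_iQ w : Wv (fun k => 'i%C *: Q k) w = 'i%C *: Jmap Q w.
Proof.
rewrite /Wv /Jmap scaler_sumr; apply: eq_bigr => k _.
by rewrite !scalerA mulrC.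
Qed.

Lemma iscale_mul A B : ('i%C *: A) *m ('i%C *: B) = - (A *m B).
Proof. by rewrite -scalemxAl -scalemxAr scalerA -expr2 sqr_i scaleN1r. Qed.

Lemma Jmap_mul u v : Jmap Q u *m Jmap Q v + Jmap Q v *m Jmap Q u = (2 * dotv u v)%:C%:M.
Proof.
have := Wv_anticomm anticliff_iQ u v; rewrite !Wv_iQ !iscale_mul -opprD mulNr.
by rewrite rmorphN raddfN => /oppr_inj.
Qed.

Lemma Jmap_sqr u : Jmap Q u *m Jmap Q u = (dotv u u)%:C%:M.
Proof.
rewrite -[LHS]half_add Jmap_mul scale_scalar_mx -rmorphM.
by congr (_%:C%:M); field.
Qed.

Lemma Jmap_orth u v : dotv u v = 0 -> Jmap Q u *m Jmap Q v = - (Jmap Q v *m Jmap Q u).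
Proof.
by move=> uv; apply/eqP; rewrite -addr_eq0 Jmap_mul uv mulr0 !rmorph0.
Qed.

Lemma gp_Jmap u : graded_pair Q (Jmap Q u) (- Jmap Q u).
Proof.
rewrite /Jmap -sumrN; apply: gp_sum => k; rewrite -scalerN.
by apply: gpZ; apply: gpQ.
Qed.

(** The elements that have a graded partner with this property form a subalgebra containing the
    generators: the signs from grading and from anticommutation cancel on each
    [Jmap Q (row i u)]. *)
Lemma gen_algebra_reflect m (u : 'M[R]_(m, n)) H :
  gen_algebra [set Jmap Q (row i u) | i in [set: 'I_m]] H ->
  exists2 H', graded_pair Q H H' & forall w, dotv w w = 1 ->
    (forall i, dotv w (row i u) = 0) ->
    Jmap Q w *m H' *m Jmap Q w = H /\ Jmap Q w *m H *m Jmap Q w = H'.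
Proof.
pose P w := dotv w w = 1 /\ forall i, dotv w (row i u) = 0.
pose S : set 'M[C]_(2 ^ n) := [set A | exists2 A', graded_pair Q A A' & forall w, P w ->
    Jmap Q w *m A' *m Jmap Q w = A /\ Jmap Q w *m A *m Jmap Q w = A'].
have JJ w : P w -> Jmap Q w *m Jmap Q w = 1%:M by move=> [w1 _]; rewrite Jmap_sqr w1 rmorph1.
move=> /(_ S) h; have [] // := h _; last by move=> H' g k; exists H' => // w w1 w2; apply: k.
split; last first.
  move=> _ [i _ <-]; exists (- Jmap Q (row i u)); first exact: gp_Jmap.
  move=> w Pw; have [_ wu] := Pw.
  have e : Jmap Q w *m Jmap Q (row i u) *m Jmap Q w = - Jmap Q (row i u).
    by rewrite Jmap_orth // mulNmx -mulmxA JJ // mulmx1.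
  by rewrite mulmxN mulNmx e opprK.
split.
- by exists 1%:M; [exact: gp1 | move=> w Pw; rewrite mulmx1 JJ].
- move=> a A B [A' gA hA] [B' gB hB]; exists (a *: A' + B'); first exact: gp_lin.
  move=> w Pw; have [a1 a2] := hA w Pw; have [b1 b2] := hB w Pw.
  by rewrite !mulmxDr !mulmxDl -!scalemxAr -!scalemxAl a1 a2 b1 b2.
- move=> A B [A' gA hA] [B' gB hB]; exists (A' *m B'); first exact: gpM.
  move=> w Pw; have [a1 a2] := hA w Pw; have [b1 b2] := hB w Pw.
  by rewrite !(conj_sqM _ _ (JJ w Pw)) a1 a2 b1 b2.
Qed.

End GeneratedAlgebra.

(** * The projection condition implies the trace inequality *)

Section Sufficiency.
Context {R : realType} {n : nat}.
Local Notation C := R[i].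
Local Notation d := (2 ^ n)%N.
Context (Q : 'I_n -> 'M[C]_(2 ^ n)) (cQ : clifford_generators Q).
Implicit Types (A B H : 'M[C]_(2 ^ n)) (V : 'M[R]_n).

Lemma Re_tau A : complex.Re (tau A) = rtr A / d%:R.
Proof.
rewrite /tau; have -> : (d%:R^-1 : C) = (d%:R^-1)%:C by rewrite fmorphV rmorph_nat.
by rewrite ReZ mulrC.
Qed.

Lemma dim_gt0 : (0 < 2 ^ n)%N.
Proof. by rewrite expn_gt0. Qed.

Lemma Re_tau_exp A : adj A = A -> complex.Re (tau (expmx A)) = partition_fun A.
Proof. by move=> hA; rewrite Re_tau expmxE. Qed.

Lemma gp_rtr A B : graded_pair Q A B -> rtr A = rtr B.
Proof. by move=> /(gp_trace cQ); rewrite /rtr => ->. Qed.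

Lemma partition_fun_dg A B : adj A = A -> adj B = B -> graded_pair Q A B ->
  partition_fun (dg A B) = partition_fun A.
Proof.
move=> hA hB g; rewrite /partition_fun fmx_dg // rtr_dg.
rewrite -(gp_rtr (gp_fmx cQ expR hA hB g)) natrD.
have alg (a x : R) : x != 0 -> (a + a) / (x + x) = a / x.
  move=> x0; rewrite -mulr2n -(mulr2n x) -[a *+ 2]mulr_natl -[x *+ 2]mulr_natl.
  by rewrite -mulf_div divff ?mul1r // pnatr_eq0.
by apply: alg; rewrite pnatr_eq0 -lt0n dim_gt0.
Qed.

(** The spectrum lies below l iff max(x - l, 0) of the matrix vanishes, and this vanishing passes to
    the graded partner by [gp_fmx] and [gp_inj]. *)
Lemma eigs_dg_le A B (l : R) : adj A = A -> adj B = B -> graded_pair Q A B ->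
  (forall i, eigs A i <= l) -> forall i, eigs (dg A B) i <= l.
Proof.
move=> hA hB g hl i; pose f (x : R) := Num.max (x - l) 0.
have fA : fmx f A = 0.
  rewrite -(scale0r 1%:M) scalemx1 -[0 in RHS](rmorph0 (real_complex R)) -(fmx_cst 0 A).
  by apply: eq_fmx_eigs => j; apply/max_idPr; rewrite subr_le0.
have fB : fmx f B = 0.
  by have := gp_fmx cQ f hA hB g; rewrite fA; apply: gp_inj.
have := @fmx0_eigs _ _ f (dg A B); rewrite fmx_dg // fA fB /dg block_mx0.
by move=> /(_ erefl i); rewrite /f => /max_idPr; rewrite subr_le0.
Qed.

(* us and ss are orthonormal bases of V and of its orthogonal complement. *)
Lemma cliff_sub_datum V H : cliff_sub Q V H -> adj H = H ->
  exists (us ss : seq 'rV[R]_n) H',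
  [/\ forall v, v \in us -> dotv v v = 1,
      forall v w, v \in us -> w \in ss -> dotv w v = 0,
      onseq ss,
      forall x, \sum_(v <- us) dotv v x ^+ 2 + \sum_(v <- ss) dotv v x ^+ 2 = dotv x x
    & forall x, \sum_(v <- us) dotv v x ^+ 2 = (x *m orthproj V *m x^T) 0 0] /\
  [/\ graded_pair Q H H', adj H' = H'
    & forall w, w \in ss -> cjW (dblW Q) w (dg H H') = dg H H'].
Proof.
move=> [m [u [onu gH]]] hH; have [uu uV] := onu.
have [k [w [ww wu uw1]]] := orthonormal_complement uu.
have [H' g hH'] := gen_algebra_reflect cQ gH.
exists [seq row i u | i <- enum 'I_m], [seq row i w | i <- enum 'I_k], H'; split; split.
- by move=> _ /mapP[i _ ->]; rewrite dotv_rows uu mxE eqxx.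
- by move=> _ _ /mapP[i _ ->] /mapP[j _ ->]; rewrite dotv_rows wu mxE.
- exact: onseq_rows ww (enum_uniq _).
- move=> x; rewrite !sum_dotv_rows.
  have -> : dotv x x = (x *m (u^T *m u + w^T *m w) *m x^T) 0 0.
    by rewrite uw1 mulmx1 dotvE.
  by rewrite mulmxDr mulmxDl [RHS]mxE.
- by move=> x; rewrite sum_dotv_rows (orthproj_onb onu).
- by [].
(* Both H' and its adjoint are graded partners of H, hence equal. *)
- have g' := gp_adj cQ g; rewrite hH in g'.
  have h := gp_lin (-1) g g'; rewrite !scaleN1r addNr in h.
  by have /eqP := gp_inj cQ h; rewrite addrC subr_eq0 => /eqP.
- move=> _ /mapP[i _ ->]; rewrite (cjW_dg cQ).
  have [|l|-> ->] // := hH' (row i w); first by rewrite dotv_rows ww mxE eqxx.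
  by rewrite dotv_rows wu mxE.
Qed.

Lemma exp_norm_gt0 (p : \bar R) H : (1 <= p)%E -> adj H = H -> 0 < exp_norm p H.
Proof.
case: p => [r| |] // r1 hH; rewrite /exp_norm.
  rewrite Re_tau_exp ?adj_scaler ?hH //.
  by apply: powR_gt0; apply: partition_fun_gt0 dim_gt0.
rewrite expmxE //; have := @opnorm_fmx_ge _ _ expR H (Ordinal dim_gt0) (expR_ge0 _).
by apply: lt_le_trans; rewrite expR_gt0.
Qed.

(** For finite p, apply [gibbs_variational] to p H and divide by p. For p = oo, the eigenvalues of
    H, hence of its double, are at most the logarithm of the norm of e^H. *)
Lemma exp_norm_variational (p : \bar R) H H' dl (B : 'M[C]_(d + d)) :
  (1 <= p)%E -> adj H = H -> adj H' = H' -> graded_pair Q H H' ->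
  0 < dl -> hlb dl B -> rtr B = (d + d)%:R ->
  rtr (B *m dg H H') <= fine (p^-1)%E * entropy B + (d + d)%:R * ln (exp_norm p H).
Proof.
move=> p1 hH hH' g d0 lB tB; have D0 : (0 < d + d)%N by rewrite addn_gt0 dim_gt0.
have hHH : adj (dg H H') = dg H H' by rewrite adj_dg hH hH'.
case: p p1 => [r| |] //= p1.
  have r0 : 0 < r by rewrite lee_fin in p1; exact: lt_le_trans ltr01 p1.
  rewrite inver gt_eqF //=.
  have hr : adj (r%:C *: H) = r%:C *: H by rewrite adj_scaler hH.
  have hr' : adj (r%:C *: H') = r%:C *: H' by rewrite adj_scaler hH'.
  have hrr : adj (r%:C *: dg H H') = r%:C *: dg H H' by rewrite adj_scaler hHH.
  rewrite Re_tau_exp // -(partition_fun_dg hr hr' (gpZ _ g)) -dgZ ln_powR.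
  have := gibbs_variational D0 d0 lB hrr tB.
  rewrite -scalemxAr rtrZ => h.
  rewrite -(ler_pM2l r0); apply: le_trans h _.
  have alg (e D l : R) : e + D * l <= r * (r^-1 * e + D * (r^-1 * l)).
    by rewrite le_eqVlt; apply/orP; left; apply/eqP; field; rewrite gt_eqF.
  exact: alg.
rewrite mul0r add0r -tB; apply: (rtr_mul_le d0 lB hHH).
apply: (eigs_dg_le hH hH' g) => i; rewrite -ler_expR lnK.
  by rewrite expmxE //; apply: opnorm_fmx_ge; apply: expR_ge0.
by rewrite posrE (@exp_norm_gt0 +oo%E).
Qed.

Lemma brascamp_sufficient (N : nat) (V : 'I_N -> 'M[R]_n) (p : 'I_N -> \bar R)
    (H : 'I_N -> 'M[C]_(2 ^ n)) :
  (forall j, (1 <= p j)%E) ->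
  qform_le (\sum_j fine (p j)^-1%E *: orthproj (V j)) 1%:M ->
  (forall j, cliff_sub Q (V j) (H j)) -> (forall j, adj (H j) = H j) ->
  complex.Re (tau (expmx (\sum_j H j))) <= \prod_j exp_norm (p j) (H j).
Proof.
move=> p1 qf HV hH.
have /choice[us /choice[ss /choice[H' hd]]] : forall j, exists us ss H', _ :=
  fun j => cliff_sub_datum (HV j) (hH j).
have D0 : (0 < d + d)%N by rewrite addn_gt0 dim_gt0.
have g j : graded_pair Q (H j) (H' j) by have [_ []] := hd j.
have hH' j : adj (H' j) = H' j by have [_ []] := hd j.
pose c j : R := fine (p j)^-1%E.
have c0 j : 0 <= c j by rewrite fine_ge0 // inve_ge0 (le_trans _ (p1 j)) // lee01.
have bd : brascamp_datum c us ss.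
  split=> // [j|j|j|j|x]; try by have [[]] := hd j.
  apply: (@le_trans _ _ ((x *m (\sum_j fine (p j)^-1%E *: orthproj (V j)) *m x^T) 0 0)).
    2: by have := qf x; rewrite mulmx1 (dotvE x x).
  rewrite mulmx_sumr mulmx_suml summxE; apply: ler_sum => j _.
  rewrite -scalemxAr -scalemxAl mxE; have [[_ _ _ _ ->] _] := hd j.
  by [].
set K := \sum_j H j; pose K' := \sum_j H' j.
have hK : adj K = K by rewrite /K adj_sum; apply: eq_bigr.
have hK' : adj K' = K' by rewrite /K' adj_sum; apply: eq_bigr.
have gK : graded_pair Q K K' by apply: gp_sum.
have KE : \sum_j dg (H j) (H' j) = dg K K' by rewrite dg_sum.
pose f (x : R) := expR x / partition_fun (dg K K').
have [x [fK fK']] := gp_fmx cQ f hK hK' gK.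
have FE : \sum_al dblF Q x al = gibbs_state (\sum_j dg (H j) (H' j)).
  rewrite KE /gibbs_state fmx_dg // -/f fK fK' -dg_sum.
  by apply: eq_bigr => al _; rewrite /dblF dgZ.
(* This coefficient is tau of f(K). The two blocks have equal traces adding up to 2 * 2^n, so it
   equals 1. *)
have x0 : x [ffun=> false] = 1.
  have := rtr_gibbs (dg K K') D0; rewrite /gibbs_state fmx_dg // -/f rtr_dg.
  rewrite -(gp_rtr (gp_fmx cQ f hK hK' gK)) natrD => t.
  have {}t : rtr (fmx f K) = d%:R by lra.
  rewrite -(cliff_tau cQ) -fK /tau trace_fmx -rtr_fmx t rmorph_nat mulVf //.
have := @ln_partition_le R (d + d) n N _ (anticliff_dblW cQ) c us ss bd
  (fun j => dg (H j) (H' j)) (fun j => ln (exp_norm (p j) (H j))) _ D0.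
move=> /(_ (dblF Q x)) h.
have {h}h : ln (partition_fun (\sum_j dg (H j) (H' j))) <= \sum_j ln (exp_norm (p j) (H j)).
  apply: h => //.
  - by move=> j; rewrite adj_dg hH hH'.
  - by move=> j w; have [_ [_ _]] := hd j; apply.
  - exact: graded_dblF.
  - move=> j dl B d0 lB tB; exact: (exp_norm_variational (p1 j) (hH j) (hH' j) (g j) d0 lB tB).
rewrite KE partition_fun_dg // in h.
rewrite Re_tau_exp // -[leLHS]lnK ?posrE ?partition_fun_gt0 ?dim_gt0 //.
apply: le_trans (_ : expR (\sum_j ln (exp_norm (p j) (H j))) <= _); first by rewrite ler_expR.
rewrite expR_sum le_eqVlt; apply/orP; left; apply/eqP; apply: eq_bigr => j _.
by rewrite lnK // posrE exp_norm_gt0.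
Qed.

End Sufficiency.

(** * Second-order comparison of hyperbolic cosines and exponentials *)

Section SmallTimeBound.
Context {R : realType}.
Implicit Types (s a b M : R).

(** The hyperbolic cosine, which is the normalized trace of e^J(v) at s = |v|. *)
Definition hcos s : R := (expR s + expR (- s)) / 2.

(** Uses cosh s - 1 = (e^s - 1)^2 e^(-s) / 2 with e^s - 1 >= s; the upper bound [hcos_le] uses the
    form (1 - e^(-s))^2 e^s / 2 in the same way. *)
Lemma hcos_ge s : 0 <= s -> 1 + s ^+ 2 / 2 * expR (- s) <= hcos s.
Proof.
move=> s0; have e0 := expR_gt0 (- s); have h := expR_ge1Dx s.
have E : expR s * expR (- s) = 1 by rewrite -expRD subrr expR0.
have h2 : s ^+ 2 <= (expR s - 1) ^+ 2 by rewrite ler_sqr ?nnegrE //; lra.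
have := ler_wpM2r (ltW e0) h2; rewrite /hcos.
have -> : (expR s - 1) ^+ 2 * expR (- s) =
    expR s * (expR s * expR (- s)) - 2 * (expR s * expR (- s)) + expR (- s) by ring.
rewrite E; lra.
Qed.

Lemma hcos_le s : 0 <= s -> hcos s <= expR (s ^+ 2 / 2 * expR s).
Proof.
move=> s0; apply: le_trans (expR_ge1Dx _).
have e0 := expR_gt0 s; have h := expR_ge1Dx (- s).
have E : expR s * expR (- s) = 1 by rewrite -expRD subrr expR0.
have e1 : expR (- s) <= 1 by rewrite expR_le1 oppr_le0.
have h2 : (1 - expR (- s)) ^+ 2 <= s ^+ 2 by rewrite ler_sqr ?nnegrE //; lra.
have := ler_wpM2r (ltW e0) h2; rewrite /hcos.
have -> : (1 - expR (- s)) ^+ 2 * expR s =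
    expR s - 2 * (expR s * expR (- s)) + expR (- s) * (expR s * expR (- s)) by ring.
rewrite E; lra.
Qed.

Lemma hcos_gt0 s : 0 < hcos s.
Proof. by rewrite divr_gt0 // addr_gt0 // expR_gt0. Qed.

(* Compare the second-order terms at t = 0. *)
Lemma hcos_second_order a b M : 0 <= a -> 0 <= b -> 0 <= M ->
  (forall t, 0 < t -> hcos (t * a) <= expR (t ^+ 2 / 2 * (b * expR (t * M)))) ->
  a ^+ 2 <= b.
Proof.
move=> a0 b0 M0 H; pose K := a ^+ 2 * (a + M) + b * (a ^+ 2 / 2).
(* In K, the summand a^2 (a + M) pays for linearizing e^(-t a) and e^(-t M), and b a^2 / 2 for the
   factor 1 + w below. *)
have K0 : 0 <= K.
  by rewrite addr_ge0 // mulr_ge0 ?sqr_ge0 ?addr_ge0 // divr_ge0 ?sqr_ge0.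
have small t : 0 < t -> t <= 1 -> a ^+ 2 <= b + t * K.
  move=> t0 t1; have ta0 : 0 <= t * a by rewrite mulr_ge0 // ltW.
  pose z := t ^+ 2 / 2 * (b * expR (t * M)); pose w := (t * a) ^+ 2 / 2 * expR (- (t * a)).
  have w0 : 0 <= w by rewrite mulr_ge0 ?divr_ge0 ?sqr_ge0 ?expR_ge0.
  have zz : (1 - z) * expR z <= 1.
    have := ler_wpM2r (expR_ge0 z) (expR_ge1Dx (- z)).
    by rewrite -expRD addNr expR0.
  have wz : 1 + w <= expR z := le_trans (hcos_ge ta0) (H t t0).
  (* Eliminates the exponential on the right: 1 + w <= e^z and (1 - z) e^z <= 1. *)
  have h1 : w <= z * (1 + w).
    have [z1|z1] := leP z 1; last first.
      have := ler_wpM2r (_ : 0 <= 1 + w) (ltW z1).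
      by rewrite addr_ge0 // => /(_ isT); lra.
    have := ler_wpM2l (_ : 0 <= 1 - z) wz; rewrite subr_ge0 => /(_ z1); lra.
  have p1 : expR (- (t * a)) <= 1 by rewrite expR_le1 oppr_le0.
  have h2 : w <= t * (a ^+ 2 / 2).
    have q0 : 0 <= (t * a) ^+ 2 / 2 by rewrite divr_ge0 ?sqr_ge0.
    have h3 := ler_wpM2l q0 p1; rewrite mulr1 in h3; apply: le_trans h3 _.
    have := mulr_ge0 (mulr_ge0 (ltW t0) (_ : 0 <= 1 - t)) (sqr_ge0 a).
    rewrite subr_ge0 => /(_ t1); rewrite exprMn; lra.
  have hz : a ^+ 2 * expR (- (t * a)) <= b * expR (t * M) * (1 + w).
    have tt : 0 < t ^+ 2 / 2 by rewrite divr_gt0 // exprn_gt0.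
    rewrite -(ler_pM2l tt); move: h1; rewrite /z {1}/w exprMn; lra.
  have E : expR (t * M) * expR (- (t * M)) = 1 by rewrite -expRD subrr expR0.
  have h4 := ler_wpM2r (expR_ge0 (- (t * M))) hz.
  have h5 : a ^+ 2 * expR (- (t * a)) * expR (- (t * M)) <= b * (1 + w).
    apply: le_trans h4 _.
    have -> : b * expR (t * M) * (1 + w) * expR (- (t * M)) =
      b * (1 + w) * (expR (t * M) * expR (- (t * M))) by ring.
    by rewrite E mulr1.
  have h6 : a ^+ 2 * (1 - t * (a + M)) <= b * (1 + w).
    apply: le_trans h5; rewrite -mulrA -expRD; apply: ler_wpM2l; first exact: sqr_ge0.
    by have := expR_ge1Dx (- (t * a) + - (t * M)); rewrite mulrDr opprD.
  have h7 := ler_wpM2l b0 h2; rewrite /K; lra.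
apply/ler_addgt0Pr => e e0; pose t := Num.min 1 (e / (K + 1)).
have t0 : 0 < t by rewrite lt_min ltr01 divr_gt0 // ltr_wpDl.
have t1 : t <= 1 by rewrite ge_min lexx.
apply: le_trans (small t t0 t1) _; rewrite lerD2l.
apply: le_trans (_ : t * (K + 1) <= _); first by rewrite ler_wpM2l ?(ltW t0) // lerDl.
by rewrite -ler_pdivlMr ?ltr_wpDl // ge_min lexx orbT.
Qed.

End SmallTimeBound.

(** * The trace inequality implies the projection condition *)

Section Necessity.
Context {R : realType} {n : nat}.
Local Notation C := R[i].
Local Notation d := (2 ^ n)%N.
Context (Q : 'I_n -> 'M[C]_(2 ^ n)) (cQ : clifford_generators Q).
Implicit Types (v x : 'rV[R]_n) (V : 'M[R]_n).

Lemma JmapD u v : Jmap Q (u + v) = Jmap Q u + Jmap Q v.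
Proof.
rewrite /Jmap -big_split; apply: eq_bigr => k _ /=.
by rewrite mxE rmorphD scalerDl.
Qed.

Lemma JmapZ (a : R) v : Jmap Q (a *: v) = a%:C *: Jmap Q v.
Proof.
rewrite /Jmap scaler_sumr; apply: eq_bigr => k _.
by rewrite mxE rmorphM scalerA.
Qed.

Lemma Jmap0 : Jmap Q 0 = 0.
Proof. by rewrite -(scale0r (0 : 'rV_n)) JmapZ rmorph0 scale0r. Qed.

Lemma Jmap_sum (I : finType) (F : I -> 'rV[R]_n) :
  Jmap Q (\sum_i F i) = \sum_i Jmap Q (F i).
Proof. exact: (big_morph (Jmap Q) JmapD Jmap0). Qed.

Lemma cliff_sub_Jmap V v : (v <= V)%MS -> cliff_sub Q V (Jmap Q v).
Proof.
move=> vV; have [m [u onu]] := exists_orthonormal V.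
exists m, u; split=> // S [[S1 Sl SM] Sg].
have /submxP[Z ->] : (v <= u)%MS.
  by apply: submx_trans vV _; case: onu => _ /andP[].
have S0 : S 0.
  by have := Sl (-1) _ _ S1 S1; rewrite scaleN1r addNr.
rewrite mulmx_sum_row Jmap_sum; elim/big_ind: _ => //.
  by move=> A B SA SB; rewrite -[A]scale1r; apply: Sl.
move=> i _; rewrite JmapZ -[_ *: _]addr0; apply: Sl => //.
by apply: Sg; exists i.
Qed.

(** The grading preserves the trace and negates J(v). *)
Lemma rtr_Jmap v : rtr (Jmap Q v) = 0.
Proof.
have := gp_trace cQ (gp_Jmap cQ v); rewrite raddfN => h.
have := congr1 (@complex.Re R) h; rewrite ReN /rtr; lra.
Qed.

Lemma Re_tau_exp_Jmap v : complex.Re (tau (expmx (Jmap Q v))) = hcos (Num.sqrt (dotv v v)).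
Proof.
set l := Num.sqrt _; have hJ := adj_Jmap cQ v.
have l2 : l ^+ 2 = dotv v v by rewrite sqr_sqrtr // dotv_ge0.
have ev i : eigs (Jmap Q v) i = l \/ eigs (Jmap Q v) i = - l.
  have z : fmx (fun y => y * y + - (l * l)) (Jmap Q v) = 0.
    rewrite fmxD -fmxM fmx_id // (Jmap_sqr cQ) fmx_cst -raddfD -rmorphD.
    by rewrite -l2 expr2 subrr rmorph0 raddf0.
  have /eqP := fmx0_eigs z i; rewrite subr_eq0 -!expr2 eqf_sqr.
  by case/orP => /eqP; [left | right].
rewrite Re_tau expmxE //.
(* The slope sinh(l) / l of the affine function that agrees with the exponential at l and -l, the
   only possible eigenvalues; l = 0 is treated apart. *)
pose b := (expR l - expR (- l)) / (2 * l).
have -> : fmx expR (Jmap Q v) = fmx (fun y => hcos l + b * y) (Jmap Q v).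
  apply: eq_fmx_eigs => i; rewrite /b /hcos.
  have [l0|l0] := eqVneq l 0.
    have -> : eigs (Jmap Q v) i = 0 by case: (ev i) => ->; rewrite l0 ?oppr0.
    by rewrite l0 oppr0 expR0 mulr0 addr0; field.
  by case: (ev i) => ->; field.
rewrite (fmxD (fun=> hcos l)) (fmxZ b id) fmx_id // fmx_cst rtrD rtrZ rtr_Jmap mulr0 addr0.
rewrite -scalemx1 rtrZ rtr1 mulfK // pnatr_eq0 -lt0n; exact: dim_gt0.
Qed.

(** The factor 1/p cancels the p inside the norm, giving equality for finite p; for p = oo the
    operator is 0, and the right side is a zeroth power, that is 1. *)
Lemma exp_norm_Jmap (p : \bar R) v : (1 <= p)%E ->
  exp_norm p (Jmap Q (fine (p^-1)%E *: v)) <= hcos (Num.sqrt (dotv v v)) `^ fine (p^-1)%E.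
Proof.
case: p => [r| |] //= p1.
  have r0 : 0 < r by rewrite lee_fin in p1; exact: lt_le_trans ltr01 p1.
  rewrite inver gt_eqF //= -JmapZ scalerA mulfV ?gt_eqF // scale1r.
  by rewrite Re_tau_exp_Jmap.
rewrite powRr0 scale0r Jmap0.
have -> : expmx (0 : 'M[C]_d) = 1%:M; last exact: opnorm1_le.
have e0 : (0 : 'M[C]_d) = fmx (fun=> 0) 0 by rewrite fmx_cst !rmorph0.
rewrite expmxE ?adj0 // e0 fmx_comp.
have -> : expR \o (fun=> 0) = (fun=> 1) :> (R -> R) by apply/funext => y /=; rewrite expR0.
by rewrite fmx_cst.
Qed.

Lemma brascamp_necessary (N : nat) (V : 'I_N -> 'M[R]_n) (p : 'I_N -> \bar R) :
  (forall j, (1 <= p j)%E) ->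
  (forall H : 'I_N -> 'M[C]_(2 ^ n),
     (forall j, cliff_sub Q (V j) (H j)) -> (forall j, adj (H j) = H j) ->
     complex.Re (tau (expmx (\sum_j H j))) <= \prod_j exp_norm (p j) (H j)) ->
  qform_le (\sum_j fine (p j)^-1%E *: orthproj (V j)) 1%:M.
Proof.
move=> p1 ineq x; set S := \sum_j _; pose c j : R := fine (p j)^-1%E.
have c0 j : 0 <= c j by rewrite fine_ge0 // inve_ge0 (le_trans _ (p1 j)) // lee01.
pose P j := x *m orthproj (V j).
have PP j : dotv (P j) (P j) = (x *m orthproj (V j) *m x^T) 0 0.
  have [m [u onu]] := exists_orthonormal (V j); have [uu _] := onu.
  rewrite dotvE /P (orthproj_onb onu) trmx_mul trmx_mul trmxK !mulmxA.
  by rewrite -(mulmxA _ u u^T) uu mulmx1.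
pose z j := Num.sqrt (dotv (P j) (P j)).
have z0 j : 0 <= z j by apply: sqrtr_ge0.
have z2 j : z j ^+ 2 = dotv (P j) (P j) by rewrite sqr_sqrtr // dotv_ge0.
pose b := \sum_j c j * z j ^+ 2; pose a := Num.sqrt (dotv (x *m S) (x *m S)).
have bE : (x *m S *m x^T) 0 0 = b.
  rewrite /S mulmx_sumr mulmx_suml summxE; apply: eq_bigr => j _.
  by rewrite -scalemxAr -scalemxAl mxE z2 PP.
have ab : a ^+ 2 <= b.
  (* The sum of all [z j] dominates each of them, which gives one common exponential factor in the
     upper bounds from [hcos_le]. *)
  apply: (@hcos_second_order R a b (\sum_j z j)); rewrite ?sqrtr_ge0 ?sumr_ge0 //.
    by move=> j _; rewrite mulr_ge0 ?sqr_ge0.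
  move=> t t0; pose H j := Jmap Q (c j *: (t *: P j)).
  have := ineq H; rewrite -Jmap_sum.
  have -> : \sum_j c j *: (t *: P j) = t *: (x *m S).
    rewrite /S mulmx_sumr scaler_sumr; apply: eq_bigr => j _.
    by rewrite -scalemxAr !scalerA mulrC.
  have nt v : Num.sqrt (dotv (t *: v) (t *: v)) = t * Num.sqrt (dotv v v).
    have -> : dotv (t *: v) (t *: v) = t ^+ 2 * dotv v v.
      by rewrite /dotv mulr_sumr; apply: eq_bigr => k _; rewrite !mxE; ring.
    by rewrite sqrtrM ?sqr_ge0 // sqrtr_sqr ger0_norm // ltW.
  rewrite Re_tau_exp_Jmap nt -/a => h; apply: le_trans (h _ _) _.
  - move=> j; apply: cliff_sub_Jmap; rewrite !scalemx_sub //; exact: orthproj_sub.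
  - by move=> j; apply: (adj_Jmap cQ).
  apply: le_trans (_ : \prod_j hcos (t * z j) `^ c j <= _).
    apply: ler_prod => j _; apply/andP; split.
      by apply/ltW/exp_norm_gt0 => //; apply: (adj_Jmap cQ).
    by have := exp_norm_Jmap (t *: P j) (p1 j); rewrite nt.
  have -> : t ^+ 2 / 2 * (b * expR (t * \sum_j z j)) =
      \sum_j c j * ((t * z j) ^+ 2 / 2 * expR (t * \sum_k z k)).
    rewrite /b mulr_suml mulr_sumr; apply: eq_bigr => j _; rewrite exprMn; ring.
  rewrite expR_sum; apply: ler_prod => j _; rewrite powR_ge0 /=.
  have tz : 0 <= t * z j by rewrite mulr_ge0 // ltW.
  rewrite [c j * _]mulrC expRM.
  apply: ge0_ler_powR; rewrite ?nnegrE ?expR_ge0 ?(ltW (hcos_gt0 _)) //.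
  apply: le_trans (hcos_le tz) _; rewrite ler_expR ler_wpM2l ?divr_ge0 ?sqr_ge0 // ler_expR.
  by rewrite ler_wpM2l ?(ltW t0) // (bigD1 j) //= lerDl sumr_ge0.
(* From |x - S x|^2 >= 0 and |S x|^2 <= b one gets 2 b <= |x|^2 + b, that is b <= |x|^2. *)
rewrite mulmx1 bE -dotvE; have := dotv_ge0 (x - x *m S).
have -> : dotv (x - x *m S) (x - x *m S) = dotv x x - 2 * b + a ^+ 2.
  have -> : a ^+ 2 = dotv (x *m S) (x *m S) by rewrite sqr_sqrtr // dotv_ge0.
  have -> : b = dotv (x *m S) x by rewrite dotvE.
  move: (x *m S) => y; rewrite /dotv mulr_sumr -sumrB -big_split /=.
  by apply: eq_bigr => k _; rewrite !mxE; ring.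
lra.
Qed.

End Necessity.

Theorem theorem1p6 (R : realType) (n N : nat)
    (Q : 'I_n -> 'M[R[i]]_(2 ^ n)) (V : 'I_N -> 'M[R]_n) (p : 'I_N -> \bar R) :
  (1 < n)%N ->
  clifford_generators Q ->
  (forall j, (1 <= p j)%E) ->
  (forall H : 'I_N -> 'M[R[i]]_(2 ^ n),
     (forall j, cliff_sub Q (V j) (H j)) ->
     (forall j, H j \is hermsymmx) ->
     complex.Re (tau (expmx (\sum_j H j))) <= \prod_j exp_norm (p j) (H j))
  <->
  qform_le (\sum_j fine (p j)^-1%E *: orthproj (V j)) 1%:M.
Proof.
move=> _ cQ p1; split=> [ineq | qle H HV hH].
  apply: (brascamp_necessary cQ p1) => H HV hH; apply: ineq => // j.
  exact/hermP/hH.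
by apply: (brascamp_sufficient cQ p1 qle HV) => j; apply/hermP/hH.
Qed.
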